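(* Let $(M^2,g)$ be a complete Riemannian surface homeomorphic to $\mathbb R^2$, and let $\mathcal F$ be a geodesic line foliation on $M$. Then $\mathcal F$ is homeomorphic to the standard straight line foliation on the Euclidean plane $\mathbb R^2$; that is, there is a homeomorphism $M\to\mathbb R^2$ carrying the leaves of $\mathcal F$ onto the lines $\mathbb R\times\{c\}$, $c\in\mathbb R$.
   Context: A (geodesic) line in $M$ is a smooth curve $\gamma:(-\infty,\infty)\to M$ with $\operatorname{dist}(\gamma(t),\gamma(s))=|t-s|$ for all $t,s\in\mathbb R$. A geodesic line foliation on $M$ is a (one-dimensional) foliation of $M$ all of whose leaves are (images of) geodesic lines. No assumption on conjugate points is made. *)

(* Defs.v *)
From HB Require Import structures.
From Stdlib Require Import Relations.
From mathcomp Require Import all_boot all_order all_algebra.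
From mathcomp Require Import all_classical all_reals all_analysis.

Set Implicit Arguments.
Unset Strict Implicit.
Unset Printing Implicit Defensive.

Import Order.TTheory GRing.Theory Num.Theory.
Import numFieldNormedType.Exports.

Local Open Scope classical_set_scope.
Local Open Scope ring_scope.

Definition homeomorphism (S T : topologicalType) (f : S -> T) : Prop :=
  continuous f /\
  exists f' : T -> S, [/\ continuous f', cancel f f' & cancel f' f].

(* [f] is of class C^k on the open set [U]; only the values of [f] on [U]
   matter. For finite-dimensional [V], asking for all directional derivatives
   is the same as asking for the partial derivatives. *)
Fixpoint class_C (R : realType) (V W : normedModType R) (k : nat)
    (U : set V) (f : V -> W) : Prop :=
  {in U, continuous f} /\
  if k is k'.+1 then
    forall v : V, {in U, forall x, derivable f x v} /\
                  class_C k' U (fun x => 'D_v f x)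
  else True.

Definition smooth_on (R : realType) (V W : normedModType R)
    (U : set V) (f : V -> W) : Prop :=
  forall k, class_C k U f.

(* A chart is given by total functions; [cfun] is meaningful only on [dom] and
   [cinv] only on the image [cod] of [dom]. *)
Record chart (R : realType) (M : topologicalType) := Chart {
  dom : set M;
  cfun : M -> R * R;
  cinv : R * R -> M }.

Definition cod (R : realType) (M : topologicalType) (c : chart R M) :
  set (R * R) := cfun c @` dom c.

Definition is_chart (R : realType) (M : topologicalType) (c : chart R M) :
    Prop :=
  [/\ open (dom c), open (cod c),
      {in dom c, continuous (cfun c)},
      {in cod c, continuous (cinv c)} &
      {in dom c, cancel (cfun c) (cinv c)}].

Definition transition (R : realType) (M : topologicalType) (c d : chart R M) :
  R * R -> R * R := cfun d \o cinv c.

(* [metric c x u v] is g(u, v) for tangent vectors u, v at the point of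
   coordinates [x], all read in the chart [c]. The choice [chart_at] of a chart
   around each point only serves to write down chart-independent quantities. *)
Record riemannian_surface (R : realType) (M : topologicalType) :=
  RiemannianSurface {
  surface_hausdorff : hausdorff_space M;
  surface_second_countable : @second_countable M;
  atlas : set (chart R M);
  atlas_chart : forall c, atlas c -> is_chart c;
  chart_at : M -> chart R M;
  chart_at_atlas : forall p, atlas (chart_at p);
  chart_at_dom : forall p, dom (chart_at p) p;
  transition_smooth : forall c d, atlas c -> atlas d ->
    smooth_on (cfun c @` (dom c `&` dom d)) (transition c d);
  metric : chart R M -> R * R -> R * R -> R * R -> R;
  metric_linear : forall c x, atlas c -> cod c x ->
    forall (a : R) (u v w : R * R),
      metric c x (a *: u + v) w = a * metric c x u w + metric c x v w;
  metric_sym : forall c x, atlas c -> cod c x ->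
    forall u v : R * R, metric c x u v = metric c x v u;
  metric_posdef : forall c x, atlas c -> cod c x ->
    forall u : R * R, u != 0 -> 0 < metric c x u u;
  metric_smooth : forall c, atlas c -> forall u v : R * R,
    smooth_on (cod c) (fun x => metric c x u v);
  metric_compat : forall c d p, atlas c -> atlas d -> dom c p -> dom d p ->
    forall u v : R * R,
      metric d (cfun d p) ('D_u (transition c d) (cfun c p))
                          ('D_v (transition c d) (cfun c p))
      = metric c (cfun c p) u v }.

Definition smooth_curve_on (R : realType) (M : topologicalType)
    (g : riemannian_surface R M) (I : set R) (gamma : R -> M) : Prop :=
  {in I, continuous gamma} /\
  forall c, atlas g c ->
    smooth_on (I `&` gamma @^-1` dom c) (cfun c \o gamma).

Definition speed (R : realType) (M : topologicalType)
    (g : riemannian_surface R M) (gamma : R -> M) (t : R) : R :=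
  let c := chart_at g (gamma t) in
  let u := derive1 (cfun c \o gamma) t in
  Num.sqrt (metric g c (cfun c (gamma t)) u u).

Definition curve_length (R : realType) (M : topologicalType)
    (g : riemannian_surface R M) (gamma : R -> M) (a b : R) : R :=
  (\int[lebesgue_measure]_(t in `[a, b]) speed g gamma t)%R.

(* [path_length g p q l]: some piecewise smooth curve from [p] to [q] has
   length [l]. Each piece is smooth on a compact interval [a, b] in the sense
   that it extends smoothly to an open interval around it. *)
Inductive path_length (R : realType) (M : topologicalType)
    (g : riemannian_surface R M) : M -> M -> R -> Prop :=
| path_length_nil p : path_length g p p 0
| path_length_cons (gamma : R -> M) (a b e : R) q l :
    a <= b -> 0 < e ->
    smooth_curve_on g `]a - e, b + e[ gamma ->
    path_length g (gamma b) q l ->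
    path_length g (gamma a) q (curve_length g gamma a b + l).

Definition dist (R : realType) (M : topologicalType)
    (g : riemannian_surface R M) (p q : M) : R :=
  inf [set l | path_length g p q l].

Definition complete_surface (R : realType) (M : topologicalType)
    (g : riemannian_surface R M) : Prop :=
  forall u : nat -> M,
    (forall e : R, 0 < e -> exists N, forall m n,
       (N <= m)%N -> (N <= n)%N -> dist g (u m) (u n) < e) ->
    exists p, forall e : R, 0 < e -> exists N, forall n,
       (N <= n)%N -> dist g (u n) p < e.

Definition geodesic_line (R : realType) (M : topologicalType)
    (g : riemannian_surface R M) (gamma : R -> M) : Prop :=
  smooth_curve_on g setT gamma /\
  forall t s : R, dist g (gamma t) (gamma s) = `|t - s|.

(* A one-dimensional topological foliation, given by an atlas of charts onto
   open rectangles whose changes of coordinates are locally of the form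
   (x, y) |-> (f (x, y), h y); the plaques are the horizontal segments. *)
Record foliation (R : realType) (M : topologicalType) := Foliation {
  fatlas : set (chart R M);
  fatlas_chart : forall c, fatlas c -> is_chart c;
  fatlas_rectangle : forall c, fatlas c -> exists a b a' b' : R,
    [/\ a < b, a' < b' & cod c = `]a, b[ `*` `]a', b'[];
  fatlas_cover : forall p, exists2 c, fatlas c & dom c p;
  fatlas_compat : forall c d p, fatlas c -> fatlas d -> dom c p -> dom d p ->
    exists2 N, nbhs p N & forall q r, N q -> N r ->
      (cfun c q).2 = (cfun c r).2 -> (cfun d q).2 = (cfun d r).2 }.

Definition same_plaque (R : realType) (M : topologicalType)
    (F : foliation R M) (p q : M) : Prop :=
  exists c, [/\ fatlas F c, dom c p, dom c q & (cfun c p).2 = (cfun c q).2].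

Definition leaf (R : realType) (M : topologicalType)
    (F : foliation R M) (p : M) : set M :=
  [set q | clos_refl_trans M (same_plaque F) p q].

Definition leaves (R : realType) (M : topologicalType)
    (F : foliation R M) : set (set M) := range (leaf F).

Definition geodesic_line_foliation (R : realType) (M : topologicalType)
    (g : riemannian_surface R M) (F : foliation R M) : Prop :=
  forall L, leaves F L -> exists2 gamma, geodesic_line g gamma & L = range gamma.

(* Main.v *)
(* Symmetrizing the Riemannian distance gives a metric D which induces the
   topology and for which every leaf is an isometrically embedded line. Since [M]
   is a plane, locally constant Z/2-valued cocycles on it are coboundaries; hence
   the leaves can be oriented coherently, and become the orbits of a continuous
   flow. As q = flow p t forces |t| = D p q, the relation of being on the same leaf
   is closed, i.e. the leaf space is Hausdorff. A second cocycle shows that each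
   leaf p has two sides, so that the transverse coordinate near p extends to a
   continuous function M -> [-1, 1], constant on leaves and equal to -1 or 1 far
   from p. With suitable signs these functions order the leaf space totally, and
   a convergent sum of countably many of them is a strictly increasing continuous
   parameter f of the leaves, whose image is an open interval, rescaled to R. The
   other coordinate of the trivialization is inf_s (2 D(p0, flow p s) - s), which
   increases at unit speed along the flow. *)
From HB Require Import structures.
From Stdlib Require Import Relations.
Require Import Defs.
From mathcomp Require Import all_boot all_order all_algebra.
From mathcomp Require Import all_classical all_reals all_analysis.
From mathcomp Require Import ring lra.
Set Implicit Arguments.
Unset Strict Implicit.
Unset Printing Implicit Defensive.
Import Order.TTheory GRing.Theory Num.Theory.
Import numFieldNormedType.Exports.
Local Open Scope classical_set_scope.
Local Open Scope ring_scope.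

(** * Cocycles on the plane *)

(** The leaves are given as isometric lines of [M], the foliation only through its plaques, and the
    two are tied by the topology of [M] alone. A priori the parameter of a leaf need not follow the
    plaques, and a leaf may return to a chart infinitely often. Both are excluded by the equality of
    time and distance along a leaf: in the first case a rectangle would embed in a line, and in the
    second two points of a leaf that are close in [M] are also close in time. This makes every later
    local statement uniform. The global shape of the plane enters through two facts only, constancy
    of locally constant functions and triviality of Z/2-valued cocycles. They take the place of
    covering spaces for the orientation and of the Jordan curve theorem for the sides of a leaf.
    Separation statements are accordingly phrased as: a function that is locally constant off a leaf
    is constant on each side of it. *)

Lemma connected_locally_constant (T : topologicalType) (Y : Type) (A : set T)
    (f : T -> Y) :
  connected A ->
  (forall x, A x -> \forall y \near x, A y -> f y = f x) ->
  forall x y, A x -> A y -> f x = f y.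
Proof.
move=> Ac fl x y Ax Ay.
suff /seteqP[_ /(_ y Ay)[_ ->]] : A `&` [set z | f z = f x] = A by [].
apply: Ac; first by exists x.
- exists [set z | \forall w \near z, A w -> f w = f x].
    exact: open_interior.
  apply/seteqP; split => z [Az /= fz]; split => //=.
    by apply: filterS (fl z Az) => w h /h ->.
  exact: (nbhs_singleton fz).
- exists (~` [set z | \forall w \near z, A w -> f w <> f x]).
    by apply: open_closedC; exact: open_interior.
  apply/seteqP; split => z [Az /= fz]; split => //=.
    by move=> /nbhs_singleton /(_ Az).
  apply: contrapT => ne; apply: fz.
  by apply: filterS (fl z Az) => w h /h ->.
Qed.

Lemma nbhsRP (R : realType) (x : R) (P : set R) :
  (\forall y \near x, P y) <->
  exists2 e : R, 0 < e & forall y, `|x - y| < e -> P y.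
Proof.
split=> [/nbhs_ballP[e /= e0 h]|[e e0 h]]; first by exists e => // y ?; exact: h.
by apply/nbhs_ballP; exists e => // y ?; exact: h.
Qed.

Lemma near_gt (R : realType) (T : topologicalType) (f : T -> R) x a :
  {for x, continuous f} -> a < f x -> \forall y \near x, a < f y.
Proof. by move=> c h; exact: (cvgr_gt _ c). Qed.

Lemma near_lt (R : realType) (T : topologicalType) (f : T -> R) x a :
  {for x, continuous f} -> f x < a -> \forall y \near x, f y < a.
Proof. by move=> c h; exact: (cvgr_lt _ c). Qed.

(** A subdivision argument without Lebesgue numbers: the truth value of the proposition [f x] is
    locally constant on the connected set [[a, b]]. *)
Lemma interval_ind (R : realType) (P : R -> R -> Prop) :
  (forall a b c, a <= b -> b <= c -> P a b -> P b c -> P a c) ->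
  (forall x, exists2 e : R, 0 < e &
     forall u v, x - e < u -> u <= v -> v < x + e -> P u v) ->
  forall a b, a <= b -> P a b.
Proof.
move=> tr loc a b ab.
pose f x := forall z, a <= z -> z <= x -> P a z.
have cf : connected `[a, b] by exact: segment_connected.
have : f a = f b.
  apply: (connected_locally_constant cf); rewrite /= ?in_itv /= ?lexx ?ab //.
  move=> x; rewrite /= in_itv /= => /andP[ax xb].
  have [e e0 he] := loc x; apply/nbhsRP; exists e => // y.
  rewrite ltr_distlC => /andP[xy yx]; rewrite in_itv /= => /andP[ay yb].
  apply/propext; split=> h z az zx.
    have [zy|yz] := leP z y; first exact: h.
    by apply: (tr _ _ _ ay (ltW yz)); [exact: h | apply: he => //; lra].
  have [zy|yz] := leP z x; first exact: h.
  by apply: (tr _ _ _ ax (ltW yz)); [exact: h | apply: he => //; lra].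
have fa : f a.
  move=> z az za; have -> : z = a by lra.
  by have [e e0] := loc a; apply => //; lra.
by move=> fab; move: fa; rewrite fab; apply.
Qed.

Section Plane.
Variable R : realType.
Implicit Types (p q : R * R) (A B : set (R * R)).

Lemma nbhsRRP p (P : set (R * R)) :
  (\forall q \near p, P q) <->
  exists2 e : R, 0 < e &
    forall q, `|p.1 - q.1| < e -> `|p.2 - q.2| < e -> P q.
Proof.
split=> [/nbhs_ballP[e /= e0 h]|[e e0 h]]; first by exists e => // q *; exact: h.
by apply/nbhs_ballP; exists e => // q [*]; exact: h.
Qed.

Definition convexRR A := forall p q (u : R), A p -> A q -> 0 <= u <= 1 ->
  A (p + u *: (q - p)).

Lemma convex_locally_constant (Y : Type) A (f : R * R -> Y) :
  convexRR A -> (forall p, A p -> \forall q \near p, A q -> f q = f p) ->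
  forall p q, A p -> A q -> f p = f q.
Proof.
move=> cA lf p q Ap Aq.
pose c (u : R) : R * R := p + u *: (q - p).
have cc : continuous c.
  by rewrite /c => u; apply: cvgD; [exact: cvg_cst | exact: scalel_continuous].
have : (f \o c) 0 = (f \o c) 1.
  apply: (@connected_locally_constant _ _ `[(0 : R), 1]).
  - exact: segment_connected.
  - move=> u /=; rewrite in_itv /= => u01.
    have H : \forall v \near u, A (c v) -> f (c v) = f (c u).
      exact: (cc u _ (lf (c u) (cA _ _ _ Ap Aq u01))).
    apply: filterS H => v /= h; rewrite in_itv /= => v01.
    by apply: h; exact: cA.
  - by rewrite /= in_itv /= lexx ler01.
  - by rewrite /= in_itv /= lexx ler01.
by rewrite /c /= scale0r addr0 scale1r addrC subrK.
Qed.

Definition rect (a b c d : R) : set (R * R) :=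
  [set p | a <= p.1 <= b /\ c <= p.2 <= d].

Lemma rect_convex a b c d : convexRR (rect a b c d).
Proof.
move=> [p1 p2] [q1 q2] u [/= /andP[h1 h2] /andP[h3 h4]] [/= /andP[g1 g2] /andP[g3 g4]].
move=> /andP[u0 u1]; rewrite /GRing.scale /=.
split; apply/andP; split => /=; rewrite /GRing.scale /=; nra.
Qed.

Lemma rectI a b c d a' b' c' d' :
  rect a b c d `&` rect a' b' c' d' =
  rect (Num.max a a') (Num.min b b') (Num.max c c') (Num.min d d').
Proof.
apply/seteqP; split=> p; rewrite /rect /= !ge_max !le_min.
  by move=> [[/andP[-> ->] /andP[-> ->]] [/andP[-> ->] /andP[-> ->]]].
by move=> [/andP[/andP[-> ->] /andP[-> ->]] /andP[/andP[-> ->] /andP[-> ->]]].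
Qed.

Lemma rect_closed a b c d : closed (rect a b c d).
Proof.
move=> p clp.
have H e : 0 < e -> exists q, [/\ rect a b c d q, `|p.1 - q.1| < e & `|p.2 - q.2| < e].
  move=> e0; have [] := clp [set q | `|p.1 - q.1| < e /\ `|p.2 - q.2| < e].
    by apply/nbhsRRP; exists e.
  by move=> q [? []]; exists q.
split; apply/andP; split; apply/ler_addgt0Pr => e /H[q];
  rewrite !ltr_distlC; case=> -[/= /andP[? ?] /andP[? ?]] /andP[? ?] /andP[? ?]; lra.
Qed.

(* [t p] is a primitive, near [p], of a locally constant Z/2-valued cocycle;
   [section_on A s] means that [s] is a primitive of it on [A]. *)
Variable t : R * R -> R * R -> bool.
Hypothesis t_coh : forall p, \forall q \near p, \forall r \near q,
  t p r (+) t q r = t p q (+) t q q.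

Definition section_on A (s : R * R -> bool) := forall p, A p ->
  \forall q \near p, A q -> s q (+) t p q = s p (+) t p p.

Lemma section_sub A B s : A `<=` B -> section_on B s -> section_on A s.
Proof.
move=> AB sB p /AB/sB; apply: filterS => q h /AB; exact: h.
Qed.

Lemma section_local p : exists2 e : R, 0 < e &
  section_on [set q | `|p.1 - q.1| < e /\ `|p.2 - q.2| < e] (t p).
Proof.
have /nbhsRRP[e e0 he] := t_coh p; exists e => // q [q1 q2].
by apply: filterS (he q q1 q2) => r h _.
Qed.

Lemma section_unique A s1 s2 : convexRR A -> section_on A s1 ->
  section_on A s2 -> forall p q, A p -> A q -> s1 p (+) s2 p = s1 q (+) s2 q.
Proof.
move=> cA h1 h2; apply: (@convex_locally_constant _ A (fun p => s1 p (+) s2 p)) => // p Ap.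
apply: filterS2 (h1 p Ap) (h2 p Ap) => q g1 g2 Aq; move: (g1 Aq) (g2 Aq).
by case: (s1 q); case: (s2 q); case: (s1 p); case: (s2 p); case: (t p q); case: (t p p).
Qed.

(** On the convex overlap the two primitives differ by a constant [k], which corrects [s2].
    Closedness makes the check local: near a point outside [A] there is no point of [A] to compare
    with, and likewise for [B]. *)
Lemma section_glue A B s1 s2 : closed A -> closed B -> convexRR (A `&` B) ->
  section_on A s1 -> section_on B s2 -> exists s, section_on (A `|` B) s.
Proof.
move=> clA clB cAB h1 h2.
have [k hk] : exists k, forall q, A q -> B q -> s1 q = s2 q (+) k.
  have [[p0 [A0 B0]]|h] := pselect (A `&` B !=set0); last first.
    by exists false => q Aq Bq; exfalso; apply: h; exists q.
  exists (s1 p0 (+) s2 p0) => q Aq Bq.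
  have <- := section_unique cAB (section_sub (@subIsetl _ A B) h1)
    (section_sub (@subIsetr _ A B) h2) (conj Aq Bq) (conj A0 B0).
  by case: (s1 q); case: (s2 q).
pose s q := if `[< A q >] then s1 q else s2 q (+) k.
have sA q : A q -> s q = s1 q by move=> Aq; rewrite /s asboolT.
have sB q : B q -> s q = s2 q (+) k.
  by move=> Bq; rewrite /s; case: asboolP => // Aq; exact: hk.
have nA p : \forall q \near p, A q -> A p.
  have [Ap|nAp] := pselect (A p); first by near=> q.
  have : \forall q \near p, (~` A) q by apply: open_nbhs_nbhs; split => //; exact: closed_openC.
  by apply: filterS => q.
have nB p : \forall q \near p, B q -> B p.
  have [Bp|nBp] := pselect (B p); first by near=> q.
  have : \forall q \near p, (~` B) q by apply: open_nbhs_nbhs; split => //; exact: closed_openC.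
  by apply: filterS => q.
have h1' p : \forall q \near p, A q -> s q (+) t p q = s p (+) t p p.
  have [Ap|nAp] := pselect (A p); last by apply: filterS (nA p) => q h /h.
  by apply: filterS (h1 p Ap) => q h Aq; rewrite !sA // h.
have h2' p : \forall q \near p, B q -> s q (+) t p q = s p (+) t p p.
  have [Bp|nBp] := pselect (B p); last by apply: filterS (nB p) => q h /h.
  by apply: filterS (h2 p Bp) => q h Bq; rewrite !sB // addbAC h // addbAC.
exists s => p _; near=> q => -[].
  by near: q; exact: h1'.
by near: q; exact: h2'.
Unshelve. all: by end_near.
Qed.

(** Two subdivisions: small squares are stacked into a thin column, whose half-width [e] may shrink
    at each gluing, and columns are then put side by side. Overlaps of rectangles are rectangles,
    hence convex. *)
Lemma section_rect a b c d : a <= b -> c <= d ->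
  exists s, section_on (rect a b c d) s.
Proof.
have column x y1 y2 : y1 <= y2 -> exists2 e : R, 0 < e &
    exists s, section_on (rect (x - e) (x + e) y1 y2) s.
  move: y1 y2; apply: interval_ind.
    move=> u v w uv vw [e1 e10 [s1 h1]] [e2 e20 [s2 h2]].
    exists (Num.min e1 e2); first by rewrite lt_min e10.
    set e := Num.min e1 e2.
    have e_le1 : e <= e1 by rewrite ge_min lexx.
    have e_le2 : e <= e2 by rewrite ge_min lexx orbT.
    have g1 : section_on (rect (x - e) (x + e) u v) s1.
      by apply: section_sub h1 => q [/= ? ?]; split => //=; lra.
    have g2 : section_on (rect (x - e) (x + e) v w) s2.
      by apply: section_sub h2 => q [/= ? ?]; split => //=; lra.
    have [|s hs] := section_glue (@rect_closed _ _ _ _) (@rect_closed _ _ _ _) _ g1 g2.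
      by rewrite rectI; exact: rect_convex.
    exists s; apply: section_sub hs => q [/= ? /andP[q1 q2]].
    have [qv|vq] := leP q.2 v; [left|right]; split => //; lra.
  move=> y; have [e e0 he] := section_local (x, y).
  exists e => // u v ? ? ?; exists (e / 2); first lra.
  exists (t (x, y)); apply: section_sub he => q [/= ? ?]; split => /=;
    rewrite ltr_distlC; lra.
move=> + cd; move: a b; apply: interval_ind.
  move=> u v w uv vw [s1 g1] [s2 g2].
  have [|s hs] := section_glue (@rect_closed _ _ _ _) (@rect_closed _ _ _ _) _ g1 g2.
    by rewrite rectI; exact: rect_convex.
  exists s; apply: section_sub hs => q [/= /andP[q1 q2] ?].
  have [qv|vq] := leP q.1 v; [left|right]; split => //; lra.
move=> x; have [e e0 [s hs]] := column x _ _ cd.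
exists e => // u v ? ? ?; exists s; apply: section_sub hs => q [/= ? ?].
by split => //=; lra.
Qed.

Lemma plane_section : exists s, section_on setT s.
Proof.
pose Q (n : nat) := rect (- n%:R) n%:R (- n%:R) n%:R.
have Q0 n : Q n 0 by split; rewrite /= oppr_le0 ler0n.
(* Primitives normalized at the origin agree wherever two of the squares overlap. *)
have /choice[s hs] n : exists s, section_on (Q n) s /\ s 0 = false.
  have [||s hs] := @section_rect (- n%:R) n%:R (- n%:R) n%:R.
  - by rewrite ge0_cp ?ler0n.
  - by rewrite ge0_cp ?ler0n.
  exists (fun q => s q (+) s 0); split; last by rewrite addbb.
  by move=> p Qp; apply: filterS (hs p Qp) => q h Qq; rewrite addbAC h // addbAC.
have eqs m n q : Q m q -> Q n q -> s m q = s n q.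
  move=> Qm Qn.
  have cQ : convexRR (Q m `&` Q n) by rewrite /Q rectI; exact: rect_convex.
  have := section_unique cQ (section_sub (@subIsetl _ _ _) (hs m).1)
    (section_sub (@subIsetr _ _ _) (hs n).1) (conj Qm Qn) (conj (Q0 m) (Q0 n)).
  by rewrite (hs m).2 (hs n).2; case: (s m q); case: (s n q).
pose N (q : R * R) := (Num.truncn (Num.max `|q.1| `|q.2|)).+1.
have NQ q n : (N q <= n)%N -> `|q.1| <= n%:R /\ `|q.2| <= n%:R.
  rewrite -(@ler_nat R) => Nn.
  have := truncnS_gt (Num.max `|q.1| `|q.2|); rewrite -/(N q) gt_max.
  by move=> /andP[h1 h2]; split; apply: ltW; exact: lt_le_trans Nn.
have QN q n : (N q <= n)%N -> Q n q by move=> /NQ[]; rewrite !ler_norml.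
exists (fun q => s (N q) q) => p _.
(* The square of index [N p] contains [p]; the next one contains a neighbourhood of [p]. *)
have Qp : Q (N p).+1 p by exact: QN.
have loc := (hs (N p).+1).1 p Qp.
have nQ : \forall q \near p, Q (N p).+1 q.
  apply/nbhsRRP; exists 1 => // q; rewrite !ltr_distlC => h1 h2.
  have [] := NQ p (N p) (leqnn _); rewrite !ler_norml => h3 h4.
  by split; rewrite -natr1; lra.
near=> q => _; rewrite (eqs _ (N p).+1) ?(eqs (N p) (N p).+1 p) //; try exact: QN.
  by near: q; apply: filterS2 loc nQ => q; apply.
by near: q.
Unshelve. all: by end_near.
Qed.

End Plane.

(** * Leaves in a foliated chart *)

Section PlaneLike.
Variables (R : realType) (M : topologicalType).
Hypothesis M_plane : exists f : M -> R * R, homeomorphism f.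

Lemma plane_locally_constant (Y : Type) (f : M -> Y) :
  (forall p, \forall q \near p, f q = f p) -> forall p q, f p = f q.
Proof.
move=> lf p q; have [h [ch [h' [ch' hK h'K]]]] := M_plane.
rewrite -(hK p) -(hK q).
apply: (@convex_locally_constant R Y setT (f \o h')) => // x _.
have H : \forall y \near x, f (h' y) = f (h' x) by exact: (ch' x _ (lf (h' x))).
by apply: filterS H.
Qed.

Lemma plane_cocycle (t : M -> M -> bool) :
  (forall p, \forall q \near p, \forall r \near q,
     t p r (+) t q r = t p q (+) t q q) ->
  exists s : M -> bool,
    forall p, \forall q \near p, s q (+) t p q = s p (+) t p p.
Proof.
move=> tc; have [h [ch [h' [ch' hK h'K]]]] := M_plane.
have [|s hs] := @plane_section R (fun x y => t (h' x) (h' y)).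
  move=> x; have H : \forall y \near x, \forall r \near h' y,
      t (h' x) r (+) t (h' y) r = t (h' x) (h' y) (+) t (h' y) (h' y).
    exact: (ch' x _ (tc (h' x))).
  by apply: filterS H => y; exact: ch'.
exists (s \o h) => p.
have H : \forall q \near p, setT (h q) -> s (h q) (+) t (h' (h p)) (h' (h q)) =
    s (h p) (+) t (h' (h p)) (h' (h p)) by exact: (ch p _ (hs (h p) I)).
by apply: filterS H => q /=; rewrite !hK; apply.
Qed.

End PlaneLike.

Lemma IVT_real (R : realType) (f : R -> R) (a b v : R) : a <= b ->
  (forall x, a <= x <= b -> {for x, continuous f}) ->
  (f a <= v <= f b) || (f b <= v <= f a) ->
  exists2 x, a <= x <= b & f x = v.
Proof.
move=> ab cf vab.
have cf' : {within `[a, b], continuous f}.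
  by apply: continuous_in_subspaceT => x; rewrite inE /= in_itv /= => /cf.
have [|x] := @IVT R f a b v ab cf'.
  by rewrite ge_min le_max; case/orP: vab => /andP[-> ->]; rewrite ?orbT.
by rewrite in_itv /= => ? ?; exists x.
Qed.

Lemma isometry_line (R : realType) (j : R -> R) :
  (forall s t, `|j s - j t| = `|s - t|) -> j 0 = 0 ->
  (forall t, j t = t) \/ (forall t, j t = - t).
Proof.
move=> ij j0.
have j1 t : j t = t \/ j t = - t.
  by have := ij t 0; rewrite j0 !subr0 => /eqP; rewrite eqr_norm2 => /orP[]/eqP; auto.
have [h|h] := j1 1; [left|right] => t; have [ht|ht] := j1 t => //.
  by have := ij t 1; rewrite ht h => /eqP; rewrite eqr_norm2 => /orP[]/eqP; lra.
by have := ij t 1; rewrite ht h => /eqP; rewrite eqr_norm2 => /orP[]/eqP; lra.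
Qed.

(** The broken path from [a] to [b] through [c] and [d] passes over the midpoint of [a] and [b] on
    one of its three legs. The four numbers will be the values of a function at the corners of a
    rectangle. *)
Lemma midpoint_leg (R : realType) (a b c d : R) : a != b ->
  let m := (a + b) / 2 in
  [|| (a <= m <= c) || (c <= m <= a), (c <= m <= d) || (d <= m <= c) |
    (b <= m <= d) || (d <= m <= b)].
Proof.
rewrite neq_lt /= => /orP[]h;
have [h1|h1] := leP ((a + b) / 2) c; have [h2|h2] := leP ((a + b) / 2) d; lra.
Qed.

Lemma continuous_pair (T U V : topologicalType) (f : T -> U) (g : T -> V) x :
  {for x, continuous f} -> {for x, continuous g} ->
  {for x, continuous (fun y => (f y, g y))}.
Proof. by move=> cf cg; exact: (cvg_pair cf cg). Qed.

(** Only one implication relates plaques to leaves here, namely that a plaque lies in one leaf. Its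
    local converse, that a leaf meets a small ball in one plaque, is derived from the metric in
    [leaf_chartY]. *)
Definition foliated_chart (R : realType) (M : topologicalType)
    (lf : M -> M -> Prop) (c : chart R M) := [/\ is_chart c,
  exists a b a' b' : R, [/\ a < b, a' < b' & cod c = `]a, b[ `*` `]a', b'[] &
  forall q r, dom c q -> dom c r -> (cfun c q).2 = (cfun c r).2 -> lf q r].

(* A foliation by geodesic lines, seen through the symmetrized distance, with
   an arbitrarily oriented unit speed line [line p] through each point [p]. *)
Record lined_plane (R : realType) (M : topologicalType) := LinedPlane {
  ldist : M -> M -> R;
  ldist0 : forall p, ldist p p = 0;
  ldistC : forall p q, ldist p q = ldist q p;
  ldist_triangle : forall q p r, ldist p r <= ldist p q + ldist q r;
  ldist_nbhs : forall p (U : set M),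
    nbhs p U <-> exists2 e : R, 0 < e & forall q, ldist p q < e -> U q;
  same_leaf : M -> M -> Prop;
  same_leaf_sym : forall p q, same_leaf p q -> same_leaf q p;
  same_leaf_trans : forall q p r,
    same_leaf p q -> same_leaf q r -> same_leaf p r;
  leaf_chart : forall p, exists2 c : chart R M, foliated_chart same_leaf c & dom c p;
  line : M -> R -> M;
  line0 : forall p, line p 0 = p;
  line_dist : forall p s t, ldist (line p s) (line p t) = `|s - t|;
  line_leaf : forall p q, same_leaf p q <-> exists t, q = line p t;
  lined_plane_homeo : exists f : M -> R * R, homeomorphism f }.

Lemma foliated_chart_is_chart (R : realType) (M : topologicalType)
  (lf : M -> M -> Prop) (c : chart R M) : foliated_chart lf c -> is_chart c.
Proof. by case. Qed.

Coercion foliated_chart_is_chart : foliated_chart >-> is_chart.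

Section Charts.
Variables (R : realType) (M : topologicalType) (c : chart R M).
Hypothesis hc : is_chart c.

Definition chartX q := (cfun c q).1.
Definition chartY q := (cfun c q).2.

Lemma cfun_cont q : dom c q -> {for q, continuous (cfun c)}.
Proof. by have [_ _ h _ _] := hc => /mem_set; exact: h. Qed.

Lemma chartX_cont q : dom c q -> {for q, continuous chartX}.
Proof.
move=> h; apply: (@continuous_comp _ _ _ (cfun c) fst); first exact: cfun_cont.
exact: cvg_fst.
Qed.

Lemma chartY_cont q : dom c q -> {for q, continuous chartY}.
Proof.
move=> h; apply: (@continuous_comp _ _ _ (cfun c) snd); first exact: cfun_cont.
exact: cvg_snd.
Qed.

Lemma cinv_cont x : cod c x -> {for x, continuous (cinv c)}.
Proof. by have [_ _ _ h _] := hc => /mem_set; exact: h. Qed.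

Lemma cfunK q : dom c q -> cinv c (cfun c q) = q.
Proof. by have [_ _ _ _ h] := hc => /mem_set; exact: h. Qed.

Lemma cinvP x : cod c x -> dom c (cinv c x) /\ cfun c (cinv c x) = x.
Proof. by move=> [q cq <-]; rewrite cfunK. Qed.

Lemma cod_open x : cod c x -> \forall y \near x, cod c y.
Proof. by have [_ h _ _ _] := hc; move=> cx; exact: open_nbhs_nbhs. Qed.

Lemma dom_open x : dom c x -> \forall y \near x, dom c y.
Proof. by have [h _ _ _ _] := hc; move=> cx; exact: open_nbhs_nbhs. Qed.

Lemma chart_inj q r : dom c q -> dom c r -> chartX q = chartX r ->
  chartY q = chartY r -> q = r.
Proof.
move=> cq cr x y; rewrite -(cfunK cq) -(cfunK cr); congr cinv.
by move: x y; rewrite /chartX /chartY; case: (cfun c q) (cfun c r) => ? ? [? ?] /= -> ->.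
Qed.

End Charts.

Section Lines.
Variables (R : realType) (M : topologicalType) (S : lined_plane R M).
Local Notation D := (ldist S).
Local Notation lf := (same_leaf S).
Local Notation g0 := (line S).

Lemma ldist_ge0 p q : 0 <= D p q.
Proof. by have := ldist_triangle S q p p; rewrite ldist0 (ldistC _ q p); lra. Qed.

Lemma ldist_near p (e : R) : 0 < e -> \forall q \near p, D p q < e.
Proof. by move=> e0; apply/(ldist_nbhs S); exists e. Qed.

Lemma ldist_cont (T : topologicalType) (x : T) (f g : T -> M) :
  {for x, continuous f} -> {for x, continuous g} ->
  {for x, continuous (fun y => D (f y) (g y))}.
Proof.
move=> cf cg; apply/cvgrPdist_lt => e e0.
have e2 : 0 < e / 2 by lra.
have Hf : \forall y \near x, D (f x) (f y) < e / 2 by exact: (cf _ (ldist_near _ e2)).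
have Hg : \forall y \near x, D (g x) (g y) < e / 2 by exact: (cg _ (ldist_near _ e2)).
apply: filterS2 Hf Hg => y h1 h2.
have := ldist_triangle S (f y) (f x) (g x); have := ldist_triangle S (g y) (f y) (g x).
have := ldist_triangle S (f x) (f y) (g y); have := ldist_triangle S (g x) (f x) (g y).
rewrite (ldistC _ (f y) (f x)) (ldistC _ (g y) (g x)) ltr_distlC => *; lra.
Qed.

Lemma line_cont p : continuous (g0 p).
Proof.
move=> t U /(ldist_nbhs S)[e e0 h]; apply/nbhsRP; exists e => // s ts.
by apply: h; rewrite line_dist.
Qed.

Lemma line_inj p s t : g0 p s = g0 p t -> s = t.
Proof.
move=> h; have := line_dist S p s t; rewrite h ldist0 => /esym/eqP.
by rewrite normr_eq0 subr_eq0 => /eqP.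
Qed.

Section InChart.
Variable c : chart R M.
Hypothesis fc : foliated_chart lf c.

(* Otherwise, by the intermediate value theorem, the leaf would contain a closed
   rectangle of the chart, which would embed isometrically in the line. *)
Lemma plaque_segment q u v : u <= v ->
  (forall t, u <= t <= v -> dom c (g0 q t)) -> chartY c (g0 q u) = chartY c (g0 q v).
Proof.
move=> uv duv; apply: contrapT => ne.
have [_ [a [b [a' [b' [ab a'b' codc]]]]] plq] := fc.
(* By the intermediate value theorem the line takes all ordinates between two distinct values, so
   every plaque at these ordinates lies in the leaf of [q]. *)
wlog [y1 [y2 [y12 yin ylf]]] : / exists y1 y2, [/\ y1 < y2, a' < y1 /\ y2 < b' &
    forall y, y1 <= y <= y2 -> exists2 t, u <= t <= v & chartY c (g0 q t) = y].
  apply.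
  have inY t : u <= t <= v -> a' < chartY c (g0 q t) < b'.
    move=> /duv d; have : cod c (cfun c (g0 q t)) by exists (g0 q t).
    by rewrite codc => -[_]; rewrite /= in_itv.
  have cY t : u <= t <= v -> {for t, continuous (chartY c \o g0 q)}.
    by move=> /duv d; apply: continuous_comp; [exact: line_cont|exact: (chartY_cont fc)].
  have /andP[ui1 ui2] := inY u ltac:(lra).
  have /andP[vi1 vi2] := inY v ltac:(lra).
  have [lt|ge] := ltP (chartY c (g0 q u)) (chartY c (g0 q v)).
    exists (chartY c (g0 q u)), (chartY c (g0 q v)); split => // y yb.
    by apply: (IVT_real uv cY); rewrite /= yb.
  exists (chartY c (g0 q v)), (chartY c (g0 q u)); split => //.
    by rewrite lt_neqAle ge andbT; apply/eqP => /esym.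
  by move=> y yb; apply: (IVT_real uv cY); rewrite /= yb orbT.
have inc x y : a < x < b -> y1 <= y <= y2 -> cod c (x, y).
  move=> xab yy; rewrite codc; split; rewrite /= in_itv //=; lra.
(* [T z] is the parameter of [z] on the line of [q], with an irrelevant default off the leaf. Read
   in coordinates it gives [tau], injective and continuous on the rectangle. *)
have /choice[T hT] (z : M) : exists t, lf q z -> z = g0 q t.
  have [/line_leaf[t ->]|h] := pselect (lf q z); last by exists 0.
  by exists t.
pose tau x y := T (cinv c (x, y)).
have tauP x y : a < x < b -> y1 <= y <= y2 -> cinv c (x, y) = g0 q (tau x y).
  move=> xab yy; apply: hT; have [t tuv yt] := ylf y yy.
  have [d e] := cinvP fc (inc _ _ xab yy).
  apply: (@same_leaf_trans _ _ S (g0 q t)); first by apply/line_leaf; exists t.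
  by apply: plq => //; [exact: duv | rewrite e].
have tauI x y x' y' : a < x < b -> y1 <= y <= y2 -> a < x' < b -> y1 <= y' <= y2 ->
    tau x y = tau x' y' -> x = x' /\ y = y'.
  move=> h1 h2 h3 h4 e; have := tauP _ _ h1 h2; rewrite e -(tauP _ _ h3 h4).
  move=> /(congr1 (cfun c)).
  by rewrite (cinvP fc (inc _ _ h1 h2)).2 (cinvP fc (inc _ _ h3 h4)).2 => -[].
pose x1 := a + (b - a) / 3; pose x2 := b - (b - a) / 3.
have x1ab : a < x1 < b by rewrite /x1; lra.
have x2ab : a < x2 < b by rewrite /x2; lra.
have x12 : x1 < x2 by rewrite /x1 /x2; lra.
(* Clamping turns functions on a side of the rectangle into functions continuous on the whole
   line. *)
pose clamp (lo hi x : R) := Num.min hi (Num.max lo x).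
have clampE lo hi x : lo <= x <= hi -> clamp lo hi x = x.
  by move=> /andP[h1 h2]; rewrite /clamp max_r // min_r.
have clampP lo hi x : lo <= hi -> lo <= clamp lo hi x <= hi.
  by move=> h; rewrite /clamp le_min h le_max lexx /= ge_min lexx.
have clampC lo hi : continuous (clamp lo hi).
  move=> x; apply: continuous_min; first exact: cvg_cst.
  by apply: continuous_max; [exact: cvg_cst | exact: cvg_id].
have tau_cont (k : R -> R * R) : continuous k ->
    (forall s, a < (k s).1 < b /\ y1 <= (k s).2 <= y2) ->
    continuous (fun s => tau (k s).1 (k s).2).
  move=> ck ik s; apply/cvgrPdist_lt => e e0.
  have cc : {for s, continuous (cinv c \o k)}.
    apply: continuous_comp; first exact: ck.
    by apply: (cinv_cont fc); have [] := ik s; case: (k s) => /= *; exact: inc.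
  have H : \forall s' \near s, D (cinv c (k s)) (cinv c (k s')) < e by exact: (cc _ (ldist_near _ e0)).
  apply: filterS H => s'; have [i1 i2] := ik s; have [i1' i2'] := ik s'.
  by rewrite [k s]surjective_pairing [k s']surjective_pairing !tauP //= line_dist.
have hor y : y1 <= y <= y2 -> continuous (fun s => tau (clamp x1 x2 s) y).
  move=> yy; apply: (tau_cont (fun s => (clamp x1 x2 s, y))) => s /=.
    by apply: continuous_pair; [exact: clampC | exact: cvg_cst].
  by split => //; have := clampP x1 x2 s (ltW x12); lra.
have ver x : a < x < b -> continuous (fun s => tau x (clamp y1 y2 s)).
  move=> xx; apply: (tau_cont (fun s => (x, clamp y1 y2 s))) => s /=.
    by apply: continuous_pair; [exact: cvg_cst | exact: clampC].
  by split => //; exact: clampP (ltW y12).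
(* The value [m] is taken on the bottom side, and by [midpoint_leg] again on one of the three other
   sides. By injectivity the two points coincide, so they are a bottom corner; but [m] differs from
   the values at both bottom corners. *)
pose m := (tau x1 y1 + tau x2 y1) / 2.
have y1y : y1 <= y1 <= y2 by lra.
have y2y : y1 <= y2 <= y2 by lra.
have neA : tau x1 y1 != tau x2 y1.
  by apply/eqP => /(tauI _ _ _ _ x1ab y1y x2ab y1y)[]; lra.
have leg (k : R -> R) lo hi : lo <= hi -> continuous (fun s => k (clamp lo hi s)) ->
    (k lo <= m <= k hi) || (k hi <= m <= k lo) ->
    exists2 s, lo <= s <= hi & k s = m.
  move=> lh ck km; have [|s hs] := @IVT_real R _ lo hi m lh (fun x _ => ck x).
    by rewrite !clampE // lexx lh.
  by rewrite clampE // => <-; exists s.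
have [xm xmin xmE] : exists2 s, x1 <= s <= x2 & tau s y1 = m.
  apply: (leg (fun x => tau x y1)); [exact: ltW | exact: hor |].
  by rewrite /m; move: neA; rewrite neq_lt => /orP[]h; apply/orP; [left|right]; lra.
have xmab : a < xm < b by lra.
have := midpoint_leg (tau x1 y2) (tau x2 y2) neA; rewrite -/m.
move=> /or3P[] km.
- have [s sy sm] := leg (tau x1) _ _ (ltW y12) (ver _ x1ab) km.
  have [] := tauI _ _ _ _ x1ab sy xmab y1y; rewrite ?sm ?xmE // => e _.
  by move: xmE neA; rewrite -e /m => ? /eqP; lra.
- have [s sx sm] := leg (tau^~ y2) _ _ (ltW x12) (hor _ y2y) km.
  have [] := @tauI s y2 xm y1; rewrite ?sm ?xmE //; lra.
- have [s sy sm] := leg (tau x2) _ _ (ltW y12) (ver _ x2ab) km.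
  have [] := tauI _ _ _ _ x2ab sy xmab y1y; rewrite ?sm ?xmE // => e _.
  by move: xmE neA; rewrite -e /m => ? /eqP; lra.
Qed.

End InChart.
End Lines.

(** * The flow along the leaves *)

Definition jointly_continuous (R : realType) (M : topologicalType)
    (G : M -> R -> M) q s := forall U, nbhs (G q s) U ->
  exists2 k : R, 0 < k & \forall q' \near q, forall s', `|s - s'| < k -> U (G q' s').

Section LocalOrientation.
Variables (R : realType) (M : topologicalType) (S : lined_plane R M).
Local Notation D := (ldist S).
Local Notation lf := (same_leaf S).
Local Notation g0 := (line S).
Local Notation X := chartX.
Local Notation Y := chartY.

(** The factor 4 lets the line through any point of the ball of radius [ce.2] run inside the chart
    for all times below [3 * ce.2]. *)
Definition chart_ball (ce : chart R M * R) p := [/\ foliated_chart lf ce.1,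
  0 < ce.2 & forall q, D p q < 4 * ce.2 -> dom ce.1 q].

Lemma chart_ball_exists p : exists ce, chart_ball ce p.
Proof.
have [c fc dp] := leaf_chart S p.
have /(ldist_nbhs S)[e e0 he] := dom_open fc dp.
exists (c, e / 4); split => //=; first lra.
by move=> q h; apply: he; lra.
Qed.

Lemma line_distl q t : D q (g0 q t) = `|t|.
Proof. by rewrite -{1}(line0 S q) line_dist sub0r normrN. Qed.

Section Ball.
Variables (c : chart R M) (e : R) (p : M).
Hypothesis fc : foliated_chart lf c.
Hypothesis e0 : 0 < e.
Hypothesis dball : forall q, D p q < 4 * e -> dom c q.

Lemma line_dom q t : D p q < e -> `|t| < 3 * e -> dom c (g0 q t).
Proof.
move=> pq te; apply: dball; have := ldist_triangle S q p (g0 q t).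
by rewrite line_distl; lra.
Qed.

Lemma line_chartY q t : D p q < e -> `|t| < 3 * e -> Y c (g0 q t) = Y c q.
Proof.
move=> pq; rewrite ltr_norml => /andP[t1 t2].
have [t0|t0] := leP 0 t.
  rewrite -{2}(line0 S q); apply/esym; apply: (plaque_segment fc) => // u /andP[? ?].
  by apply: line_dom => //; rewrite ltr_norml; lra.
rewrite -{2}(line0 S q); apply: (plaque_segment fc); first exact: ltW.
by move=> u /andP[? ?]; apply: line_dom => //; rewrite ltr_norml; lra.
Qed.

(** The time from [q] to [r] along their leaf equals their distance, which is below [2 * e]; the
    segment of leaf between them therefore stays in the chart, on one plaque. A leaf cannot come
    back to the ball on another plaque. *)
Lemma leaf_chartY q r : D p q < e -> D p r < e -> lf q r -> Y c q = Y c r.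
Proof.
have e_gt0 := e0.
move=> pq pr /line_leaf[t rE]; rewrite rE line_chartY //.
rewrite -(line_distl q) -rE.
have := ldist_triangle S p q r; rewrite (ldistC _ q p);  lra.
Qed.

Definition orientation q : bool := X c q < X c (g0 q e).

Definition oline q t := g0 q (if orientation q then t else - t).

Lemma oline0 q : oline q 0 = q.
Proof. by rewrite /oline oppr0 if_same line0. Qed.

Lemma oline_dist q s t : D (oline q s) (oline q t) = `|s - t|.
Proof.
by rewrite /oline; case: ifP; rewrite line_dist // -opprD normrN.
Qed.

Lemma oline_distl q t : D q (oline q t) = `|t|.
Proof. by rewrite -{1}(oline0 q) oline_dist sub0r normrN. Qed.

(** Distances from a point in the past recover the signed time [t], whereas the distance from [q]
    gives only its absolute value. Times thus become continuous functions of points. *)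
Lemma oline_anchor q w t : w < 0 -> w < t ->
  D (oline q w) (oline q t) - D (oline q w) q = t.
Proof.
by move=> w0 wt; rewrite oline_dist ldistC oline_distl !ltr0_norm ?subr_lt0 //; ring.
Qed.

Lemma oline_dom q t : D p q < e -> `|t| < 3 * e -> dom c (oline q t).
Proof. by move=> ? ?; rewrite /oline; case: ifP => _; apply: line_dom; rewrite ?normrN. Qed.

Lemma oline_chartY q t : D p q < e -> `|t| < 3 * e -> Y c (oline q t) = Y c q.
Proof. by move=> ? ?; rewrite /oline; case: ifP => _; apply: line_chartY; rewrite ?normrN. Qed.

(** The ordinate is constant along this piece of line, so the abscissa is injective, and a
    continuous injective function on an interval is monotone. *)
Lemma line_chartX q : D p q < e ->
  (forall u v, - (3 * e) < u -> u < v -> v < 3 * e -> X c (g0 q u) < X c (g0 q v)) \/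
  (forall u v, - (3 * e) < u -> u < v -> v < 3 * e -> X c (g0 q v) < X c (g0 q u)).
Proof.
move=> pq; pose I : interval R := `](- (3 * e)), (3 * e)[.
have ine u : (u \in I) = (- (3 * e) < u < 3 * e) by rewrite in_itv.
have cf : {within [set` I], continuous (X c \o g0 q)}.
  apply: continuous_in_subspaceT => u; rewrite inE /= ine => ue.
  apply: continuous_comp; first exact: line_cont.
  by apply: (chartX_cont fc); apply: line_dom => //; rewrite ltr_norml.
have injf : {in I &, injective (X c \o g0 q)}.
  move=> u v; rewrite !ine -!ltr_norml => ue ve /= uv.
  apply: (@line_inj _ _ S q); apply: (chart_inj fc) => //; try exact: line_dom.
  by rewrite !line_chartY.
have [h|h] := itv_continuous_inj_mono cf injf; [left|right] => u v ? ? ?.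
  by apply: h => //; rewrite ine; lra.
by apply: h => //; rewrite ine; lra.
Qed.

Lemma oline_chartX q u v : D p q < e -> - (3 * e) < u -> u < v -> v < 3 * e ->
  X c (oline q u) < X c (oline q v).
Proof.
have e_gt0 := e0.
move=> pq ue uv ve; have e1 : - (3 * e) < 0 by lra.
have e2 : e < 3 * e by lra.
rewrite /oline /orientation; have [h|h] := line_chartX pq.
  by have := h _ _ e1 e0 e2; rewrite line0 => -> /=; apply: h.
have := h _ _ e1 e0 e2; rewrite line0 => /ltW; rewrite leNgt => /negbTE ->.
by apply: h; lra.
Qed.

Lemma oline_le q u v : D p q < e -> `|u| < 3 * e -> `|v| < 3 * e ->
  X c (oline q u) < X c (oline q v) -> u < v.
Proof.
rewrite !ltr_norml => pq /andP[? ?] /andP[? ?] h; rewrite ltNge; apply/negP.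
rewrite le_eqVlt => /orP[/eqP vu|vu]; first by move: h; rewrite vu ltxx.
have /(lt_trans h) : X c (oline q v) < X c (oline q u) by apply: oline_chartX.
by rewrite ltxx.
Qed.

Lemma plaque_oline q r : D p q < e -> dom c r -> Y c r = Y c q -> D q r < 3 * e ->
  exists2 u, `|u| < 3 * e & r = oline q u.
Proof.
have e_gt0 := e0.
move=> pq dr rq Dqr.
have /line_leaf[t rE] : lf q r.
  by case: fc => _ _; apply => //; apply: dball; lra.
exists (if orientation q then t else - t); last first.
  by rewrite /oline; case: (orientation q); rewrite ?opprK.
by move: Dqr; rewrite rE line_distl; case: ifP; rewrite ?normrN.
Qed.

(* For [q'] near [q], the points of the plaque of [q'] with the abscissas of
   [oline q (s - k)] and [oline q (s + k)] enclose [oline q' s'], as seen by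
   measuring from a point far on the left. *)
Lemma oline_cont q s : D p q < e -> `|s| < e -> jointly_continuous oline q s.
Proof.
have e_gt0 := e0.
move=> pq se U nU; have [s1 s2] : - e < s /\ s < e by move: se; rewrite ltr_norml => /andP.
have abs (x y : R) : - y < x -> x < y -> `|x| < y by rewrite ltr_norml => -> ->.
have slope (l r t k' : R) : 0 < k' -> k' < e -> l < s - k' / 2 -> s + k' / 2 < r ->
    `|s - t| < k' / 2 -> `|l| < 3 * e -> `|r| < 3 * e ->
    [/\ - (3 * e) < l, l < t, t < r, r < 3 * e & `|t| < 3 * e].
  rewrite ltr_distlC !ltr_norml => k'0 k'e ls sr /andP[? ?] /andP[? ?] /andP[? ?].
  by split; lra.
pose z := oline q s.
have dz : dom c z by apply: oline_dom => //; apply: abs; lra.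
have codz : cod c (cfun c z) by exists z.
have [eta eta0 heta] : exists2 eta : R, 0 < eta & forall x y,
    `|X c z - x| < eta -> `|Y c z - y| < eta -> U (cinv c (x, y)).
  have : \forall v \near cfun c z, U (cinv c v).
    by apply: (cinv_cont fc codz); rewrite /= (cfunK fc).
  by move=> /nbhsRRP[eta eta0 h]; exists eta => // x y *; exact: h.
have cX : {for s, continuous (X c \o oline q)}.
  apply: continuous_comp; last exact: (chartX_cont fc dz).
  move=> V /(ldist_nbhs S)[d d0 h]; apply/nbhsRP; exists d => // t st.
  by apply: h; rewrite oline_dist.
have [k0 k00 hk0] : exists2 k0 : R, 0 < k0 & forall t, `|s - t| < k0 ->
    `|X c z - X c (oline q t)| < eta.
  by apply/nbhsRP; apply: (cX [set x | `|X c z - x| < eta]); apply/nbhsRP; exists eta.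
(* [k < k0] keeps the abscissas at times [s - k] and [s + k] within [eta] of that of [z]; [k < e]
   keeps these times above [- (2 * e)], the time of the anchor. *)
pose k := Num.min (k0 / 2) (e / 2).
have [k1 k2 k3] : [/\ 0 < k, k < k0 & k < e].
  by rewrite /k lt_min !gt_min; split; first (apply/andP; split); try (apply/orP); lra.
have at_t t : `|t| < 3 * e -> {for q, continuous (fun q' => cinv c (X c (oline q t), Y c q'))} /\
    \forall q' \near q, cod c (X c (oline q t), Y c q').
  move=> te; have d := oline_dom pq te.
  have E : (X c (oline q t), Y c q) = cfun c (oline q t).
    by rewrite -(oline_chartY pq te) /X /Y -surjective_pairing.
  have cp : {for q, continuous (fun q' => (X c (oline q t), Y c q'))}.
    apply: continuous_pair; first exact: cvg_cst.
    by apply: (chartY_cont fc); apply: dball; lra.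
  have cd : cod c (X c (oline q t), Y c q) by rewrite E; exists (oline q t).
  split; last by apply: cp; exact: (cod_open fc cd).
  apply: (continuous_comp (f := fun q' => (X c (oline q t), Y c q')) (g := cinv c)) => //.
  exact: (cinv_cont fc cd).
(* The point of the plaque of [q'] with the abscissa of [oline q t]: its dependence on [q'] is
   continuous because it is defined in coordinates, not by following lines. *)
pose P t q' := cinv c (X c (oline q t), Y c q').
have P_q t : `|t| < 3 * e -> P t q = oline q t.
  move=> te; rewrite /P -(oline_chartY pq te) /X /Y -surjective_pairing (cfunK fc) //.
  exact: oline_dom.
have a1 : `|- (2 * e)| < 3 * e by apply: abs; lra.
have a2 : `|s - k| < 3 * e by apply: abs; lra.
have a3 : `|s + k| < 3 * e by apply: abs; lra.
have ord1 : - (3 * e) < - (2 * e) by lra.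
have ord2 : - (2 * e) < s - k by lra.
have ord3 : - (2 * e) < s + k by lra.
have ord4 : s - k < 3 * e by lra.
have ord5 : s + k < 3 * e by lra.
have ord6 : - (2 * e) < 0 by lra.
have ord7 : 0 < 3 * e by lra.
have se3 : `|s| < 3 * e by lra.
have bnd (l r x xl xr : R) : `|x - xl| < l -> `|x - xr| < l -> xl < r -> r < xr ->
    `|x - r| < l.
  by rewrite !ltr_distlC => /andP[? ?] /andP[? ?] ? ?; lra.
have near_dist t : `|t| < 3 * e -> \forall q' \near q, D q' (P t q') < 3 * e.
  move=> te; apply: near_lt; first by apply: ldist_cont; [exact: cvg_id | exact: (at_t t te).1].
  by rewrite P_q // oline_distl.
(* By [oline_anchor] this difference is the time at which the oriented line of [q'] reaches
   [P t q']. *)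
have diff_cont t : `|t| < 3 * e ->
    {for q, continuous (fun q' => D (P (- (2 * e)) q') (P t q') - D (P (- (2 * e)) q') q')}.
  move=> te; apply: continuousB; apply: ldist_cont; try exact: cvg_id.
  - exact: (at_t _ a1).1.
  - exact: (at_t _ te).1.
  - exact: (at_t _ a1).1.
have val_q t : - (2 * e) < t -> `|t| < 3 * e ->
    D (P (- (2 * e)) q) (P t q) - D (P (- (2 * e)) q) q = t.
  by move=> te te'; rewrite !P_q // oline_anchor // oppr_lt0 mulr_gt0.
exists (k / 2); first lra.
near=> q' => s' ss'.
have pq' : D p q' < e.
  by near: q'; apply: near_lt => //; apply: ldist_cont; [exact: cvg_cst | exact: cvg_id].
have YY : `|Y c q - Y c q'| < eta.
  near: q'; have : {for q, continuous (Y c)} by apply: (chartY_cont fc); apply: dball; lra.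
  by move=> /(_ [set y | `|Y c q - y| < eta]); apply; apply/nbhsRP; exists eta.
have Pu t : `|t| < 3 * e -> cod c (X c (oline q t), Y c q') -> D q' (P t q') < 3 * e ->
    exists u, [/\ `|u| < 3 * e, P t q' = oline q' u & X c (oline q' u) = X c (oline q t)].
  move=> te ct Dt; have [d E] := cinvP fc ct.
  have [|u u1 u2] := @plaque_oline q' (P t q') pq' d _ Dt; first by rewrite /Y E.
  by exists u; split => //; rewrite -u2 /X /P E.
have [w [w1 w2 w3]] : exists w, [/\ `|w| < 3 * e, P (- (2 * e)) q' = oline q' w &
    X c (oline q' w) = X c (oline q (- (2 * e)))].
  by apply: Pu => //; near: q'; [exact: (at_t _ a1).2 | exact: near_dist].
have [l [l1 l2 l3]] : exists w, [/\ `|w| < 3 * e, P (s - k) q' = oline q' w &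
    X c (oline q' w) = X c (oline q (s - k))].
  by apply: Pu => //; near: q'; [exact: (at_t _ a2).2 | exact: near_dist].
have [r [r1 r2 r3]] : exists w, [/\ `|w| < 3 * e, P (s + k) q' = oline q' w &
    X c (oline q' w) = X c (oline q (s + k))].
  by apply: Pu => //; near: q'; [exact: (at_t _ a3).2 | exact: near_dist].
have w0 : w < 0.
  apply: (oline_le pq') => //; first by rewrite normr0 mulr_gt0.
  rewrite oline0 w3; near: q'; apply: near_gt.
    by apply: (chartX_cont fc); apply: dball; rewrite (lt_trans pq) // ltr_pMl // ltr1n.
  by rewrite -[X in _ < chartX c X](oline0 q); apply: oline_chartX.
have wl : w < l by apply: (oline_le pq') => //; rewrite w3 l3; apply: oline_chartX.
have wr : w < r by apply: (oline_le pq') => //; rewrite w3 r3; apply: oline_chartX.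
(* The time [l] tends to [s - k] as [q'] tends to [q]. Half of [k] absorbs this error, the other
   half the variation of [s']. *)
have ls : l < s - k / 2.
  rewrite -(oline_anchor q' w0 wl) -w2 -l2; near: q'; apply: near_lt; first exact: diff_cont.
  by rewrite val_q // ltrD2l ltrN2 ltr_pdivrMr // ltr_pMr // ltr1n.
have sr : s + k / 2 < r.
  rewrite -(oline_anchor q' w0 wr) -w2 -r2; near: q'; apply: near_gt; first exact: diff_cont.
  by rewrite val_q // ltrD2l ltr_pdivrMr // ltr_pMr // ltr1n.
have [lt1 lt2 lt3 lt4 s'3] := slope _ _ _ _ k1 k3 ls sr ss' l1 r1.
have sx1 : X c (oline q' l) < X c (oline q' s') by apply: oline_chartX => //; exact: lt_trans lt4.
have sx2 : X c (oline q' s') < X c (oline q' r) by apply: oline_chartX => //; exact: lt_trans lt2.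
rewrite l3 in sx1; rewrite r3 in sx2.
have := hk0 (s - k); have := hk0 (s + k).
rewrite subKr opprD addNKr normrN gtr0_norm // => /(_ k2) b1 /(_ k2) b2.
have := heta (X c (oline q' s')) (Y c (oline q' s')).
rewrite /X /Y -surjective_pairing (cfunK fc); last exact: oline_dom.
apply; first exact: bnd b2 b1 sx1 sx2.
by have := YY; rewrite -(oline_chartY pq se3) -(oline_chartY pq' s'3).
Unshelve. all: by end_near.
Qed.

End Ball.
End LocalOrientation.

Record geodesic_flow (R : realType) (M : topologicalType) (S : lined_plane R M) :=
  GeodesicFlow {
  flow : M -> R -> M;
  flow0 : forall p, flow p 0 = p;
  flow_dist : forall p s t, ldist S (flow p s) (flow p t) = `|s - t|;
  flow_leaf : forall p q, same_leaf S p q <-> exists t, q = flow p t;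
  flowD : forall p s t, flow (flow p s) t = flow p (s + t);
  flow_cont : forall p s, jointly_continuous flow p s }.

Section Orientation.
Variables (R : realType) (M : topologicalType) (S : lined_plane R M).
Local Notation D := (ldist S).
Local Notation lf := (same_leaf S).
Local Notation g0 := (line S).
Local Notation X := chartX.

Lemma chart_near_lt (c : chart R M) (f g : M -> M) q : foliated_chart lf c ->
  {for q, continuous f} -> {for q, continuous g} -> dom c (f q) -> dom c (g q) ->
  X c (f q) < X c (g q) -> \forall r \near q, X c (f r) < X c (g r).
Proof.
move=> fc cf cg df dg fg; pose h r := X c (g r) - X c (f r).
have ch : {for q, continuous h}.
  apply: continuousB.
    exact: (continuous_comp (f := g) (g := X c) cg (chartX_cont fc dg)).
  exact: (continuous_comp (f := f) (g := X c) cf (chartX_cont fc df)).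
have h0 : 0 < h q by rewrite subr_gt0.
have H : \forall r \near q, 0 < h r by exact: (cvgr_gt _ ch).
by apply: filterS H => r; rewrite subr_gt0.
Qed.

Lemma ldist_ball_open p q (e : R) : D p q < e -> \forall r \near q, D p r < e.
Proof.
move=> pq; have := @ldist_near _ _ S q (e - D p q); rewrite subr_gt0 => /(_ pq).
by apply: filterS => r; have := ldist_triangle S q p r; lra.
Qed.

(** The orientation can be tested at any small positive time, so that charts with different radii
    can be compared at a common time. *)
Lemma orientation_pos c e p r s : chart_ball S (c, e) p -> D p r < e ->
  0 < s -> s < 3 * e -> (X c r < X c (g0 r s)) = orientation S c e r.
Proof.
move=> [/= fc e0 dball] pr s0 se.
have [b|b] := boolP (orientation S c e r).
  have := oline_chartX fc e0 dball pr (u := 0) (v := s).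
  by rewrite oline0 /oline b; apply => //; lra.
have := oline_chartX fc e0 dball pr (u := - s) (v := 0).
rewrite oline0 /oline (negbTE b) opprK => h.
by apply/negbTE; rewrite -leNgt; apply/ltW/h; lra.
Qed.

Lemma orientation_neg c e p r s : chart_ball S (c, e) p -> D p r < e ->
  0 < s -> s < 3 * e -> (X c r < X c (g0 r (- s))) = ~~ orientation S c e r.
Proof.
move=> [/= fc e0 dball] pr s0 se.
have [b|b] := boolP (orientation S c e r).
  have := oline_chartX fc e0 dball pr (u := - s) (v := 0).
  rewrite oline0 /oline b => h.
  by apply/negbTE; rewrite -leNgt; apply/ltW/h; lra.
have := oline_chartX fc e0 dball pr (u := 0) (v := s).
by rewrite oline0 /oline (negbTE b); apply => //; lra.
Qed.

Lemma jointly_continuousW (G : M -> R -> M) q s :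
  jointly_continuous G q s -> {for q, continuous (G^~ s)}.
Proof.
by move=> jc U /jc[k k0 H]; apply: filterS H => q'; apply; rewrite subrr normr0.
Qed.

(** To compare the orientations by the charts of [p] and of [q], follow the line oriented by the
    second for a short time and look at the abscissa in the first. Moving right means agreement,
    moving right backwards means disagreement, and both are open conditions; hence the comparison is
    locally constant. *)
Lemma orientation_cocycle (ce : M -> chart R M * R) :
  (forall p, chart_ball S (ce p) p) ->
  let t p q := orientation S (ce p).1 (ce p).2 q in
  forall p, \forall q \near p, \forall r \near q, t p r (+) t q r = t p q (+) t q q.
Proof.
move=> bce t p.
have [fp ep dp] := bce p.
apply: filterS (ldist_near S p ep) => q pq.
have [fq eq dq] := bce q.
pose s := Num.min (ce p).2 (ce q).2 / 2.
have [s0 [sp sq]] : 0 < s /\ s < (ce p).2 /\ s < (ce q).2.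
  have : 0 < Num.min (ce p).2 (ce q).2 by rewrite lt_min ep.
  have : Num.min (ce p).2 (ce q).2 <= (ce p).2 by rewrite ge_min lexx.
  have : Num.min (ce p).2 (ce q).2 <= (ce q).2 by rewrite ge_min lexx orbT.
  by rewrite /s; lra.
have qq : D q q < (ce q).2 by rewrite ldist0.
have bp : chart_ball S ((ce p).1, (ce p).2) p by rewrite -surjective_pairing.
have bq : chart_ball S ((ce q).1, (ce q).2) q by rewrite -surjective_pairing.
pose G := oline S (ce q).1 (ce q).2.
have cG u : `|u| < (ce q).2 -> {for q, continuous (G^~ u)}.
  by move=> ue; apply: jointly_continuousW; exact: (oline_cont fq eq dq).
pose K u r := X (ce p).1 r < X (ce p).1 (G r u).
have key r : D p r < (ce p).2 ->
    K s r = ~~ (t p r (+) t q r) /\ K (- s) r = t p r (+) t q r.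
  move=> pr; rewrite /K /G /oline -/(t q r).
  have s3 : s < 3 * (ce p).2 by lra.
  have E1 := orientation_pos bp pr s0 s3; have E2 := orientation_neg bp pr s0 s3.
  by case: (t q r); rewrite ?opprK ?E1 ?E2 -?/(t p r); split => //; case: (t p r).
have near_p := ldist_ball_open pq.
have Kopen u : `|u| < (ce q).2 -> `|u| < (ce p).2 -> K u q -> \forall r \near q, K u r.
  move=> uq up KG; apply: (@chart_near_lt _ id (G^~ u) q fp) => //.
  - exact: cG.
  - by apply: dp; lra.
  - apply: dp; have := ldist_triangle S q p (G q u); rewrite oline_distl; lra.
have [K1 K2] := key q pq.
have sn : `|s| = s by rewrite gtr0_norm.
have [b|b] := boolP (t p q (+) t q q).
  rewrite b in K2; have := Kopen (- s); rewrite normrN sn => /(_ sq sp K2).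
  by apply: filterS2 near_p => r /key[_ ->].
rewrite b in K1; have := Kopen s; rewrite sn => /(_ sq sp K1).
by apply: filterS2 near_p => r /key[-> _] /negbTE.
Qed.

(** The function [x], an abscissa up to sign, increases along all the oriented lines near [p]. It
    records that neighbouring points of a leaf are oriented the same way, which the group law will
    need. *)
Lemma oriented_lines : exists G : M -> R -> M, [/\
  forall p, G p 0 = p, forall p s t, D (G p s) (G p t) = `|s - t|,
  forall p q, lf p q <-> exists t, q = G p t &
  forall p, exists2 e : R, 0 < e & exists x : M -> R, forall q, D p q < e ->
    (forall s, `|s| < e -> jointly_continuous G q s) /\
    (forall u v, - e < u -> u < v -> v < e -> x (G q u) < x (G q v))].
Proof.
have [ce bce] := choice (chart_ball_exists S).
have [ori ho] := plane_cocycle (lined_plane_homeo S) (orientation_cocycle bce).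
pose sg (b : bool) (s : R) := if b then s else - s.
have sgD b s t : `|sg b s - sg b t| = `|s - t|.
  by rewrite /sg; case: b => //; rewrite -opprD normrN.
have sgN b s : sg (~~ b) s = sg b (- s) by rewrite /sg; case: b; rewrite ?opprK.
exists (fun p s => g0 p (sg (ori p) s)); split.
- by move=> p; rewrite /sg oppr0 if_same line0.
- by move=> p s t; rewrite line_dist sgD.
- move=> p q; rewrite line_leaf; split => -[t ->]; exists (sg (ori p) t) => //.
  by rewrite /sg; case: (ori p); rewrite ?opprK.
move=> p; have [fp ep dp] := bce p; set e := (ce p).2; set c := (ce p).1.
have /(ldist_nbhs S)[e' e'0 he'] := ho p.
(* Whether the global orientation is opposite to that of the chart; near [p] this does not depend on
   the point, since [ori] is a primitive of the cocycle. *)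
pose k := ori p (+) orientation S c e p.
have GE q : D p q < e' -> forall s, g0 q (sg (ori q) s) = oline S c e q (sg (~~ k) s).
  move=> /he' h s; rewrite -/k in h; rewrite /oline.
  have -> : ori q = k (+) orientation S c e q by rewrite -h -/e -/c addbK.
  by rewrite /sg; case: (k); case: (orientation S c e q) => /=; rewrite ?opprK.
pose m := Num.min e e'.
have [m0 me me'] : [/\ 0 < m, m <= e & m <= e'].
  by rewrite /m lt_min ep e'0 !ge_min !lexx orbT.
exists m => //; exists (fun q => sg (~~ k) (X c q)) => q pq; split.
  move=> s sm U; rewrite GE; last exact: lt_le_trans me'.
  have : jointly_continuous (@oline R M S c e) q (sg (~~ k) s).
    apply: (oline_cont fp ep dp); first exact: lt_le_trans me.
    by apply: lt_le_trans me; rewrite /sg; case: ifP; rewrite ?normrN.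
  move=> /[apply] -[d d0 H]; exists d => //.
  have H' := ldist_ball_open (lt_le_trans pq me').
  apply: filterS2 H' H => r pr h s' ss'.
  by rewrite GE //; apply: h; rewrite sgD.
move=> u v ue uv ve; rewrite !GE; try exact: lt_le_trans me'.
have pq' : D p q < e by exact: lt_le_trans me.
have me2 : m <= (ce p).2 by [].
rewrite /sg; case: (k) => /=; first rewrite ltrN2.
  by apply: (oline_chartX fp ep dp pq'); lra.
by apply: (oline_chartX fp ep dp pq'); lra.
Qed.

Lemma connectedRT : connected [set: R].
Proof. by apply/connected_intervalP => x y _ _ z _. Qed.

(** The line started at [G p r] is a reparametrization of [G p] by an isometry of the real line, so
    it runs along [G p] forwards or backwards. The direction is locally constant in [r], and forward
    at [r = 0]. *)
Lemma geodesic_flow_exists : inhabited (geodesic_flow S).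
Proof.
have [G [G0 GD Glf Gloc]] := oriented_lines.
have GG p s t : G (G p s) t = G p (s + t).
  have GDl q u : D q (G q u) = `|u| by rewrite -{1}(G0 q) GD sub0r normrN.
  have dir r : (forall u, G (G p r) u = G p (r + u)) \/ (forall u, G (G p r) u = G p (r - u)).
    have /choice[j hj] u : exists v, G (G p r) u = G p (r + v).
      have [v hv] : exists v, G (G p r) u = G p v.
        by apply/Glf; apply: (@same_leaf_trans _ _ S (G p r)); apply/Glf; [exists r | exists u].
      by exists (v - r); rewrite addrC subrK.
    have [||h|h] := @isometry_line R j.
    - by move=> u v; rewrite -(GD (G p r) u v) !hj GD opprD addrACA subrr add0r.
    - have := hj 0; rewrite G0 => /(congr1 (D (G p r))).
      by rewrite ldist0 GD opprD addNKr normrN => /esym/eqP; rewrite normr_eq0 => /eqP.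
    - by left => u; rewrite hj h.
    - by right => u; rewrite hj h.
  pose A r := forall u, G (G p r) u = G p (r + u).
  have nA r : (forall u, G (G p r) u = G p (r - u)) -> ~ A r.
    move=> h /(_ 1); rewrite h => /(congr1 (D (G p (r - 1)))).
    by rewrite ldist0 GD distrC ger0_norm; lra.
  suff : A s by apply.
  suff -> : A s = A 0 by move=> u; rewrite G0 add0r.
  apply: (connected_locally_constant connectedRT) => // r _.
  have [e e0 [x hx]] := Gloc (G p r).
  apply/nbhsRP; exists (e / 2); first lra.
  move=> r' rr' _; have [_ mono'] := hx (G p r') ltac:(rewrite GD; lra).
  have [_ mono] := hx (G p r) ltac:(rewrite ldist0; lra).
  have lt' := mono' 0 (e / 4) ltac:(lra) ltac:(lra) ltac:(lra).
  move: rr'; rewrite ltr_distlC => /andP[rr1 rr2].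
  (* With opposite directions at [r] and [r'], the function [x] would both increase and decrease
     along a common piece of the leaf. *)
  have [h|h] := dir r; have [h'|h'] := dir r'.
  - exact/propext.
  - move: lt'; rewrite !h' subr0.
    have -> : r' = r + (r' - r) by lra.
    rewrite -addrA -!h => lt'.
    by have := lt_trans lt' (mono (r' - r - e / 4) (r' - r) ltac:(lra) ltac:(lra) ltac:(lra)); rewrite ltxx.
  - move: lt'; rewrite !h' addr0.
    have -> : r' = r - (r - r') by lra.
    have -> : r - (r - r') + e / 4 = r - (r - r' - e / 4) by lra.
    rewrite -!h => lt'.
    by have := lt_trans lt' (mono (r - r' - e / 4) (r - r') ltac:(lra) ltac:(lra) ltac:(lra)); rewrite ltxx.
  - by apply/propext; split => [a|a]; [case: (nA _ h' a) | case: (nA _ h a)].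
(* Continuity holds for short times from every point; the group law carries it from one time to
   nearby times, and connectedness to all of them. *)
have Gc p s : jointly_continuous G p s.
  pose A r := jointly_continuous G p r.
  suff -> : jointly_continuous G p s = A 0.
    have [e e0 [x hx]] := Gloc p.
    by have [h _] := hx p ltac:(rewrite ldist0; lra); apply: h; rewrite normr0.
  apply: (connected_locally_constant (f := A) connectedRT) => // r _.
  have [e e0 [x hx]] := Gloc (G p r).
  have step s1 s2 : `|r - s1| < e / 2 -> `|r - s2| < e / 2 -> A s1 -> A s2.
    move=> r1 r2 A1 U.
    have GE q s' : G q s' = G (G q s1) (s' - s1) by rewrite GG addrC subrK.
    have jc : jointly_continuous G (G p s1) (s2 - s1).
      have [jc _] := hx (G p s1) ltac:(rewrite GD; lra).
      apply: jc.
      by move: r1 r2; rewrite !ltr_distlC; lra.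
    rewrite GE => /jc[d d0 /(jointly_continuousW A1) H]; exists d => //.
    apply: (@filterS _ (nbhs p) _ _ _ _ H) => q' /= h s' ss'.
    rewrite GE; apply: h; apply: le_lt_trans ss'.
    by rewrite le_eqVlt; apply/orP; left; apply/eqP; congr (`|_|); lra.
  apply/nbhsRP; exists (e / 2); first lra.
  move=> r' rr' _; apply/propext; split; apply: step => //; rewrite subrr normr0; lra.
by constructor; exact: (@GeodesicFlow _ _ S G).
Qed.

End Orientation.

(** * The two sides of a leaf *)

Section Transversal.
Variables (R : realType) (M : topologicalType) (S : lined_plane R M).
Variable F : geodesic_flow S.
Local Notation D := (ldist S).
Local Notation lf := (same_leaf S).
Local Notation G := (flow F).

Lemma same_leaf_refl p : lf p p.
Proof. by apply/(flow_leaf F); exists 0; rewrite flow0. Qed.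

Lemma same_leaf_flow p t : lf p (G p t).
Proof. by apply/(flow_leaf F); exists t. Qed.

Lemma flow_distl p t : D p (G p t) = `|t|.
Proof. by rewrite -{1}(flow0 F p) flow_dist sub0r normrN. Qed.

Lemma flow_line_cont p : continuous (G p).
Proof.
move=> t U /(ldist_nbhs S)[e e0 h]; apply/nbhsRP; exists e => // s ts.
by apply: h; rewrite flow_dist.
Qed.

(** Separation is inherited from the plane, whose topology is the one given by [D]. *)
Lemma ldist_eq0 p q : D p q = 0 -> p = q.
Proof.
move=> pq0; have [f [cf [f' [_ fK _]]]] := lined_plane_homeo S.
have H e : 0 < e -> `|(f p).1 - (f q).1| < e /\ `|(f p).2 - (f q).2| < e.
  move=> e0; have : \forall r \near p, `|(f p).1 - (f r).1| < e /\ `|(f p).2 - (f r).2| < e.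
    by apply: (cf p [set x | `|(f p).1 - x.1| < e /\ `|(f p).2 - x.2| < e]); apply/nbhsRRP; exists e.
  by move=> /(ldist_nbhs S)[d d0]; apply; rewrite pq0.
have E (x y : R) : (forall e, 0 < e -> `|x - y| < e) -> x = y.
  move=> h; apply/eqP; rewrite -subr_eq0 -normr_eq0; apply/negPn/negP => ne.
  by have := h `|x - y|; rewrite lt_neqAle eq_sym ne normr_ge0 => /(_ isT); rewrite ltxx.
rewrite -(fK p) -(fK q) [f p]surjective_pairing [f q]surjective_pairing.
by congr (f' (_, _)); apply: E => e /H[].
Qed.

Lemma same_leaf_closed p q : ~ lf p q -> exists2 e : R, 0 < e &
  forall p' q', D p p' < e -> D q q' < e -> ~ lf p' q'.
Proof.
move=> npq; set d := D p q.
have away t : exists2 k : R, 0 < k & exists2 eta : R, 0 < eta &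
    forall p' t', D p p' < k -> `|t - t'| < k -> eta < D q (G p' t').
  have Dt : 0 < D q (G p t).
    rewrite lt_neqAle ldist_ge0 andbT; apply/eqP => /esym/ldist_eq0 qE.
    by apply: npq; rewrite qE; exact: same_leaf_flow.
  have nU : nbhs (G p t) [set z | D q (G p t) / 2 < D q z].
    have c : {for G p t, continuous (fun z => D q z)}.
      by apply: ldist_cont; [exact: cvg_cst | exact: cvg_id].
    by apply: (cvgr_gt _ c); rewrite ltr_pdivrMr // ltr_pMr // ltr1n.
  have [k k0 /(ldist_nbhs S)[k' k'0 H]] := flow_cont nU.
  exists (Num.min k k'); first by rewrite lt_min k0.
  exists (D q (G p t) / 2); first by rewrite divr_gt0.
  by move=> p' t'; rewrite !lt_min => /andP[_ h] /andP[h' _]; exact: H.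
have [k1 k10 [e1 e10 h1]] := away d.
have [k2 k20 [e2 e20 h2]] := away (- d).
(* Moving both points by less than [e] changes their distance by less than [2 * e], so the time from
   [p'] to [q'] would be within [k1] of [d] or within [k2] of [- d], where the flow stays away from
   [q]. *)
pose e := Num.min (Num.min (k1 / 2) (k2 / 2)) (Num.min e1 e2).
have [ee1 [ee2 [ee3 ee4]]] : e <= k1 / 2 /\ e <= k2 / 2 /\ e <= e1 /\ e <= e2.
  by rewrite /e !ge_min !lexx !orbT.
exists e; first by rewrite /e !lt_min e10 e20 !divr_gt0.
move=> p' q' pp' qq' /(flow_leaf F)[t q'E].
have tE : D p' q' = `|t| by rewrite q'E flow_distl.
have : `|d - `|t| | < 2 * e.
  rewrite -tE ltr_distl /d.
  have := ldist_triangle S p' p q; have := ldist_triangle S q' p' q.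
  have := ldist_triangle S p p' q'; have := ldist_triangle S q p q'.
  by rewrite (ldistC S p' p) (ldistC S q' q); lra.
have [t0|t0] := leP 0 t.
  rewrite (ger0_norm t0) => td; have := h1 p' t ltac:(lra) ltac:(lra).
  by rewrite -q'E; lra.
rewrite (ltr0_norm t0) => td.
have td' : `|- d - t| < k2.
  have -> : - d - t = - (d - - t) by ring.
  by rewrite normrN; lra.
by have := h2 p' t ltac:(lra) td'; rewrite -q'E; lra.
Qed.

Lemma leaf_compl_open p q : ~ lf p q -> \forall r \near q, ~ lf p r.
Proof.
move=> /same_leaf_closed[e e0 h]; apply: filterS (ldist_near S q e0) => r.
by apply: h; rewrite ldist0.
Qed.

(** A transversal [s] through [p], with a coordinate [y] that separates the leaves meeting [V]. It
    has half-length 2 so that the coordinate can be truncated at 1 and -1 well inside its domain. *)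
Definition leaf_transversal p (s : R -> M) (y : M -> R) (V : set M) :=
  [/\ open V, s 0 = p,
   forall v, `|v| < 2 -> [/\ {for v, continuous s}, V (s v) & y (s v) = v],
   forall q, V q -> [/\ `|y q| < 2, lf q (s (y q)) & {for q, continuous y}] &
   forall q r, V q -> V r -> lf q r -> y q = y r].

Lemma leaf_transversal_exists p : exists s y V, leaf_transversal p s y V.
Proof.
have [[c e] [/= fc e0 dball]] := chart_ball_exists S p.
have dp : dom c p by apply: dball; rewrite ldist0; lra.
have codp : cod c (cfun c p) by exists p.
have pE : cfun c p = (chartX c p, chartY c p) by rewrite -surjective_pairing.
have cinv_p : cinv c (chartX c p, chartY c p) = p by rewrite -pE (cfunK fc).
have [k k0 hk] : exists2 k : R, 0 < k & forall y, `|chartY c p - y| < k ->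
    cod c (chartX c p, y) /\ D p (cinv c (chartX c p, y)) < e.
  have H : \forall x \near cfun c p, cod c x /\ D p (cinv c x) < e.
    apply: filterI; first exact: (cod_open fc codp).
    have H1 : nbhs (cinv c (cfun c p)) [set z | D p z < e].
      by rewrite (cfunK fc) //; exact: ldist_near.
    exact: (cinv_cont fc codp H1).
  have /nbhsRRP[k k0 h] := H; exists k => // y yk.
  by apply: h => //=; rewrite subrr normr0.
have k2 : 0 < k / 2 by lra.
have vk v : `|v| < 2 -> `|chartY c p - (chartY c p + k / 2 * v)| < k.
  rewrite opprD addNKr normrN normrM (gtr0_norm k2) => v2.
  by rewrite -[X in _ < X](divfK (x := 2)) // ltr_pM2l.
(* The scale [k / 2] maps parameters below 2 in absolute value to ordinates within [k] of that of
   [p]. *)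
pose s v := cinv c (chartX c p, chartY c p + k / 2 * v).
pose y q := (chartY c q - chartY c p) / (k / 2).
pose V := [set q | D p q < e /\ `|y q| < 2].
have domV q : D p q < e -> dom c q by move=> h; apply: dball; lra.
have cy q : D p q < e -> {for q, continuous y}.
  move=> /domV dq; apply: continuousM; last exact: cvg_cst.
  by apply: continuousB; [exact: (chartY_cont fc dq) | exact: cvg_cst].
have syE q : chartY c p + k / 2 * y q = chartY c q.
  by rewrite /y mulrC divfK ?gt_eqF // addrC subrK.
exists s, y, V; split.
- rewrite openE => q [pq yq]; apply: filterI; first exact: ldist_ball_open.
  have H : \forall r \near y q, `|r| < 2.
    have := yq; rewrite ltr_norml => /andP[y1 y2].
    apply/nbhsRP; exists (Num.min (y q + 2) (2 - y q)); first by rewrite lt_min; lra.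
    by move=> r; rewrite lt_min !ltr_distlC ltr_norml; lra.
  exact: (cy q pq _ H).
- by rewrite /s mulr0 addr0.
- move=> v v2; have [codv pv] := hk _ (vk v v2).
  have [dv E] := cinvP fc codv.
  have yv : y (s v) = v.
    by rewrite /y /s /chartY E /= -/(chartY c p) addrC addKr mulrC mulKf // gt_eqF.
  split => //; last by split => //; rewrite yv.
  apply: (continuous_comp (f := fun v => (chartX c p, chartY c p + k / 2 * v)) (g := cinv c)).
    apply: continuous_pair; first exact: cvg_cst.
    by apply: continuousD; [exact: cvg_cst | apply: continuousM; [exact: cvg_cst | exact: cvg_id]].
  exact: (cinv_cont fc codv).
- move=> q [pq yq]; split => //; last exact: cy.
  have [codv _] := hk _ (vk _ yq); have [dv E] := cinvP fc codv.
  case: (fc) => _ _; apply => //; first exact: domV.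
  by rewrite /s E /= syE.
- move=> q r [pq _] [pr _] qr.
  by rewrite /y (leaf_chartY fc e0 dball pq pr qr).
Qed.

End Transversal.

Lemma same_sign_itv (R : realType) (a b r : R) : `|a| < 2 -> `|b| < 2 ->
  0 < a * b -> r \in `[a, b] -> `|r| < 2 /\ r != 0.
Proof.
rewrite in_itv /= !ltr_norml => /andP[? ?] /andP[? ?] ? /andP[? ?].
split; first by apply/andP; split; lra.
by apply/eqP => r0; nra.
Qed.

Section LeafFunction.
Variables (R : realType) (M : topologicalType) (S : lined_plane R M).
Variable F : geodesic_flow S.
Local Notation D := (ldist S).
Local Notation lf := (same_leaf S).
Local Notation G := (flow F).
Local Notation lf_refl := (same_leaf_refl F).

Lemma flow_at_cont t : continuous (G^~ t).
Proof. by move=> p; apply: jointly_continuousW; exact: flow_cont. Qed.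

Section Saturation.
Variables (p : M) (s : R -> M) (y : M -> R) (V : set M).
Hypothesis tr : leaf_transversal S p s y V.

Definition sat : set M := [set q | exists t, V (G q t)].

(** Any time that brings [q] into [V] gives the same value, as [y] is constant on the points of a
    leaf in [V]; the default time 0 matters only off [sat]. *)
Definition sat_coord q : R := y (G q (xget 0 [set t | V (G q t)])).
Local Notation th := sat_coord.

Lemma sat_coordE q t : V (G q t) -> th q = y (G q t).
Proof.
move=> Vt; case: (tr) => _ _ _ _ h; apply: h => //.
  exact: (xgetPex 0 (P := [set t | V (G q t)]) (ex_intro _ t Vt)).
apply: (@same_leaf_trans _ _ S q); last exact: same_leaf_flow.
by apply: same_leaf_sym; exact: same_leaf_flow.
Qed.

Lemma sat_coordV q : V q -> th q = y q.
Proof. by move=> Vq; rewrite (sat_coordE (t := 0)) flow0. Qed.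

Lemma subset_sat q : V q -> sat q.
Proof. by move=> Vq; exists 0; rewrite flow0. Qed.

Lemma sat_leaf q r : lf q r -> sat q -> sat r /\ th q = th r.
Proof.
move=> /(flow_leaf F)[u rE] [t Vt].
have E : G r (t - u) = G q t by rewrite rE flowD addrC subrK.
split; first by exists (t - u); rewrite E.
by rewrite (sat_coordE Vt) -E -(sat_coordE (t := t - u)) // E.
Qed.

Lemma sat_open q : sat q -> \forall r \near q, sat r.
Proof.
move=> [t Vt]; have nV : nbhs (G q t) V by case: (tr) => oV _ _ _ _; exact: open_nbhs_nbhs.
have H : \forall r \near q, V (G r t) := flow_at_cont nV.
by apply: filterS H => r; exists t.
Qed.

Lemma sat_coord_cont q : sat q -> {for q, continuous th}.
Proof.
move=> [t Vt]; have nV : nbhs (G q t) V by case: (tr) => oV _ _ _ _; exact: open_nbhs_nbhs.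
have H : \forall r \near q, V (G r t) := flow_at_cont nV.
have c : {for q, continuous (y \o G^~ t)}.
  apply: continuous_comp; first exact: flow_at_cont.
  by case: (tr) => _ _ _ /(_ _ Vt)[].
move=> U; rewrite (sat_coordE Vt) => /c c'.
have H' : \forall r \near q, U (y (G r t)) := c'.
by apply: filterS2 H H' => r /= /sat_coordE ->.
Qed.

Lemma sat_coord_lt q : sat q -> `|th q| < 2.
Proof. by move=> [t Vt]; rewrite (sat_coordE Vt); case: (tr) => _ _ _ /(_ _ Vt)[]. Qed.

Lemma sat_coord_leaf q : sat q -> lf q (s (th q)).
Proof.
move=> [t Vt]; rewrite (sat_coordE Vt).
apply: (@same_leaf_trans _ _ S (G q t)); first exact: same_leaf_flow.
by case: (tr) => _ _ _ /(_ _ Vt)[].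
Qed.

Lemma sat_s v : `|v| < 2 -> sat (s v) /\ th (s v) = v.
Proof.
case: (tr) => _ _ h _ _ /h[_ Vs ys]; split; first exact: subset_sat.
by rewrite sat_coordV.
Qed.

Lemma sat_base : sat p /\ th p = 0.
Proof. by case: (tr) => _ <- _ _ _; apply: sat_s; rewrite normr0 ltr0n. Qed.

Lemma sat_coord_inj q r : sat q -> sat r -> th q = th r -> lf q r.
Proof.
move=> Uq Ur qr; apply: (@same_leaf_trans _ _ S (s (th q))); first exact: sat_coord_leaf.
by rewrite qr; apply: same_leaf_sym; exact: sat_coord_leaf.
Qed.

Lemma sat_coord0 q : lf p q -> sat q /\ th q = 0.
Proof. by have [Up <-] := sat_base; move=> /sat_leaf /(_ Up)[? ->]. Qed.

(** The strip is closed in [M], not merely in [sat]: it consists of the leaves of [s v] for [v] in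
    the compact [[-1, 1]], and not lying on the leaf of [s v] is an open condition on both [v] and
    the point. *)
Lemma sat_strip_closed r : ~ (sat r /\ `|th r| <= 1) ->
  \forall q \near r, ~ (sat q /\ `|th q| <= 1).
Proof.
move=> nK; have [Ur|nUr] := pselect (sat r).
  have r1 : 1 < `|th r| by rewrite ltNge; apply/negP => h; exact: nK.
  have c : {for r, continuous (fun q => `|th q|)}.
    by apply: (continuous_comp (f := th)); [exact: sat_coord_cont | exact: norm_continuous].
  by apply: filterS (near_gt c r1) => q q1 [_]; rewrite leNgt q1.
have cpt : compact (`[(-1 : R), 1]) by exact: segment_compact.
have H : \forall q \near r, `[(-1 : R), 1] `<=` (fun v => ~ lf (s v) q).
  apply: (proj1 (compact_near_coveringP _) cpt M (nbhs r)
    (fun q v => ~ lf (s v) q) (@nbhs_filter M r)).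
  move=> v; rewrite /= in_itv /= -ler_norml => v1.
  have v2 : `|v| < 2 by apply: le_lt_trans v1 _; rewrite ltr1n.
  have nl : ~ lf (s v) r by move=> /sat_leaf; have [Us _] := sat_s v2; move=> /(_ Us)[].
  have [e e0 h] := same_leaf_closed F nl.
  have cs : {for v, continuous s} by case: (tr) => _ _ /(_ v v2)[].
  have H : \forall v' \near v, D (s v) (s v') < e := cs _ (ldist_near S (s v) e0).
  exists ([set v' | D (s v) (s v') < e], [set q | D r q < e]).
    by split => //=; exact: ldist_near.
  by move=> [v' q] [/= h1 h2]; exact: h.
apply: filterS H => q h [Uq q1]; apply: (h (th q)).
  by rewrite /= in_itv /= -ler_norml.
by apply: same_leaf_sym; exact: sat_coord_leaf.
Qed.

Lemma off_leaf_constant (f : M -> bool) :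
  (forall q, ~ lf p q -> \forall r \near q, f r = f q) ->
  forall q t, ~ lf p q -> f (G q t) = f q.
Proof.
move=> lc q t npq; rewrite -[in RHS](flow0 F q).
apply: (connected_locally_constant (f := f \o G q) (@connectedRT R)) => // u _.
have npu : ~ lf p (G q u).
  move=> h; apply: npq; apply: (same_leaf_trans h); apply: same_leaf_sym.
  exact: same_leaf_flow.
have H : \forall u' \near u, f (G q u') = f (G q u) := flow_line_cont (lc _ npu).
by apply: filterS H.
Qed.

(* The Z/2-valued cocycle that jumps by one across the leaf of [p] has a
   primitive since [M] is a plane: it tells the two sides of the leaf. *)
Lemma leaf_sides : exists f : M -> bool,
  (forall q, ~ lf p q -> \forall r \near q, f r = f q) /\
  (forall q, sat q -> f q = (0 < th q)).
Proof.
(* On the leaf of [p] the local primitive is the indicator of the positive side; off the leaf it is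
   zero. Near a point off the leaf the two differ by a constant, as [th] does not vanish there. *)
pose t q r := `[< [/\ lf p q, sat r & 0 < th r] >].
have tF q r : ~ lf p q -> t q r = false by move=> h; apply/asboolPn => -[].
have tT q r : lf p q -> sat r -> t q r = (0 < th r).
  by move=> pq Ur; apply/asboolP/idP => [[]|].
have tqq q : t q q = false.
  have [h|h] := pselect (lf p q); last exact: tF.
  by have [Uq E] := sat_coord0 h; rewrite tT // E ltxx.
have [|f hf] := plane_cocycle (lined_plane_homeo S) (t := t).
  move=> q; have [pq|npq] := pselect (lf p q); last first.
    apply: filterS (leaf_compl_open F npq) => q' npq'.
    by apply: filterE => r; rewrite !(tF q) // tqq; rewrite (tF q').
  apply: filterS (sat_open (sat_coord0 pq).1) => q' Uq'.
  have [pq'|npq'] := pselect (lf p q').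
    apply: filterS (sat_open Uq') => r Ur.
    by rewrite !tT // addbb (sat_coord0 pq').2 ltxx.
  have ne : th q' != 0.
    apply/eqP => e; apply: npq'; have [Up p0] := sat_base.
    by apply: sat_coord_inj => //; rewrite p0 e.
  have H : \forall r \near q', (0 < th r) = (0 < th q').
    have [gt|lt|e] := ltgtP 0 (th q'); last by rewrite -e eqxx in ne.
      by apply: filterS (near_gt (sat_coord_cont Uq') gt) => r ->.
    apply: filterS (near_lt (sat_coord_cont Uq') lt) => r h.
    by apply/negbTE; rewrite -leNgt ltW.
  by apply: filterS2 (sat_open Uq') H => r Ur E; rewrite !(tF q') // !addbF !tT.
have fa q : ~ lf p q -> \forall r \near q, f r = f q.
  by move=> npq; apply: filterS (hf q) => r; rewrite !tF // !addbF.
have fb q : lf p q -> \forall r \near q, f r (+) t q r = f q.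
  by move=> pq; apply: filterS (hf q) => r ->; rewrite tqq addbF.
have fL q : lf p q -> f q = f p.
  move=> /(flow_leaf F)[u ->]; rewrite -[in RHS](flow0 F p).
  apply: (connected_locally_constant (f := f \o G p) (@connectedRT R)) => // v _.
  have pv := same_leaf_flow F p v.
  have H : \forall w \near v, f (G p w) (+) t (G p v) (G p w) = f (G p v) :=
    flow_line_cont (fb _ pv).
  apply: filterS H => w /= <- _.
  have [U E] := sat_coord0 (same_leaf_flow F p w).
  by rewrite tT // E ltxx addbF.
pose g q := f q (+) f p.
have ga q : ~ lf p q -> \forall r \near q, g r = g q.
  by move=> /fa; apply: filterS => r E; rewrite /g E.
exists g; split => // q Uq.
have g0 : \forall r \near p, sat r -> g r = (0 < th r).
  have pp := lf_refl p; apply: filterS (fb p pp) => r E Ur.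
  by rewrite /g -E tT // addKb.
have cs v : `|v| < 2 -> {for v, continuous s} by case: (tr) => _ _ h _ _ /h[].
have s0 : s 0 = p by case: (tr).
have nls v : `|v| < 2 -> v != 0 -> ~ lf p (s v).
  by move=> v2 v0 /sat_coord0[_]; rewrite (sat_s v2).2 => /eqP; rewrite (negbTE v0).
(* The primitive property gives this near [v = 0]; each half of the transversal avoids the leaf of
   [p], so local constancy extends it. *)
have gs v : `|v| < 2 -> v != 0 -> g (s v) = (0 < v).
  move=> v2 v0.
  have H : \forall w \near 0, `|w| < 2 -> g (s w) = (0 < w).
    have H : \forall w \near 0, sat (s w) -> g (s w) = (0 < th (s w)).
      have n0 : nbhs (s 0) [set r | sat r -> g r = (0 < th r)] by rewrite s0.
      by apply: (cs 0 _ _ n0); rewrite normr0 ltr0n.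
    by apply: filterS H => w h w2; have [Uw E] := sat_s w2; rewrite h // E.
  have /nbhsRP[e e0 he] := H.
  have close (a b : R) : `|a| < 2 -> `|b| < 2 -> 0 < a * b -> g (s a) = g (s b).
    wlog xy : a b / a <= b => [hw x2 y2 xy0|x2 y2 xy0].
      have [/hw->//|/ltW /hw <- //] := leP a b; by rewrite mulrC.
    apply: (@connected_locally_constant _ _ `[a, b] (g \o s)) => //=.
    - exact: segment_connected.
    - move=> z /(same_sign_itv x2 y2 xy0)[z2 z0].
      have H' : \forall w \near z, g (s w) = g (s z) := cs z z2 _ (ga _ (nls z z2 z0)).
      by apply: filterS H'.
    - by rewrite in_itv /= lexx xy.
    - by rewrite in_itv /= lexx xy.
  (* [v] shrunk to a size below [e], with the same sign. *)
  pose w := Num.min (e / 2) `|v| / `|v| * v.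
  have nv : 0 < `|v| by rewrite normr_gt0.
  have m0 : 0 < Num.min (e / 2) `|v| by rewrite lt_min nv divr_gt0.
  have nw : `|w| = Num.min (e / 2) `|v|.
    by rewrite /w !normrM normfV normr_id divfK ?gt_eqF // gtr0_norm.
  have w2 : `|w| < 2 by rewrite nw; apply: le_lt_trans v2; rewrite ge_min lexx orbT.
  have wv : 0 < w * v.
    by rewrite /w -mulrA mulr_gt0 ?divr_gt0 // -expr2 exprn_even_gt0.
  rewrite -(close w v) // he //; last first.
    by rewrite sub0r normrN nw; apply: (@le_lt_trans _ _ (e / 2)); [rewrite ge_min lexx | lra].
  by apply/idP/idP => h; move: wv; [rewrite (pmulr_rgt0 _ h) | rewrite (pmulr_lgt0 _ h)].
have q2 := sat_coord_lt Uq.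
have [/eqP q0|q0] := boolP (th q == 0).
  have pq : lf p q by have [Up p0] := sat_base; apply: sat_coord_inj => //; rewrite p0 q0.
  by rewrite q0 ltxx /g fL // addbb.
have npq : ~ lf p q by move=> /sat_coord0[_ /eqP]; rewrite (negbTE q0).
have /(flow_leaf F)[u E] := sat_coord_leaf Uq.
by rewrite -(gs _ q2 q0) E off_leaf_constant.
Qed.

(** The coordinate truncated to [[-1, 1]], continued off [sat] by the sign of the side. Continuity
    is at stake at a leaf outside [sat] approached by leaves of [sat]: by [sat_strip_closed] these
    have a coordinate beyond 1 in absolute value, so their truncated value is already the sign of
    their side. *)
Lemma leaf_function_sat : exists Th : M -> R,
  [/\ continuous Th, forall q r, lf q r -> Th q = Th r, forall q, `|Th q| <= 1,
   forall q r, `|Th q| < 1 -> Th q = Th r -> lf q r &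
   forall v, `|v| < 1 -> Th (s v) = v].
Proof.
have [f [fc fsat]] := leaf_sides.
pose clamp (a : R) := Num.max (-1) (Num.min 1 a).
have clampE a : `|a| <= 1 -> clamp a = a.
  by rewrite ler_norml => /andP[h1 h2]; rewrite /clamp min_r // max_r.
have clampN a : 1 < `|a| -> clamp a = if 0 < a then 1 else -1.
  rewrite /clamp; have [a0|a0] := ltP 0 a.
    rewrite gtr0_norm // => a1; rewrite min_l ?(ltW a1) // max_r //; lra.
  by rewrite ler0_norm // => a1; rewrite min_r ?max_l //; lra.
have clamp1 a : `|clamp a| <= 1.
  rewrite /clamp ler_norml le_max lexx /= ge_max ge_min lexx /= andbT; lra.
have clampC : continuous clamp.
  move=> a; have c1 (b : R) : {for a, continuous (fun=> b)} by exact: cvg_cst.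
  have c2 : {for a, continuous (fun x : R => x)} by exact: cvg_id.
  exact: (continuous_max (c1 (-1)) (continuous_min (c1 1) c2)).
pose Th q := if `[< sat q >] then clamp (th q) else if f q then 1 else -1.
have ThT q : sat q -> Th q = clamp (th q) by move=> h; rewrite /Th asboolT.
have ThF q : ~ sat q -> Th q = if f q then 1 else -1 by move=> h; rewrite /Th asboolF.
have nsat q : ~ sat q -> ~ lf p q by move=> h /sat_coord0[].
have Thin q : `|Th q| < 1 -> sat q /\ th q = Th q.
  have [Uq|nUq] := pselect (sat q); last first.
    by rewrite ThF //; case: (f q); rewrite ?normrN normr1 ltxx.
  rewrite ThT //; have [h|h] := leP `|th q| 1; first by rewrite clampE.
  by rewrite clampN //; case: ifP; rewrite ?normrN normr1 ltxx.
exists Th; split.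
- move=> r; have [Ur|nUr] := pselect (sat r).
    have c : {for r, continuous (clamp \o th)}.
      by apply: continuous_comp; [exact: sat_coord_cont | exact: clampC].
    move=> W; rewrite ThT // => /c H.
    have H' : \forall q \near r, W (clamp (th q)) := H.
    by apply: filterS2 (sat_open Ur) H' => q Uq; rewrite /= ThT.
  have nK : ~ (sat r /\ `|th r| <= 1) by move=> [].
  move=> W /nbhs_singleton WTh; apply: filterS2 (sat_strip_closed nK) (fc _ (nsat _ nUr)) => q nKq fq.
  rewrite /=; suff -> : Th q = Th r by [].
  rewrite [in RHS]ThF // -fq; have [Uq|nUq] := pselect (sat q); last by rewrite ThF.
  rewrite ThT // clampN ?fsat // ltNge; apply/negP => h; exact: nKq.
- move=> q r qr; have [Uq|nUq] := pselect (sat q).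
    by have [Ur E] := sat_leaf qr Uq; rewrite !ThT // E.
  have nUr : ~ sat r by move=> /(sat_leaf (same_leaf_sym qr))[].
  rewrite !ThF //; have /(flow_leaf F)[t ->] := qr.
  by rewrite off_leaf_constant //; exact: nsat.
- move=> q; have [Uq|nUq] := pselect (sat q); first by rewrite ThT.
  by rewrite ThF //; case: ifP; rewrite ?normrN normr1.
- move=> q r q1 qr; have [Uq Eq] := Thin q q1; rewrite qr in q1.
  by have [Ur Er] := Thin r q1; apply: sat_coord_inj => //; rewrite Eq Er.
- move=> v v1; have [|Us E] := @sat_s v; first by apply: lt_trans v1 _; rewrite ltr1n.
  by rewrite ThT // E clampE // ltW.
Qed.

End Saturation.

Definition leaf_function p (Th : M -> R) (s : R -> M) := [/\ s 0 = p,
  [/\ continuous Th, forall q r, lf q r -> Th q = Th r & forall q, `|Th q| <= 1],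
  forall q r, `|Th q| < 1 -> Th q = Th r -> lf q r &
  forall v, `|v| < 1 -> {for v, continuous s} /\ Th (s v) = v].

Lemma leaf_function_exists p : exists Ths, leaf_function p Ths.1 Ths.2.
Proof.
have [s [y [V tr]]] := leaf_transversal_exists S p.
have [Th [h1 h2 h3 h4 h5]] := leaf_function_sat tr.
exists (Th, s); split => //; first by case: tr.
move=> v v1; split; last exact: h5.
by case: tr => _ _ /(_ v (lt_trans v1 _))[//|]; rewrite ?ltr1n.
Qed.

End LeafFunction.

(** * The order on the leaves *)

Section LeafOrder.
Variables (R : realType) (M : topologicalType) (S : lined_plane R M).
Variable F : geodesic_flow S.
Local Notation D := (ldist S).
Local Notation lf := (same_leaf S).
Local Notation G := (flow F).
Local Notation lf_refl := (same_leaf_refl F).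

Lemma near_sign (T : topologicalType) (f : T -> R) x : {for x, continuous f} ->
  f x != 0 -> \forall y \near x, (0 < f y) = (0 < f x).
Proof.
move=> c; rewrite neq_lt => /orP[f0|f0].
  apply: filterS (near_lt c f0) => y fy.
  by rewrite !ltNge (ltW fy) (ltW f0).
by apply: filterS (near_gt c f0) => y fy; rewrite fy f0.
Qed.

(* Since a neighbourhood [0 < Th < v] of the leaf [Th = 0] in its positive side
   is connected, so is the whole positive side. *)
Lemma side_constant (Y : Type) (Th : M -> R) (s : R -> M) (P : M -> Y) :
  continuous Th -> (forall q r, lf q r -> Th q = Th r) ->
  (forall q r, `|Th q| < 1 -> Th q = Th r -> lf q r) ->
  (forall v, `|v| < 1 -> {for v, continuous s} /\ Th (s v) = v) ->
  (forall r, 0 < Th r -> \forall r' \near r, P r' = P r) ->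
  forall q r, 0 < Th q -> 0 < Th r -> P q = P r.
Proof.
move=> cTh invTh injTh sTh Ploc q r q0 r0.
have v1 (v : R) : 0 < v -> v < 1 -> `|v| < 1 by move=> v0 v1; rewrite gtr0_norm.
have Porbit x t : 0 < Th x -> P (G x t) = P x.
  move=> x0; rewrite -[in RHS](flow0 F x).
  apply: (connected_locally_constant (f := P \o G x) (@connectedRT R)) => // u _.
  have x0' : 0 < Th (G x u) by rewrite -(invTh _ _ (same_leaf_flow F x u)).
  have H : \forall u' \near u, P (G x u') = P (G x u) := flow_line_cont (Ploc _ x0').
  by apply: filterS H.
have Psec (a b : R) : 0 < a < 1 -> 0 < b < 1 -> P (s a) = P (s b).
  move=> a01 b01.
  have co : connected `](0 : R), 1[ by apply/connected_intervalP; exact: interval_is_interval.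
  apply: (connected_locally_constant (f := P \o s) co); rewrite /= ?in_itv //=.
  move=> v; rewrite in_itv /= => /andP[v0 vlt1]; have [cs E] := sTh v (v1 v v0 vlt1).
  have sv0 : 0 < Th (s v) by rewrite E.
  have H : \forall w \near v, P (s w) = P (s v) := cs _ (Ploc _ sv0).
  by apply: filterS H.
have collar x : 0 < Th x -> Th x < 1 -> P x = P (s (1 / 2)).
  move=> x0 x1; have xx := v1 _ x0 x1.
  have [_ E] := sTh _ xx.
  have /(flow_leaf F)[t tE] : lf x (s (Th x)) by apply: injTh => //; rewrite E.
  rewrite -(Porbit x t x0) -tE; apply: Psec; first by rewrite x0.
  by apply/andP; split; lra.
(* [P] is extended by its value on the collar; the extension is locally constant on all of [M], also
   across [Th = 0]. *)
pose P' x := if 0 < Th x then P x else P (s (1 / 2)).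
have := plane_locally_constant (lined_plane_homeo S) (f := P') _ q r.
rewrite /P' q0 r0; apply => x; case: (ltP 0 (Th x)) => x0.
  by apply: filterS2 (near_gt (cTh x) x0) (Ploc x x0) => y -> .
have x1 : Th x < 1 by lra.
apply: filterS (near_lt (cTh x) x1) => y y1.
by case: ltP => // y0; exact: collar.
Qed.

Variable p0 : M.

(** The choice depends only on the set of points of the leaf, so all points of a leaf get the same
    leaf function. *)
Definition leaf_rep p := xget p0 [set q | lf p q].

Lemma leaf_repP p : lf p (leaf_rep p).
Proof. exact: (xgetPex p0 (P := [set q | lf p q]) (ex_intro _ p (lf_refl p))). Qed.

Lemma leaf_rep_eq p q : lf p q -> leaf_rep p = leaf_rep q.
Proof.
move=> pq; congr xget; apply/seteqP; split => r /=; last exact: same_leaf_trans.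
by apply: same_leaf_trans; exact: same_leaf_sym.
Qed.

Definition leaf_fun_pair p := projT1 (cid (leaf_function_exists F (leaf_rep p))).

Lemma leaf_fun_pairP p :
  leaf_function S (leaf_rep p) (leaf_fun_pair p).1 (leaf_fun_pair p).2.
Proof. exact: (projT2 (cid (leaf_function_exists F (leaf_rep p)))). Qed.

Local Notation E p := (leaf_fun_pair p).1.

(** Each leaf function is determined only up to sign. Off the leaf of [p0] the sign is the one for
    which [p] is above [p0] exactly when [p0] is not above [p]; on that leaf it is 1 by
    convention. *)
Definition leaf_sign p : R :=
  if `[< lf p0 p >] || ((0 < E p0 p) (+) (0 < E p p0)) then 1 else -1.

(* [height p] is positive on one side of the leaf of [p] and negative on the
   other one; the signs are chosen coherently, by comparison with [p0]. *)
Definition height p q := leaf_sign p * E p q.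

Definition cross p v := (leaf_fun_pair p).2 (leaf_sign p * v).

Lemma leaf_sign_cases p : leaf_sign p = 1 \/ leaf_sign p = -1.
Proof. by rewrite /leaf_sign; case: ifP; [left|right]. Qed.

Lemma leaf_signK p a : leaf_sign p * (leaf_sign p * a) = a.
Proof. by case: (leaf_sign_cases p) => ->; rewrite ?mul1r // !mulN1r opprK. Qed.

Lemma leaf_sign_norm p a : `|leaf_sign p * a| = `|a|.
Proof. by case: (leaf_sign_cases p) => ->; rewrite ?mul1r // !mulN1r normrN. Qed.

Lemma height_cont p : continuous (height p).
Proof.
have [_ [cE _ _] _ _] := leaf_fun_pairP p.
by move=> q; apply: (continuousM (s := fun=> leaf_sign p) (t := E p)); [exact: cvg_cst | exact: cE].
Qed.

Lemma height_leaf p q r : lf q r -> height p q = height p r.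
Proof.
by move=> qr; rewrite /height; case: (leaf_fun_pairP p) => _ [_ h _] _ _; rewrite (h q r).
Qed.

Lemma height_le1 p q : `|height p q| <= 1.
Proof. by rewrite leaf_sign_norm; case: (leaf_fun_pairP p) => _ []. Qed.

Lemma height_inj p q r : `|height p q| < 1 -> height p q = height p r -> lf q r.
Proof.
rewrite leaf_sign_norm => q1 /(congr1 ( *%R (leaf_sign p))); rewrite !leaf_signK.
by case: (leaf_fun_pairP p) => _ _ h _; exact: h.
Qed.

Lemma cross_cont p v : `|v| < 1 -> {for v, continuous (cross p)}.
Proof.
move=> v1; apply: (continuous_comp (f := fun v => leaf_sign p * v) (g := (leaf_fun_pair p).2)).
  by apply: continuousM; [exact: cvg_cst | exact: cvg_id].
by case: (leaf_fun_pairP p) => _ _ _ /(_ (leaf_sign p * v)); rewrite leaf_sign_norm => /(_ v1)[].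
Qed.

Lemma height_cross p v : `|v| < 1 -> height p (cross p v) = v.
Proof.
move=> v1; rewrite /height; case: (leaf_fun_pairP p) => _ _ _ /(_ (leaf_sign p * v)).
by rewrite leaf_sign_norm => /(_ v1)[_ ->]; rewrite leaf_signK.
Qed.

Lemma cross0 p : lf p (cross p 0).
Proof.
by rewrite /cross mulr0; case: (leaf_fun_pairP p) => -> _ _ _; exact: leaf_repP.
Qed.

Lemma height_self p q : lf p q -> height p q = 0.
Proof.
move=> pq; rewrite -(height_leaf p pq) (height_leaf p (cross0 p)).
by rewrite height_cross // normr0 ltr01.
Qed.

Lemma height_neq0 p q : ~ lf p q -> height p q != 0.
Proof.
move=> npq; apply/eqP => h; apply: npq.
apply: (@height_inj p); rewrite (height_self (lf_refl p)) ?h // normr0 ltr01 //.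
Qed.

Lemma height_rep p p' : lf p p' -> height p = height p'.
Proof.
move=> pp'; apply/funext => q.
have E1 : leaf_fun_pair p = leaf_fun_pair p' by rewrite /leaf_fun_pair (leaf_rep_eq pp').
have E2 : E p0 p = E p0 p' by case: (leaf_fun_pairP p0) => _ [_ h _] _ _; exact: h.
have E3 : `[< lf p0 p >] = `[< lf p0 p' >].
  apply/asboolP/asboolP => h; first exact: same_leaf_trans pp'.
  by apply: (same_leaf_trans h); exact: same_leaf_sym.
by rewrite /height /leaf_sign E1 E2 E3.
Qed.

Lemma height_base p : ~ lf p0 p -> (0 < height p0 p) = ~~ (0 < height p p0).
Proof.
move=> np; have np' : ~ lf p p0 by move=> /same_leaf_sym.
have E0 : E p p0 != 0.
  by have := height_neq0 np'; rewrite /height mulf_eq0 negb_or => /andP[].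
have s0 : leaf_sign p0 = 1 by rewrite /leaf_sign asboolT //; exact: lf_refl.
rewrite {1}/height s0 mul1r /height /leaf_sign asboolF //=.
have [h'|h'] := ltP 0 (E p p0); case: (0 < E p0 p); rewrite /= ?mul1r ?mulN1r ?oppr_gt0.
- by rewrite -leNgt ltW.
- by rewrite h'.
- by rewrite -leNgt h'.
- by rewrite lt_neqAle E0 h'.
Qed.

Lemma height_side (Y : Type) p (P : M -> Y) :
  (forall r, ~ lf p r -> \forall r' \near r, P r' = P r) ->
  forall q r, ~ lf p q -> ~ lf p r -> (0 < height p q) = (0 < height p r) -> P q = P r.
Proof.
move=> Ploc q r /height_neq0 q0 /height_neq0 r0 qr.
have [hq|hq] := boolP (0 < height p q).
  have hr : 0 < height p r by rewrite -qr.
  apply: (@side_constant _ (height p) (cross p)) hq hr.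
  - exact: height_cont.
  - exact: height_leaf.
  - exact: height_inj.
  - by move=> v v1; split; [exact: cross_cont | exact: height_cross].
  - by move=> x x0; apply: Ploc => /height_self e; rewrite e ltxx in x0.
have hq' : 0 < - height p q by rewrite oppr_gt0 lt_neqAle q0 leNgt.
have hr' : 0 < - height p r by rewrite oppr_gt0 lt_neqAle r0 leNgt -qr.
apply: (@side_constant _ (fun x => - height p x) (fun v => cross p (- v))) hq' hr'.
- by move=> x; apply: continuousN; exact: height_cont.
- by move=> x y xy; rewrite (height_leaf p xy).
- by move=> x y; rewrite normrN => x1 /oppr_inj; exact: height_inj.
- move=> v v1; rewrite height_cross ?normrN // opprK; split => //.
  apply: (continuous_comp (f := -%R) (g := cross p)); first exact: opp_continuous.
  by apply: cross_cont; rewrite normrN.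
- by move=> x x0; apply: Ploc => /height_self e; rewrite e oppr0 ltxx in x0.
Qed.

Lemma height_loc p q : ~ lf p q -> \forall r \near q, (0 < height p r) = (0 < height p q).
Proof. by move=> /height_neq0; apply: near_sign; exact: height_cont. Qed.

Lemma cross_neq p v : `|v| < 1 -> v != 0 -> ~ lf p (cross p v).
Proof.
by move=> v1 v0 /height_self; rewrite height_cross // => /eqP; rewrite (negbTE v0).
Qed.

(** Lying above [p'] in the sense of [height p] is locally constant off the leaf of [p'], hence
    constant on each of its two sides, and it takes both values. It therefore agrees with the sign
    of [height p'] up to a global flip, which a single witness [q0] decides. *)
Lemma height_coherent_at p p' q0 : `|height p p'| < 1 -> ~ lf p' q0 ->
  (0 < height p' q0) = (height p p' < height p q0) ->
  forall q, ~ lf p' q -> (0 < height p' q) = (height p p' < height p q).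
Proof.
set v := height p p' => v1 nq0 w.
pose B q := v < height p q.
have ne x : ~ lf p' x -> height p x != v.
  by move=> n; apply/eqP => e; apply: n; apply: (@height_inj p); rewrite ?e.
have Bloc r : ~ lf p' r -> \forall r' \near r, B r' = B r.
  move=> nr; have c : {for r, continuous (fun x => height p x - v)}.
    by apply: continuousB; [exact: height_cont | exact: cvg_cst].
  have n0 : height p r - v != 0 by rewrite subr_eq0 ne.
  by apply: filterS (near_sign c n0) => x; rewrite !subr_gt0.
have Bside := height_side Bloc.
have /andP[v1' v1''] : -1 < v < 1 by rewrite -ltr_norml.
(* Levels strictly between [v] and 1, and between -1 and [v]: their crossing points lie on either
   side of [p']. *)
pose a := (v + 1) / 2; pose b := (v - 1) / 2.
have a1 : `|a| < 1 by rewrite /a ltr_norml; apply/andP; split; lra.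
have b1 : `|b| < 1 by rewrite /b ltr_norml; apply/andP; split; lra.
have va : v < a by rewrite /a; lra.
have bv : b < v by rewrite /b; lra.
have na : ~ lf p' (cross p a) by move=> /(height_leaf p); rewrite height_cross // -/v; lra.
have nb : ~ lf p' (cross p b) by move=> /(height_leaf p); rewrite height_cross // -/v; lra.
have Ba : B (cross p a) by rewrite /B height_cross.
have Bb : B (cross p b) = false by rewrite /B height_cross // ltNge ltW.
have ab : (0 < height p' (cross p a)) != (0 < height p' (cross p b)).
  by apply/eqP => e; have := Bside _ _ na nb e; rewrite Ba Bb.
have key x : ~ lf p' x -> (0 < height p' x) = (0 < height p' (cross p a)) -> B x.
  by move=> nx e; rewrite (Bside _ _ nx na e).
have key' x : ~ lf p' x -> (0 < height p' x) = (0 < height p' (cross p b)) -> B x = false.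
  by move=> nx e; rewrite (Bside _ _ nx nb e).
have := key q0 nq0; have := key' q0 nq0; rewrite -/(B q0) in w *.
move=> k1 k2 q nq; have := key q nq; have := key' q nq; rewrite -/(B q); move: k1 k2 w ab.
case: (0 < height p' (cross p a)); case: (0 < height p' (cross p b)) => //;
case: (0 < height p' q0); case: (0 < height p' q); case: (B q0); case: (B q) => //; intuition.
Qed.

(** The witness is [p0], against which all signs were fixed by [height_base]: it stays on the same
    side as [p'] moves near [p]. On the leaf of [p0] itself, [height_base] decides directly. *)
Lemma height_coherent_near p : \forall p' \near p, forall q, ~ lf p' q ->
  (0 < height p' q) = (height p p' < height p q).
Proof.
have hp0 : height p p = 0 by apply: height_self; exact: lf_refl.
have small : \forall p' \near p, `|height p p'| < 1.
  have c : {for p, continuous (fun x => `|height p x|)}.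
    by apply: (continuous_comp (f := height p)); [exact: height_cont | exact: norm_continuous].
  by apply: (near_lt c); rewrite hp0 normr0 ltr01.
have [pp|np] := pselect (lf p0 p).
  apply: filterS small => p' s1; have [pp'|np'] := pselect (lf p0 p').
    have e : lf p p' by apply: same_leaf_trans pp'; exact: same_leaf_sym.
    by move=> q _; rewrite (height_rep e) (height_self (lf_refl p')).
  apply: (height_coherent_at (q0 := p0)) => //; first by move=> /same_leaf_sym.
  have := height_base np'; rewrite -(height_rep pp) (height_self (lf_refl p0)).
  have := height_neq0 np'; rewrite neq_lt => /orP[h|h].
    by rewrite h ltNge (ltW h) /= => /esym/negbFE ->.
  by rewrite h => /esym/negbTE ->; rewrite ltNge (ltW h).
have np' : ~ lf p p0 by move=> /same_leaf_sym.
have near2 : \forall p' \near p, (height p p' < height p p0) = (0 < height p p0).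
  have c : {for p, continuous (fun x => height p p0 - height p x)}.
    by apply: continuousB; [exact: cvg_cst | exact: height_cont].
  have := near_sign c; rewrite hp0 subr0 => /(_ (height_neq0 np')).
  by apply: filterS => x; rewrite subr_gt0.
near=> p'.
have n0 : ~ lf p0 p' by near: p'; exact: (leaf_compl_open F np).
apply: (height_coherent_at (q0 := p0)).
- by near: p'.
- by move=> /same_leaf_sym.
have -> : (height p p' < height p p0) = (0 < height p p0) by near: p'.
apply: negb_inj; rewrite -(height_base n0) -(height_base np); near: p'.
exact: height_loc.
Unshelve. all: by end_near.
Qed.

(** With [q] fixed, the sign of [height x q] is locally constant in [x] off the leaf of [q], hence
    constant on each side of it; it is computed for [x] on the transversal of [q], close to [q]. *)
Lemma height_antisym p q : ~ lf p q -> (0 < height p q) = (height q p < 0).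
Proof.
move=> npq; have nqp : ~ lf q p by move=> /same_leaf_sym.
pose P x := 0 < height x q.
have Ploc r : ~ lf q r -> \forall r' \near r, P r' = P r.
  move=> nqr; have nrq : ~ lf r q by move=> /same_leaf_sym.
  have near2 : \forall x \near r, (height r x < height r q) = (0 < height r q).
    have c : {for r, continuous (fun x => height r q - height r x)}.
      by apply: continuousB; [exact: cvg_cst | exact: height_cont].
    have := near_sign c; rewrite (height_self (lf_refl r)) subr0 => /(_ (height_neq0 nrq)).
    by apply: filterS => x; rewrite subr_gt0.
  apply: filterS2 (leaf_compl_open F nqr) (filterI near2 (height_coherent_near r)).
  by move=> x nqx [e h]; rewrite /P -e; apply: h => /same_leaf_sym.
have [e e0 he] : exists2 e : R, 0 < e & forall v, `|v| < e -> `|v| < 1 -> v != 0 ->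
    P (cross q v) = (v < 0).
  have c0 := @cross_cont q 0; rewrite normr0 ltr01 in c0.
  have H : \forall v \near 0, forall x, ~ lf (cross q v) x ->
      (0 < height (cross q v) x) = (height (cross q 0) (cross q v) < height (cross q 0) x).
    exact: (c0 isT _ (height_coherent_near (cross q 0))).
  have /nbhsRP[e e0 h] := H; exists e => // v ve v1 v0.
  have nl : ~ lf (cross q v) q by move=> /same_leaf_sym; exact: cross_neq.
  rewrite /P h //; last by rewrite sub0r normrN.
  by rewrite -(height_rep (cross0 q)) height_cross // (height_self (lf_refl q)).
have hqp := height_neq0 nqp.
(* A small level on the same side of [q] as [p]. *)
pose w := Num.min (e / 2) (1 / 2) * (if 0 < height q p then 1 else -1).
have m0 : 0 < Num.min (e / 2) (1 / 2) by rewrite lt_min; apply/andP; split; lra.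
have me : Num.min (e / 2) (1 / 2) < e by rewrite gt_min; apply/orP; left; lra.
have m1 : Num.min (e / 2) (1 / 2) < 1 by rewrite gt_min; apply/orP; right; lra.
have nw : `|w| = Num.min (e / 2) (1 / 2).
  by rewrite /w; case: ifP; rewrite ?mulr1 ?mulrN1 ?normrN gtr0_norm.
have w0 : w != 0 by rewrite -normr_eq0 nw gt_eqF.
have w1 : `|w| < 1 by rewrite nw.
have sw : (0 < w) = (0 < height q p).
  by rewrite /w; case: ifP => _; rewrite ?mulr1 // mulrN1 oppr_gt0 ltNge ltW.
have E1 : P p = P (cross q w).
  by apply: (height_side Ploc nqp (cross_neq w1 w0)); rewrite height_cross // sw.
rewrite -/(P p) E1 he ?nw //.
by apply: negb_inj; rewrite -!leNgt !le_eqVlt ![0 == _]eq_sym (negbTE w0) (negbTE hqp) /= sw.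
Qed.

(** Antisymmetry lets [p] itself serve as witness, which removes the condition that [p'] be near
    [p]. *)
Lemma height_coherent p p' q : `|height p p'| < 1 -> ~ lf p' q ->
  (0 < height p' q) = (height p p' < height p q).
Proof.
move=> p'1; have [pp'|npp'] := pselect (lf p p').
  by move=> _; rewrite (height_rep pp') (height_self (lf_refl p')).
have np'p : ~ lf p' p by move=> /same_leaf_sym.
apply: (height_coherent_at (q0 := p)) => //.
by rewrite (height_self (lf_refl p)); exact: height_antisym.
Qed.

(** The positive side of [q] does not meet the leaf of [p], which is below [q]; so the sign of
    [height p] is constant there, and it is positive just above [q]. *)
Lemma height_trans q p r : 0 < height p q -> 0 < height q r -> 0 < height p r.
Proof.
move=> pq qr; have npq : ~ lf p q by move=> /height_self e; rewrite e ltxx in pq.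
have qp : height q p < 0 by rewrite -height_antisym.
pose P x := 0 < height p x.
have Ploc x : 0 < height q x -> \forall x' \near x, P x' = P x.
  move=> x0; apply: height_loc => /(height_leaf q) e; move: qp x0; rewrite e; lra.
have c0 := @cross_cont q 0; rewrite normr0 ltr01 in c0.
have pq0 : 0 < height p (cross q 0) by rewrite -(height_leaf p (cross0 q)).
have H : \forall v \near 0, 0 < height p (cross q v).
  exact: (c0 isT _ (near_gt (height_cont (p := p) (x := cross q 0)) pq0)).
have /nbhsRP[e e0 h] := H.
pose w := Num.min (e / 2) (1 / 2).
have m0 : 0 < w by rewrite lt_min; apply/andP; split; lra.
have me : w < e by rewrite gt_min; apply/orP; left; lra.
have m1 : `|w| < 1 by rewrite gtr0_norm // gt_min; apply/orP; right; lra.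
have : P (cross q w) by apply: h; rewrite sub0r normrN gtr0_norm.
suff -> : P (cross q w) = P r by [].
apply: (@side_constant _ (height q) (cross q)) => //.
- exact: height_cont.
- exact: height_leaf.
- exact: height_inj.
- by move=> v v1; split; [exact: cross_cont | exact: height_cross].
- by rewrite height_cross.
Qed.

(** Otherwise the leaf [k] at the mean of the two levels would lie below [p] and above [q], against
    transitivity. The mean of two distinct levels in [[-1, 1]] is never 1 or -1, so this leaf
    exists. *)
Lemma height_mono p q m : 0 < height p q -> height m p <= height m q.
Proof.
move=> pq; rewrite leNgt; apply/negP => h.
have := height_le1 m p; have := height_le1 m q; rewrite !ler_norml => /andP[q1 q2] /andP[p1 p2].
pose v := (height m p + height m q) / 2.
have v1 : `|v| < 1 by rewrite /v ltr_norml; apply/andP; split; lra.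
have vk := height_cross m v1; set k := cross m v in vk.
have kp : ~ lf k p by move=> /(height_leaf m); rewrite vk /v; lra.
have kq : ~ lf k q by move=> /(height_leaf m); rewrite vk /v; lra.
have k1 : `|height m k| < 1 by rewrite vk.
have kp0 : 0 < height k p by rewrite (height_coherent k1 kp) vk /v; lra.
have := height_coherent k1 kq; rewrite vk => kq0.
have : 0 < height k q by exact: height_trans pq.
by rewrite kq0 /v; lra.
Qed.

End LeafOrder.

(** * The leaf parameter and the time along the leaves *)

Section HalfSum.
Variables (R : realType) (T : Type) (u : nat -> T -> R).
Hypothesis u_le1 : forall n x, `|u n x| <= 1.

Let w (n : nat) : R := (1 / 2) ^+ n.

Lemma half_pow_gt0 n : 0 < w n.
Proof. by rewrite exprn_gt0 // divr_gt0. Qed.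

Lemma half_powS n : w n.+1 = w n / 2.
Proof. by rewrite /w exprS mulrC mulrA mulr1. Qed.

Lemma half_pow_small (e : R) : 0 < e -> exists n, w n < e.
Proof.
move=> e0; have bnd n : w n * n.+1%:R <= 1.
  elim: n => [|n IH]; first by rewrite /w expr0 mulr1.
  have n1 : n.+2%:R = n.+1%:R + 1 :> R by rewrite natr1.
  have := half_pow_gt0 n; have : 1 <= n.+1%:R :> R by rewrite ler1n.
  rewrite half_powS n1; move: IH; set a := w n; set b := n.+1%:R; nra.
pose n := Num.truncn e^-1; exists n.
have h : e^-1 < n.+1%:R by exact: truncnS_gt.
have := bnd n; have := half_pow_gt0 n.
have : 1 < e * n.+1%:R by rewrite -(ltr_pM2l e0) mulfV ?gt_eqF // in h.
set b := n.+1%:R; set a := w n => h1 h2 h3.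
rewrite ltNge; apply/negP => ea.
have b0 : 0 < b by rewrite ltr0n.
have : e * b <= a * b by rewrite ler_pM2r.
lra.
Qed.

Definition half_partial N x := \sum_(k < N) w k.+1 * u k x.

(** The sum of the series without limits: the terms after the first [N] contribute at most [w N], so
    subtracting [w N] from the partial sums gives a nondecreasing sequence, and adding it a
    nonincreasing one. *)
Definition half_sum x := sup (range (fun N => half_partial N x - w N)).

Let partialS N x : half_partial N.+1 x = half_partial N x + w N.+1 * u N x.
Proof. by rewrite /half_partial big_ord_recr. Qed.

Let partial_step N m x : (N <= m)%N ->
  half_partial N x - w N <= half_partial m x - w m /\
  half_partial m x + w m <= half_partial N x + w N.
Proof.
move=> /subnKC <-; elim: (m - N)%N => [|k [h1 h2]]; first by rewrite addn0.
rewrite addnS partialS half_powS; move: h1 h2; set a := half_partial _ _.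
have := u_le1 (N + k) x; rewrite ler_norml => /andP[u1 u2].
have := half_pow_gt0 (N + k); set b := w (N + k); move: u1 u2; set c := u _ _.
by move=> c1 c2 b0 h1 h2; split; nra.
Qed.

Let partial_le N m x : half_partial N x - w N <= half_partial m x + w m.
Proof.
have [h1 _] := partial_step x (leq_maxl N m).
have [_ h2] := partial_step x (leq_maxr N m).
have := half_pow_gt0 (maxn N m); lra.
Qed.

Lemma half_sum_approx N x : `|half_sum x - half_partial N x| <= w N.
Proof.
have b1 : half_partial N x - w N <= half_sum x.
  by apply: ub_le_sup; [exists (half_partial 0 x + w 0) => _ [m _ <-] | exists N].
have b2 : half_sum x <= half_partial N x + w N.
  by apply: ge_sup => [|_ [m _ <-]]; [exists (half_partial 0 x - w 0), 0%N | ].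
by rewrite ler_norml; apply/andP; split; lra.
Qed.

Lemma half_sum_le1 x : `|half_sum x| <= 1.
Proof. by have := half_sum_approx 0 x; rewrite /half_partial big_ord0 subr0. Qed.

Lemma half_sum_mono x y n : (forall k, u k x <= u k y) -> u n x < u n y ->
  half_sum x < half_sum y.
Proof.
move=> le lt; pose d := w n.+1 * (u n y - u n x).
have d0 : 0 < d by rewrite mulr_gt0 ?half_pow_gt0 // subr_gt0.
have inc N : 0 <= half_partial N y - half_partial N x.
  elim: N => [|N IH]; first by rewrite /half_partial !big_ord0 subrr.
  rewrite !partialS; have := half_pow_gt0 N.+1; have := le N.
  move: IH; set a := half_partial _ _; set b := half_partial _ _.
  set c := w _; set p := u _ _; set q := u _ _; nra.
have big N : (n < N)%N -> d <= half_partial N y - half_partial N x.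
  elim: N => // N IH; rewrite ltnS leq_eqVlt => /orP[/eqP <-|/IH h].
    rewrite !partialS; move: (inc n); rewrite /d.
    by set a := half_partial _ _; set b := half_partial _ _; nra.
  rewrite !partialS; have := half_pow_gt0 N.+1; have := le N; move: h.
  set a := half_partial _ _; set b := half_partial _ _.
  set c := w _; set p := u _ _; set q := u _ _; nra.
(* Two truncation errors below [d / 2] cannot cancel the gap [d], present in all partial sums beyond
   [n]. *)
have [m hm] : exists m, w m < d / 2 by apply: half_pow_small; lra.
have hw k : w (m + k) <= w m.
  elim: k => [|k IH]; first by rewrite addn0.
  by rewrite addnS half_powS; have := half_pow_gt0 (m + k); lra.
have := half_sum_approx (m + n.+1) x; have := half_sum_approx (m + n.+1) y.
have := big (m + n.+1)%N (leq_addl _ _); have := hw n.+1.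
rewrite !ler_norml => ? ? /andP[? ?] /andP[? ?]; lra.
Qed.

End HalfSum.

Lemma half_sum_cont (R : realType) (T : topologicalType) (u : nat -> T -> R) :
  (forall n x, `|u n x| <= 1) -> (forall n, continuous (u n)) ->
  continuous (half_sum u).
Proof.
move=> u1 cu x.
have cp N : continuous (half_partial u N).
  elim: N => [|N IH] y.
    have -> : half_partial u 0 = fun=> 0 by apply/funext => z; rewrite /half_partial big_ord0.
    exact: cvg_cst.
  have -> : half_partial u N.+1 = fun z => half_partial u N z + (1 / 2) ^+ N.+1 * u N z.
    by apply/funext => z; rewrite /half_partial big_ord_recr.
  apply: continuousD; first exact: IH.
  by apply: continuousM; [exact: cvg_cst | exact: cu].
apply/cvgrPdist_lt => e e0.
have [N hN] := @half_pow_small R (e / 3) ltac:(lra).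
have e3 : 0 < e / 3 by lra.
have H : \forall y \near x, `|half_partial u N x - half_partial u N y| < e / 3.
  by move: (cp N x) => /cvgrPdist_lt /(_ _ e3).
apply: filterS H => y.
have := half_sum_approx u1 N x; have := half_sum_approx u1 N y.
move: hN; set a := half_sum u x; set b := half_sum u y; set c := half_partial u N x.
set d := half_partial u N y; set w := (1 / 2) ^+ N.
rewrite !ler_norml !ltr_norml => ? /andP[? ?] /andP[? ?] /andP[? ?].
by apply/andP; split; lra.
Qed.

Section UnboundedRescaling.
Variables (R : realType) (a b : R).

(** The poles at both ends make it increase from minus to plus infinity on []a, b[]. *)
Definition rescale (x : R) := (b - x)^-1 - (x - a)^-1.

Lemma rescale_lt x y : a < x -> x < y -> y < b -> rescale x < rescale y.
Proof.
move=> ax xy yb; rewrite /rescale.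
have h1 : (b - x)^-1 < (b - y)^-1 by rewrite ltf_pV2 ?posrE; lra.
have h2 : (y - a)^-1 < (x - a)^-1 by rewrite ltf_pV2 ?posrE; lra.
lra.
Qed.

Lemma rescale_cont x : a < x < b -> {for x, continuous rescale}.
Proof.
move=> /andP[ax xb]; apply: continuousB; apply: continuousV.
- by rewrite gt_eqF // subr_gt0.
- by apply: continuousB; [exact: cvg_cst | exact: cvg_id].
- by rewrite gt_eqF // subr_gt0.
- by apply: continuousB; [exact: cvg_id | exact: cvg_cst].
Qed.

Lemma rescale_unbounded x c : a < x < b ->
  exists2 d, 0 < d & forall y, a < y < b ->
    (b - d < y -> c < rescale y) /\ (y < a + d -> rescale y < c).
Proof.
move=> /andP[ax xb].
(* Near one end the pole exceeds [K], while the other term is bounded by its value at [x]; what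
   remains beats [c]. *)
pose K := `|c| + (x - a)^-1 + (b - x)^-1.
have i1 : 0 < (x - a)^-1 by rewrite invr_gt0 subr_gt0.
have i2 : 0 < (b - x)^-1 by rewrite invr_gt0 subr_gt0.
have c0 := normr_ge0 c.
have K0 : 0 < K by rewrite /K; lra.
pose d := Num.min K^-1 (Num.min (b - x) (x - a)).
have d0 : 0 < d by rewrite /d !lt_min invr_gt0 K0 !subr_gt0 xb.
have [d1 d2 d3] : [/\ d <= K^-1, d <= b - x & d <= x - a].
  by rewrite /d !ge_min !lexx !orbT.
have cc : - `|c| <= c <= `|c| by rewrite -ler_norml.
exists d => // y /andP[ay yb]; rewrite /rescale; split => h.
  have h1 : K < (b - y)^-1.
    by rewrite -[K]invrK ltf_pV2 ?posrE ?invr_gt0 //; lra.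
  have h2 : (y - a)^-1 <= (x - a)^-1 by rewrite lef_pV2 ?posrE; lra.
  by move: h1; rewrite /K; lra.
have h1 : K < (y - a)^-1.
  by rewrite -[K]invrK ltf_pV2 ?posrE ?invr_gt0 //; lra.
have h2 : (b - y)^-1 <= (b - x)^-1 by rewrite lef_pV2 ?posrE; lra.
by move: h1; rewrite /K; lra.
Qed.

End UnboundedRescaling.

Section Trivialization.
Variables (R : realType) (M : topologicalType) (S : lined_plane R M).
Variable F : geodesic_flow S.
Hypothesis M_countable : @second_countable M.
Variable p0 : M.
Local Notation D := (ldist S).
Local Notation lf := (same_leaf S).
Local Notation G := (flow F).
Local Notation lf_refl := (same_leaf_refl F).
Local Notation height := (height F p0).
Local Notation cross := (cross F p0).

(** A Lindelof argument: for each base set contained in some strip, one centre of such a strip is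
    recorded at the index of that set. *)
Lemma countable_cover : exists c : nat -> M, forall x, exists n, `|height (c n) x| < 1.
Proof.
have [B /countable_injP[f finj] [Bo Bb]] := M_countable.
pose A n x := exists U, [/\ B U, f U = n & U `<=` [set y | `|height x y| < 1]].
exists (fun n => xget p0 (A n)) => x.
have c : {for x, continuous (fun y => `|height x y|)}.
  by apply: (continuous_comp (f := height x)); [exact: height_cont | exact: norm_continuous].
have H : \forall y \near x, `|height x y| < 1.
  by apply: (near_lt c); rewrite height_self ?normr0 ?ltr01 //; exact: lf_refl.
have [U [BU Ux] UA] := Bb x _ H.
have AU : A (f U) x by exists U.
have [U' [BU' fU' UA']] := xgetPex p0 (ex_intro (A (f U)) x AU).
exists (f U); apply: UA'.
by rewrite (finj U' U) ?inE.
Qed.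

Lemma leaf_height : exists f : M -> R, [/\ continuous f,
  forall x y, lf x y -> f x = f y, forall x, `|f x| <= 1 &
  forall x y, 0 < height x y -> f x < f y].
Proof.
have [c hc] := countable_cover.
have u1 n x : `|height (c n) x| <= 1 by exact: height_le1.
exists (half_sum (fun n => height (c n))); split.
- by apply: half_sum_cont => // n; exact: height_cont.
- move=> x y xy; rewrite /half_sum.
  suff -> : (fun N => half_partial (fun n => height (c n)) N x - (1 / 2) ^+ N) =
      (fun N => half_partial (fun n => height (c n)) N y - (1 / 2) ^+ N) by [].
  apply/funext => N.
  by congr (_ - _); apply: eq_bigr => k _; rewrite (height_leaf F p0 (c k) xy).
- by move=> x; exact: half_sum_le1.
(* All heights are monotone, and the one whose open strip contains [x] is strictly so, since equal
   values there would put [x] and [y] on one leaf. *)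
move=> x y xy; have [n hn] := hc x.
apply: (@half_sum_mono R M (fun n => height (c n)) u1 x y n).
  by move=> k; exact: height_mono.
rewrite lt_neqAle height_mono // andbT; apply/eqP => e.
by have := height_self F p0 (height_inj hn e) => h; rewrite h ltxx in xy.
Qed.

Lemma height_cross_lt z v v' : `|v| < 1 -> `|v'| < 1 -> v < v' ->
  0 < height (cross z v) (cross z v').
Proof.
move=> v1 v1' vv'; rewrite (height_coherent (p := z)) ?height_cross //.
by move=> /(height_leaf F p0 z); rewrite !height_cross // => e; rewrite e ltxx in vv'.
Qed.

Lemma height_pos_or_neg x y : ~ lf x y -> 0 < height x y \/ 0 < height y x.
Proof.
move=> nxy; have nyx : ~ lf y x by move=> /same_leaf_sym.
have := height_neq0 F p0 nxy; rewrite neq_lt => /orP[h|h]; [right|by left].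
by rewrite height_antisym.
Qed.

Lemma leaf_parameter : exists f : M -> R, [/\ continuous f,
  forall x y, lf x y <-> f x = f y,
  forall x y, 0 < height x y -> f x < f y & forall c, exists x, f x = c].
Proof.
have [f [cf invf f1 monof]] := leaf_height.
have half1 : `|1 / 2 : R| < 1 by rewrite gtr0_norm; lra.
have half2 : `|0 : R| < 1 by rewrite normr0; lra.
have half3 : `|- (1 / 2) : R| < 1 by rewrite normrN.
have above x : exists y, f x < f y.
  exists (cross x (1 / 2)); rewrite (invf _ _ (cross0 F p0 x)).
  by apply/monof/height_cross_lt => //; lra.
have below x : exists y, f y < f x.
  exists (cross x (- (1 / 2))); rewrite (invf _ _ (cross0 F p0 x)).
  by apply/monof/height_cross_lt => //; lra.
pose a := inf (range f); pose b := sup (range f).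
have f1' x : -1 <= f x <= 1 by rewrite -ler_norml.
have rne : range f !=set0 by exists (f p0), p0.
have ab x : a < f x < b.
  have [y xy] := above x; have [z zx] := below x; apply/andP; split.
    apply: le_lt_trans zx; apply: ge_inf; last by exists z.
    by exists (-1) => _ [t _ <-]; have /andP[] := f1' t.
  apply: lt_le_trans xy _; apply: ub_le_sup; last by exists y.
  by exists 1 => _ [t _ <-]; have /andP[] := f1' t.
pose g x := rescale a b (f x).
have g_lt x y : f x < f y -> g x < g y.
  by move=> xy; have /andP[? _] := ab x; have /andP[_ ?] := ab y; exact: rescale_lt.
have cg : continuous g.
  by move=> x; apply: (continuous_comp (f := f) (g := rescale a b)); [exact: cf | exact: rescale_cont].
exists g; split => //.
- move=> x y; split=> [/invf|gxy]; first by rewrite /g => ->.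
  apply: contrapT => /height_pos_or_neg[] /monof /g_lt; rewrite gxy ltxx //.
- by move=> x y /monof/g_lt.
(* If [c] were missed, [g > c] would be locally constant on the plane, although [g] takes values on
   both sides of [c]. *)
move=> c; apply: contrapT => nc.
have gc x : g x != c by apply/eqP => e; apply: nc; exists x.
have [d d0 hd] := rescale_unbounded c (ab p0).
have [_ [y _ <-] ylt] := @sup_gt _ (range f) (b - d) rne ltac:(rewrite /b; lra).
have [_ [z _ <-] zlt] := @inf_lt _ (range f) (a + d) rne ltac:(rewrite /a; lra).
have y1 := (hd _ (ab y)).1 ylt; have z1 := (hd _ (ab z)).2 zlt.
have : (0 < g y - c) = (0 < g z - c).
  apply: (@plane_locally_constant R M (lined_plane_homeo S) _ (fun x => 0 < g x - c)) => x.
  apply: (near_sign (f := fun x => g x - c)); last by rewrite subr_eq0.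
  by apply: continuousB; [exact: cg | exact: cvg_cst].
by rewrite !subr_gt0 y1 ltNge ltW.
Qed.

(* The factor 2 makes the infimum attained in a bounded part of the leaf, so
   that it depends continuously on the leaf. *)
Definition leaf_time p := inf (range (fun s => 2 * D p0 (G p s) - s)).

Let dist_lb p s : `|s| - D p0 p <= D p0 (G p s).
Proof.
by have := ldist_triangle S p0 p (G p s); rewrite flow_distl (ldistC S p p0); lra.
Qed.

Let value_lb p s : `|s| - 2 * D p0 p <= 2 * D p0 (G p s) - s.
Proof. by have := dist_lb p s; have := ler_norm s; lra. Qed.

Lemma leaf_time_le p s : leaf_time p <= 2 * D p0 (G p s) - s.
Proof.
apply: ge_inf; last by exists s.
by exists (- (2 * D p0 p)) => _ [t _ <-]; have := value_lb p t; have := normr_ge0 t; lra.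
Qed.

Lemma leaf_time_ge p m : (forall s, m <= 2 * D p0 (G p s) - s) -> m <= leaf_time p.
Proof.
move=> h; apply: lb_le_inf; first by exists (2 * D p0 (G p 0) - 0), 0.
by move=> _ [s _ <-].
Qed.

Lemma leaf_time_flow p t : leaf_time (G p t) = leaf_time p + t.
Proof.
apply/eqP; rewrite eq_le; apply/andP; split.
  rewrite -lerBlDr; apply: leaf_time_ge => s.
  have := leaf_time_le (G p t) (s - t); rewrite flowD.
  by rewrite addrCA subrr addr0; lra.
apply: leaf_time_ge => s; rewrite flowD.
by have := leaf_time_le p (t + s); lra.
Qed.

Lemma leaf_time_cont : continuous leaf_time.
Proof.
move=> p; apply/cvgrPdist_lt => e e0.
have [_ [s _ <-] hs] : exists2 v, range (fun s => 2 * D p0 (G p s) - s) v & v < leaf_time p + e.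
  apply: inf_lt; first by exists (2 * D p0 (G p 0) - 0), 0.
  by rewrite -/(leaf_time p); lra.
(* Upper semicontinuity: one almost optimal [s] serves all nearby [q]. The lower bound needs
   compactness. *)
have up : \forall q \near p, leaf_time q < leaf_time p + e.
  have c : {for p, continuous (fun q => 2 * D p0 (G q s) - s)}.
    apply: continuousB; last exact: cvg_cst.
    apply: continuousM; first exact: cvg_cst.
    by apply: ldist_cont; [exact: cvg_cst | exact: flow_at_cont].
  by apply: filterS (near_lt c hs) => q; exact: le_lt_trans (leaf_time_le q s).
(* For [q] with [D p0 q < D p0 p + 1], times beyond [N] give values above [leaf_time p] by
   [value_lb], so only [[- N, N]] matters. *)
pose N := `|leaf_time p| + 2 * D p0 p + 2.
have N0 : 0 <= N by have := normr_ge0 (leaf_time p); have := ldist_ge0 S p0 p; rewrite /N; lra.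
have cpt : compact (`[- N, N]) by exact: segment_compact.
have low : \forall q \near p, `[- N, N] `<=`
    (fun s => leaf_time p - e / 2 < 2 * D p0 (G q s) - s).
  apply: (proj1 (compact_near_coveringP _) cpt M (nbhs p)
    (fun q s => leaf_time p - e / 2 < 2 * D p0 (G q s) - s) (@nbhs_filter M p)).
  move=> t _.
  (* The loss is twice [e / 8] from the distance and [e / 8] from the time, less than [e / 2] in
     all. *)
  have nU : nbhs (G p t) [set z | D p0 (G p t) - e / 8 < D p0 z].
    have c : {for G p t, continuous (fun z => D p0 z)}.
      by apply: ldist_cont; [exact: cvg_cst | exact: cvg_id].
    by apply: (near_gt c); lra.
  have [k k0 H] := flow_cont nU.
  exists ([set t' | `|t - t'| < Num.min k (e / 8)],
    [set q | forall s', `|t - s'| < k -> D p0 (G p t) - e / 8 < D p0 (G q s')]).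
    split => //=; apply/nbhsRP; exists (Num.min k (e / 8)) => //.
    by rewrite lt_min k0; lra.
  move=> [t' q] [/= h1 h2]; move: h1; rewrite lt_min => /andP[/h2 h3].
  rewrite ltr_distlC => /andP[? ?]; have := leaf_time_le p t; lra.
have near_d : \forall q \near p, D p0 q < D p0 p + 1 by apply: ldist_ball_open; lra.
apply: filterS3 up low near_d => q h1 h2 h3.
have h4 : leaf_time p - e / 2 <= leaf_time q.
  apply: leaf_time_ge => t; have [tN|tN] := leP `|t| N.
    by apply/ltW/h2; rewrite /= in_itv /= -ler_norml.
  have := value_lb q t; have := ler_norm (leaf_time p); move: tN; rewrite /N; lra.
by rewrite ltr_distlC; apply/andP; split; lra.
Qed.

Lemma trivialization : exists (h : M -> R * R) (f : M -> R), [/\ homeomorphism h,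
  forall p, h @` [set q | lf p q] = [set: R] `*` [set f p] &
  forall c, exists p, f p = c].
Proof.
have [f [cf flf fmono fsurj]] := leaf_parameter.
have [pt hpt] := choice fsurj.
pose h x := (leaf_time x, f x).
pose k (tc : R * R) := G (pt tc.2) (tc.1 - leaf_time (pt tc.2)).
(* Any point of the leaf may serve as base point. Continuity of [k] can thus be checked from a
   transversal, whatever the choice [pt]. *)
have kP x tc : f x = tc.2 -> k tc = G x (tc.1 - leaf_time x).
  move=> fx; have /(flow_leaf F)[u uE] : lf (pt tc.2) x by apply/flf; rewrite hpt.
  rewrite uE flowD leaf_time_flow /k; congr (flow _ _ _); ring.
have hK : cancel h k.
  by move=> x; rewrite (kP x) //= subrr flow0.
have kh : cancel k h.
  move=> [t c]; rewrite /k /h /= leaf_time_flow addrC subrK; congr (_, _).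
  by rewrite -[RHS]hpt; apply/flf; apply: same_leaf_sym; exact: same_leaf_flow.
exists h, f; split => //.
- split; first by move=> x; apply: continuous_pair; [exact: leaf_time_cont | exact: cf].
  exists k; split => // -[t0 c0].
  pose z := k (t0, c0); have hz : h z = (t0, c0) by exact: kh.
  have [fz tz] : f z = c0 /\ leaf_time z = t0 by move: hz; rewrite /h => -[].
  have fs0 : f (cross z 0) = c0 by rewrite -fz; apply/esym/flf; exact: cross0.
  have zE : z = G (cross z 0) (t0 - leaf_time (cross z 0)) by exact: (kP (cross z 0) (t0, c0) fs0).
  move=> W; rewrite -/z zE => /flow_cont[d d0 Hd].
  have c0' := @cross_cont _ _ _ F p0 z 0; rewrite normr0 ltr01 in c0'.
  have {}c0' := c0' isT.
  have H1 : \forall v \near 0, forall s', `|t0 - leaf_time (cross z 0) - s'| < d -> W (G (cross z v) s').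
    exact: (c0' _ Hd).
  have H2 : \forall v \near 0, `|leaf_time (cross z 0) - leaf_time (cross z v)| < d / 2.
    have H2' : \forall x \near cross z 0, `|leaf_time (cross z 0) - leaf_time x| < d / 2.
      have d2 : 0 < d / 2 by lra.
      by move: (@leaf_time_cont (cross z 0)) => /cvgrPdist_lt /(_ _ d2).
    exact: (c0' _ H2').
  have H12 : \forall v \near 0,
      (forall s', `|t0 - leaf_time (cross z 0) - s'| < d -> W (G (cross z v) s')) /\
      `|leaf_time (cross z 0) - leaf_time (cross z v)| < d / 2.
    by apply: filterS2 H1 H2 => v.
  have /nbhsRP[e e0 he] := H12.
  (* The levels [- w] and [w] bracket [c0], so every parameter near [c0] is attained on the
     transversal between them. *)
  pose w := Num.min (e / 2) (1 / 2).
  have w0 : 0 < w by rewrite lt_min; apply/andP; split; lra.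
  have we : w < e by rewrite gt_min; apply/orP; left; lra.
  have w1 : w < 1 by rewrite gt_min; apply/orP; right; lra.
  have aw : `|w| < 1 by rewrite gtr0_norm.
  have anw : `|- w| < 1 by rewrite normrN.
  have a0 : `|0 : R| < 1 by rewrite normr0.
  have fup : c0 < f (cross z w) by rewrite -fs0; apply/fmono/height_cross_lt.
  have fdn : f (cross z (- w)) < c0.
    by rewrite -fs0; apply/fmono/height_cross_lt => //; rewrite oppr_lt0.
  apply/nbhsRRP; exists (Num.min (d / 2) (Num.min (f (cross z w) - c0) (c0 - f (cross z (- w))))).
    by rewrite !lt_min !subr_gt0 fup fdn divr_gt0.
  move=> [t c] /=; rewrite !lt_min => /andP[td _] /and3P[_ cu cd].
  have [v vw vc] : exists2 v, - w <= v <= w & f (cross z v) = c.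
    apply: (@IVT_real R (f \o cross z) (- w) w c); first lra.
      move=> v vw; apply: continuous_comp; last exact: cf.
      by apply: cross_cont; rewrite ltr_norml; apply/andP; split; lra.
    by move: cu cd; rewrite !ltr_distlC /= => /andP[? ?] /andP[? ?]; apply/orP; left; lra.
  have [|h1 h2] := he v; first by rewrite sub0r normrN ltr_norml; apply/andP; split; lra.
  rewrite (kP (cross z v)) //; apply: h1 => /=.
  move: h2 td; rewrite !ltr_distlC => /andP[? ?] /andP[? ?]; apply/andP; split; lra.
- move=> p; apply/seteqP; split => [_ [q /= pq <-]|[t c] [_ /= ->]].
    by split => //=; apply/esym/flf.
  exists (G p (t - leaf_time p)); first exact: same_leaf_flow.
  rewrite /h leaf_time_flow addrC subrK; congr (_, _).
  by apply/esym/flf; exact: same_leaf_flow.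
Qed.

End Trivialization.

(** * The topology of the Riemannian distance *)

Lemma MVT_unordered (R : realType) (f df : R -> R) (a b : R) :
  (forall t, `|t - a| <= `|b - a| -> is_derive t 1 f (df t)) ->
  exists2 c, `|c - a| <= `|b - a| & f b - f a = df c * (b - a).
Proof.
move=> fd.
have cf t : `|t - a| <= `|b - a| -> {for t, continuous f}.
  by move=> /fd[/derivable1_diffP /differentiable_continuous].
have [ab|ba] := leP a b.
  have E t : a <= t <= b -> `|t - a| <= `|b - a|.
    by move=> /andP[? ?]; rewrite !ger0_norm; lra.
  have [||c] := MVT_segment ab (f := f) (df := df).
  - by move=> t; rewrite in_itv /= => /andP[? ?]; apply/fd/E; lra.
  - apply: continuous_in_subspaceT => t; rewrite inE /= in_itv /= => tab.
    exact/cf/E.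
  by rewrite in_itv /= => /E cE ->; exists c.
have E t : b <= t <= a -> `|t - a| <= `|b - a|.
  by move=> /andP[? ?]; rewrite !ler0_norm; lra.
have [||c] := MVT_segment (ltW ba) (f := f) (df := df).
- by move=> t; rewrite in_itv /= => /andP[? ?]; apply/fd/E; lra.
- apply: continuous_in_subspaceT => t; rewrite inE /= in_itv /= => tab.
  exact/cf/E.
rewrite in_itv /= => /E cE h; exists c => //.
by rewrite -opprB h -mulrN opprB.
Qed.

Lemma linear_approx_differentiable (R : realType) (V W : normedModType R)
    (f : V -> W) (df : {linear V -> W}) x : continuous df ->
  (forall e, 0 < e -> \forall y \near x,
     `|f y - f x - df (y - x)| <= e * `|y - x|) ->
  differentiable f x.
Proof.
move=> cdf H; apply/diffP => /=.
apply: (@getPex _ (fun (df : {linear V -> W}) => continuous df /\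
  forall y, f y = f (lim (nbhs x)) + df (y - lim (nbhs x))
                  +o_(y \near x) (y - lim (nbhs x)))).
exists df; split => //; rewrite lim_id //.
have : f = (fun y => f x + df (y - x)) +o_ x (fun y => y - x).
  apply/eqaddoP => e e0; apply: filterS (H e e0) => y.
  by rewrite [(f - _) y]/= opprD addrA.
by rewrite funeqE.
Qed.

Lemma ler_norm_combination (R : realType) (a b u v n e : R) : `|a| < e / 2 ->
  `|b| < e / 2 -> `|u| <= n -> `|v| <= n -> `|a * u + b * v| <= e * n.
Proof.
move=> ae be un vn; apply: le_trans (ler_normD _ _) _; rewrite !normrM.
have -> : e * n = e / 2 * n + e / 2 * n by rewrite -mulrDl -splitr.
by apply: lerD; apply: ler_pM => //; exact: ltW.
Qed.

Section C1Differentiable.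
Variable R : realType.
Implicit Types (F : R * R -> R) (x y : R * R).

Lemma is_derive_fst F (a b : R) : derivable F (a, b) (1, 0) ->
  is_derive a 1 (fun t => F (t, b)) ('D_(1, 0) F (a, b)).
Proof.
have E : (fun h : R => h^-1 *: ((F \o shift (a, b)) (h *: (1, 0)) - F (a, b))) =
    (fun h => h^-1 *: (((fun t => F (t, b)) \o shift a) (h *: 1) - F (a, b))).
  apply/funext => h; congr (_ *: (F _ - _)).
  by apply: injective_projections => //=; rewrite scaler0 add0r.
by rewrite /derivable /derive E => dF; split.
Qed.

Lemma is_derive_snd F (a b : R) : derivable F (a, b) (0, 1) ->
  is_derive b 1 (fun t => F (a, t)) ('D_(0, 1) F (a, b)).
Proof.
have E : (fun h : R => h^-1 *: ((F \o shift (a, b)) (h *: (0, 1)) - F (a, b))) =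
    (fun h => h^-1 *: (((fun t => F (a, t)) \o shift b) (h *: 1) - F (a, b))).
  apply/funext => h; congr (_ *: (F _ - _)).
  by apply: injective_projections => //=; rewrite scaler0 add0r.
by rewrite /derivable /derive E => dF; split.
Qed.

(** The mean value theorem is applied on two sides of a rectangle. Smoothness is stated by
    directional derivatives, while the chain rule for changes of charts needs a differential. *)
Lemma C1_differentiable F x :
  (\forall y \near x, derivable F y (1, 0) /\ derivable F y (0, 1)) ->
  {for x, continuous (fun y => 'D_(1, 0) F y)} ->
  {for x, continuous (fun y => 'D_(0, 1) F y)} ->
  differentiable F x.
Proof.
move=> dF c1 c2; set a := 'D_(1, 0) F x in c1; set b := 'D_(0, 1) F x in c2.
pose df (k : R * R) := k.1 * a + k.2 * b.
have df_lin : linear df by move=> k u v; rewrite /df /= /GRing.scale /=; ring.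
pose dfM := GRing.isLinear.Build _ _ _ _ _ df_lin.
pose dfL : {linear (R * R)%type -> R} := HB.pack df dfM.
have df_cont : continuous df.
  move=> u; have cc (r : R) : {for u, continuous (fun=> r : R)} by exact: cvg_cst.
  have f1 : {for u, continuous (@fst R R)} by exact: cvg_fst.
  have f2 : {for u, continuous (@snd R R)} by exact: cvg_snd.
  exact: (continuousD (continuousM f1 (cc a)) (continuousM f2 (cc b))).
apply: (@linear_approx_differentiable R (R * R)%type R F dfL) => //.
move=> e e0.
have e2 : 0 < e / 2 by lra.
have near1 : \forall y \near x, `|a - 'D_(1, 0) F y| < e / 2.
  by move: c1 => /cvgrPdist_lt /(_ _ e2).
have near2 : \forall y \near x, `|b - 'D_(0, 1) F y| < e / 2.
  by move: c2 => /cvgrPdist_lt /(_ _ e2).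
have H : \forall y \near x, [/\ derivable F y (1, 0), derivable F y (0, 1),
    `|a - 'D_(1, 0) F y| < e / 2 & `|b - 'D_(0, 1) F y| < e / 2].
  by apply: filterS3 dF near1 near2 => y [].
have /nbhsRRP[d d0 hd] := H.
apply/nbhsRRP; exists d => // -[y1 y2]; case: (x) hd => x1 x2 /= hd h1 h2.
rewrite distrC in h1; rewrite distrC in h2.
have hor t : `|t - x1| <= `|y1 - x1| ->
    derivable F (t, y2) (1, 0) /\ `|a - 'D_(1, 0) F (t, y2)| < e / 2.
  move=> tE; have [||] := hd (t, y2); rewrite /= ?(distrC x2) //.
  by rewrite distrC; exact: le_lt_trans h1.
have ver t : `|t - x2| <= `|y2 - x2| ->
    derivable F (x1, t) (0, 1) /\ `|b - 'D_(0, 1) F (x1, t)| < e / 2.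
  move=> tE; have [||] := hd (x1, t); rewrite /= ?subrr ?normr0 //.
  by rewrite distrC; exact: le_lt_trans h2.
have [t1 /hor[_ a1] e1] := @MVT_unordered R (fun t => F (t, y2))
  (fun t => 'D_(1, 0) F (t, y2)) x1 y1 (fun t tE => is_derive_fst (hor t tE).1).
have [t2 /ver[_ b1] e2'] := @MVT_unordered R (fun t => F (x1, t))
  (fun t => 'D_(0, 1) F (x1, t)) x2 y2 (fun t tE => is_derive_snd (ver t tE).1).
have -> : F (y1, y2) - F (x1, x2) - dfL ((y1, y2) - (x1, x2)) =
    ('D_(1, 0) F (t1, y2) - a) * (y1 - x1) + ('D_(0, 1) F (x1, t2) - b) * (y2 - x2).
  have -> : F (y1, y2) - F (x1, x2) =
      'D_(1, 0) F (t1, y2) * (y1 - x1) + 'D_(0, 1) F (x1, t2) * (y2 - x2).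
    by rewrite -e1 -e2'; ring.
  by rewrite /dfL /= /df /=; ring.
rewrite distrC in a1; rewrite distrC in b1.
have n1 : `|y1 - x1| <= `|(y1, y2) - (x1, x2)| by rewrite prod_normE le_max lexx.
have n2 : `|y2 - x2| <= `|(y1, y2) - (x1, x2)| by rewrite prod_normE le_max lexx orbT.
exact: (ler_norm_combination a1 b1 n1 n2).
Qed.

End C1Differentiable.

Section ClassC.
Variables (R : realType) (V W : normedModType R).
Implicit Types (U : set V) (f : V -> W).

Lemma class_C_cont k U f x : class_C k U f -> U x -> {for x, continuous f}.
Proof. by case: k => [|k] [h _] /mem_set /h. Qed.

Lemma class_CS k U f v : class_C k.+1 U f ->
  (forall x, U x -> derivable f x v) /\ class_C k U (fun x => 'D_v f x).
Proof.
by move=> [_ /(_ v)[h1 h2]]; split => // x /mem_set; exact: h1.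
Qed.

End ClassC.

Lemma continuous_near_eq (T U : topologicalType) (f g : T -> U) x :
  {for x, continuous f} -> (\forall y \near x, g y = f y) -> {for x, continuous g}.
Proof.
move=> cf fg A; rewrite (nbhs_singleton fg) => /cf H.
have H' : \forall y \near x, A (f y) := H.
by apply: filterS2 H' fg => y /= h ->.
Qed.

(** With a transition map for [f], this shows that a straight segment in one chart is smooth in all
    the others. *)
Lemma class_C_line (R : realType) (V W : normedModType R) (x w : V) k (U : set V)
    (U' : set R) (f : V -> W) : class_C k U f ->
  (forall t, U' t -> U (x + t *: w)) -> class_C k U' (fun t => f (x + t *: w)).
Proof.
move=> + UU'; elim: k f => [|k IH] f fC.
  split=> // t /set_mem Ut.
  apply: (continuous_comp (f := fun t : R => x + t *: w)); last first.
    exact: class_C_cont fC (UU' _ Ut).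
  by apply: cvgD; [exact: cvg_cst | exact: scalel_continuous].
have E (v t : R) :
    (fun h : R => h^-1 *: (((fun t => f (x + t *: w)) \o shift t) (h *: v) - f (x + t *: w))) =
    (fun h : R => h^-1 *: ((f \o shift (x + t *: w)) (h *: (v *: w)) - f (x + t *: w))).
  apply/funext => h; congr (_ *: (f _ - _)).
  by rewrite /= scalerDl scalerA addrCA.
split.
  move=> t /set_mem Ut.
  apply: (continuous_comp (f := fun t : R => x + t *: w)); last first.
    exact: class_C_cont fC (UU' _ Ut).
  by apply: cvgD; [exact: cvg_cst | exact: scalel_continuous].
move=> v; have [fd fC'] := class_CS (v *: w) fC; split.
  by move=> t /set_mem Ut; rewrite /derivable E; exact: fd (UU' _ Ut).
have -> : (fun t : R => 'D_v (fun t : R => f (x + t *: w)) t) =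
    (fun t : R => (fun y => 'D_(v *: w) f y) (x + t *: w)).
  by apply/funext => t; rewrite /derive E.
exact: IH fC'.
Qed.

Section ProductDerivatives.
Variables (R : realType) (V : normedModType R).
Implicit Type f : V -> R * R.

Lemma derive_fst f x v : derivable f x v ->
  derivable (fun y => (f y).1) x v /\ 'D_v (fun y => (f y).1) x = ('D_v f x).1.
Proof.
move=> df.
have : (fun h : R => h^-1 *: (((fun y => (f y).1) \o shift x) (h *: v) - (f x).1)) @ 0^'
    --> ('D_v f x).1.
  have c : {for 'D_v f x, continuous (@fst R R)} by exact: cvg_fst.
  exact: (cvg_comp _ _ df c).
by move=> h; split; [exact: cvgP h | exact: cvg_lim h].
Qed.

Lemma derive_snd f x v : derivable f x v ->
  derivable (fun y => (f y).2) x v /\ 'D_v (fun y => (f y).2) x = ('D_v f x).2.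
Proof.
move=> df.
have : (fun h : R => h^-1 *: (((fun y => (f y).2) \o shift x) (h *: v) - (f x).2)) @ 0^'
    --> ('D_v f x).2.
  have c : {for 'D_v f x, continuous (@snd R R)} by exact: cvg_snd.
  exact: (cvg_comp _ _ df c).
by move=> h; split; [exact: cvgP h | exact: cvg_lim h].
Qed.

End ProductDerivatives.

Lemma smooth_differentiable (R : realType) (U : set (R * R)) (f : R * R -> R * R) x :
  (\forall y \near x, U y) -> smooth_on U f -> differentiable f x.
Proof.
move=> nU fC; have Ux := nbhs_singleton nU.
have [d1 c1] := @class_CS R (R * R)%type (R * R)%type 0 U f (1, 0) (fC 1%N).
have [d2 c2] := @class_CS R (R * R)%type (R * R)%type 0 U f (0, 1) (fC 1%N).
have fE : f = (fun y => ((f y).1, (f y).2)) by apply/funext => y; rewrite -surjective_pairing.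
have cfst z : {for z, continuous (@fst R R)} by exact: cvg_fst.
have csnd z : {for z, continuous (@snd R R)} by exact: cvg_snd.
rewrite fE; apply: differentiable_pair; apply: C1_differentiable.
- by apply: filterS nU => y Uy; split; [have [] := derive_fst (d1 y Uy) | have [] := derive_fst (d2 y Uy)].
- apply: (continuous_near_eq (f := fun y => ('D_(1, 0) f y).1)).
    by apply: (continuous_comp (f := fun y => 'D_(1, 0) f y)); [exact: class_C_cont c1 Ux | exact: cfst].
  by apply: filterS nU => y /d1 /derive_fst[].
- apply: (continuous_near_eq (f := fun y => ('D_(0, 1) f y).1)).
    by apply: (continuous_comp (f := fun y => 'D_(0, 1) f y)); [exact: class_C_cont c2 Ux | exact: cfst].
  by apply: filterS nU => y /d2 /derive_fst[].
- by apply: filterS nU => y Uy; split; [have [] := derive_snd (d1 y Uy) | have [] := derive_snd (d2 y Uy)].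
- apply: (continuous_near_eq (f := fun y => ('D_(1, 0) f y).2)).
    by apply: (continuous_comp (f := fun y => 'D_(1, 0) f y)); [exact: class_C_cont c1 Ux | exact: csnd].
  by apply: filterS nU => y /d1 /derive_snd[].
- apply: (continuous_near_eq (f := fun y => ('D_(0, 1) f y).2)).
    by apply: (continuous_comp (f := fun y => 'D_(0, 1) f y)); [exact: class_C_cont c2 Ux | exact: csnd].
  by apply: filterS nU => y /d2 /derive_snd[].
Qed.

(** * Speed of curves in a fixed chart *)

Section Speed.
Variables (R : realType) (M : topologicalType) (g : riemannian_surface R M).

Let hch c : atlas g c -> is_chart c := @atlas_chart _ _ g c.

Lemma transition_dom_open (c d : chart R M) p : atlas g c -> atlas g d ->
  dom c p -> dom d p -> \forall y \near cfun c p, (cfun c @` (dom c `&` dom d)) y.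
Proof.
move=> /hch ac /hch ad cp dp.
have codp : cod c (cfun c p) by exists p.
have H1 : nbhs (cinv c (cfun c p)) (dom d) by rewrite (cfunK ac) //; exact: dom_open.
have H2 : \forall y \near cfun c p, dom d (cinv c y) := cinv_cont ac codp H1.
apply: filterS2 (cod_open ac codp) H2 => y cy dy.
by have [h1 h2] := cinvP ac cy; exists (cinv c y).
Qed.

Lemma transition_differentiable (c d : chart R M) p : atlas g c -> atlas g d ->
  dom c p -> dom d p -> differentiable (transition c d) (cfun c p).
Proof.
move=> ac ad cp dp; apply: (smooth_differentiable (transition_dom_open ac ad cp dp)).
exact: (transition_smooth ac ad).
Qed.

Variables (I : set R) (gamma : R -> M).
Hypothesis I_open : forall t, I t -> \forall s \near t, I s.
Hypothesis gamma_smooth : smooth_curve_on g I gamma.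

Lemma curve_cont t : I t -> {for t, continuous gamma}.
Proof. by case: gamma_smooth => h _ /mem_set; exact: h. Qed.

Lemma curve_chart_open c t : atlas g c -> I t -> dom c (gamma t) ->
  \forall s \near t, (I `&` gamma @^-1` dom c) s.
Proof.
move=> ac It ct; apply: filterI; first exact: I_open.
by apply: curve_cont => //; exact: (dom_open (hch ac)).
Qed.

Lemma curve_chart_derive c t : atlas g c -> I t -> dom c (gamma t) ->
  derivable (cfun c \o gamma) t 1 /\
  {for t, continuous (fun s => derive1 (cfun c \o gamma) s)}.
Proof.
move=> ac It ct; have [_ /(_ c ac) sm] := gamma_smooth.
have [d C] := @class_CS R R (R * R)%type 0 _ _ (1 : R) (sm 1%N); split; first exact: d.
have -> : (fun s => derive1 (cfun c \o gamma) s) = (fun s => 'D_1 (cfun c \o gamma) s).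
  by apply/funext => s; rewrite derive1E.
exact: (class_C_cont C (conj It ct)).
Qed.

(** The chart in the definition of [speed] varies with the point. The chain rule and [metric_compat]
    replace it by a fixed one, in which continuity and estimates can be read. *)
Lemma speedE c t : atlas g c -> I t -> dom c (gamma t) ->
  let u := derive1 (cfun c \o gamma) t in
  speed g gamma t = Num.sqrt (metric g c (cfun c (gamma t)) u u).
Proof.
move=> ac It ct u; rewrite /speed; set d := chart_at g (gamma t).
have ad : atlas g d := chart_at_atlas g (gamma t).
have dt : dom d (gamma t) := chart_at_dom g (gamma t).
have [du _] := curve_chart_derive ac It ct.
have E : derive1 (cfun d \o gamma) t = 'D_u (transition c d) (cfun c (gamma t)).
  have tr := transition_differentiable ac ad ct dt.
  have -> : derive1 (cfun d \o gamma) t = derive1 (transition c d \o (cfun c \o gamma)) t.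
    rewrite !derive1E; apply: near_eq_derive.
    apply: filterS (curve_chart_open ac It ct) => s [_ cs].
    by rewrite /transition /= (cfunK (hch ac)).
  have du' : differentiable (cfun c \o gamma) t by apply/derivable1_diffP.
  have Eu : u = 'd (cfun c \o gamma) t 1 by rewrite /u derive1E deriveE.
  rewrite derive1E deriveE; last exact: differentiable_comp.
  by rewrite (diff_comp du' tr) /= -Eu (deriveE u tr).
by rewrite E (metric_compat ac ad ct dt).
Qed.

End Speed.

(** * Bounds for integrals and for the metric coefficients *)

Section IntegralBounds.
Variables (R : realType) (f : R -> R) (a b : R).
Hypothesis f_cont : forall t, a <= t <= b -> {for t, continuous f}.
Local Notation mu := (@lebesgue_measure R).
Local Notation integral u v := (\int[mu]_(t in `[u, v]) f t)%R.

Lemma continuous_integrable u v : a <= u -> v <= b ->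
  mu.-integrable `[u, v] (EFin \o f).
Proof.
move=> au vb; apply: continuous_compact_integrable; first exact: segment_compact.
apply: continuous_in_subspaceT => t; rewrite inE /= in_itv /= => /andP[ut tv].
by apply: f_cont; rewrite (le_trans au ut) (le_trans tv vb).
Qed.

Lemma Rintegral_chasles u v w : a <= u -> u <= v -> v <= w -> w <= b ->
  integral u w = integral u v + integral v w.
Proof.
move=> au uv vw wb.
have := @Rintegral_itvB R f (BLeft u) (BRight w) v (continuous_integrable au wb).
rewrite !bnd_simp => /(_ uv vw) E.
rewrite -(@Rintegral_itv_obnd_cbnd R v (BRight w) f).
  by rewrite -E addrC subrK.
apply: integrableS (continuous_integrable (le_trans au uv) wb) => //.
by move=> t /=; rewrite !in_itv /= => /andP[/ltW -> ->].
Qed.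

Let length_itv (u v : R) : u <= v -> fine (mu `[u, v]) = v - u.
Proof.
rewrite le_eqVlt => /orP[/eqP ->|uv]; rewrite lebesgue_measure_itv /= lte_fin.
  by rewrite ltxx subrr.
by rewrite uv.
Qed.

Let cst_integrable (k u v : R) : mu.-integrable `[u, v] (EFin \o (fun=> k)).
Proof.
apply: continuous_compact_integrable; first exact: segment_compact.
by apply: continuous_in_subspaceT => t _; exact: cvg_cst.
Qed.

Lemma Rintegral_ge k u v : a <= u -> u <= v -> v <= b ->
  (forall t, u <= t <= v -> k <= f t) -> k * (v - u) <= integral u v.
Proof.
move=> au uv vb kf; rewrite -(length_itv uv) -Rintegral_cst //.
by apply: le_Rintegral => //; exact: continuous_integrable.
Qed.

Lemma Rintegral_le k u v : a <= u -> u <= v -> v <= b ->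
  (forall t, u <= t <= v -> f t <= k) -> integral u v <= k * (v - u).
Proof.
move=> au uv vb kf; rewrite -(length_itv uv) -Rintegral_cst //.
by apply: le_Rintegral => //; exact: continuous_integrable.
Qed.

End IntegralBounds.

(** Completing the square, [e * q] and [h * q] are at least the determinant times [w2 ^+ 2] and
    [w1 ^+ 2] respectively. Here [n] is the sup norm of [w], so one of these squares is [n ^+ 2]. *)
Lemma quadratic_bounds (R : realType) (e f h delta T w1 w2 n : R) :
  0 < delta -> 0 < T -> 0 < e -> e < T -> 0 < h -> h < T -> `|f| < T ->
  delta < e * h - f ^+ 2 -> `|w1| <= n -> `|w2| <= n -> (`|w1| = n \/ `|w2| = n) ->
  let q := w1 ^+ 2 * e + 2 * (w1 * w2) * f + w2 ^+ 2 * h in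
  delta / T * n ^+ 2 <= q /\ q <= 4 * T * n ^+ 2.
Proof.
move=> d0 T0 e0 eT h0 hT fT dlt n1 n2 n12 q.
have n0 : 0 <= n by apply: le_trans n1.
have s1 : w1 ^+ 2 <= n ^+ 2 by rewrite -(real_normK (num_real w1)) lerXn2r ?nnegrE.
have s2 : w2 ^+ 2 <= n ^+ 2 by rewrite -(real_normK (num_real w2)) lerXn2r ?nnegrE.
have E1 : e * q = (e * w1 + f * w2) ^+ 2 + (e * h - f ^+ 2) * w2 ^+ 2 by rewrite /q; ring.
have E2 : h * q = (f * w1 + h * w2) ^+ 2 + (e * h - f ^+ 2) * w1 ^+ 2 by rewrite /q; ring.
have q1 : delta * w2 ^+ 2 <= e * q.
  rewrite E1; apply: (@le_trans _ _ ((e * h - f ^+ 2) * w2 ^+ 2)).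
    by apply: ler_wpM2r; [exact: sqr_ge0 | exact: ltW].
  by rewrite lerDr sqr_ge0.
have q2 : delta * w1 ^+ 2 <= h * q.
  rewrite E2; apply: (@le_trans _ _ ((e * h - f ^+ 2) * w1 ^+ 2)).
    by apply: ler_wpM2r; [exact: sqr_ge0 | exact: ltW].
  by rewrite lerDr sqr_ge0.
have q0 : 0 <= q.
  rewrite -(pmulr_rge0 _ e0); apply: le_trans q1.
  by rewrite mulr_ge0 ?sqr_ge0 // ltW.
split.
  rewrite mulrAC ler_pdivrMr // [q * T]mulrC.
  case: n12 => <-; rewrite real_normK ?num_real //.
    by apply: le_trans q2 _; apply: ler_wpM2r => //; exact: ltW.
  by apply: le_trans q1 _; apply: ler_wpM2r => //; exact: ltW.
have c : 2 * (w1 * w2) * f <= 2 * (T * n ^+ 2).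
  rewrite -mulrA ler_pM2l //; apply: le_trans (ler_norm _) _.
  rewrite !normrM mulrC; apply: ler_pM; rewrite ?mulr_ge0 ?normr_ge0 //.
    exact: ltW.
  by rewrite expr2; exact: ler_pM.
have a1 : w1 ^+ 2 * e <= T * n ^+ 2.
  by rewrite mulrC; apply: ler_pM => //; [exact: ltW | exact: sqr_ge0 | exact: ltW].
have a2 : w2 ^+ 2 * h <= T * n ^+ 2.
  by rewrite mulrC; apply: ler_pM => //; [exact: ltW | exact: sqr_ge0 | exact: ltW].
rewrite /q; move: a1 a2 c; set A := w1 ^+ 2 * e; set B := 2 * (w1 * w2) * f.
by set C := w2 ^+ 2 * h; set E := T * n ^+ 2; rewrite -mulrA -/E; lra.
Qed.

Section MetricInChart.
Variables (R : realType) (M : topologicalType) (g : riemannian_surface R M).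
Variable c : chart R M.
Hypothesis ac : atlas g c.
Local Notation e1 := ((1, 0) : R * R).
Local Notation e2 := ((0, 1) : R * R).
Local Notation m z := (metric g c z).

Lemma metric_quad z w : cod c z ->
  m z w w = w.1 ^+ 2 * m z e1 e1 + 2 * (w.1 * w.2) * m z e1 e2 + w.2 ^+ 2 * m z e2 e2.
Proof.
move=> cz; have lin := metric_linear ac cz; have sym := Defs.metric_sym ac cz.
have m0 v : m z 0 v = 0.
  by have := lin 1 0 0 v; rewrite scaler0 addr0 mul1r => h; lra.
have wE : w = w.1 *: e1 + (w.2 *: e2 + 0).
  by apply: injective_projections; rewrite /= /GRing.scale /= ?mulr1 ?mulr0 ?addr0 ?add0r.
have exp u : m z w u = w.1 * m z e1 u + w.2 * m z e2 u.
  by rewrite [in LHS]wE !lin m0 addr0.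
rewrite exp (sym e1 w) (sym e2 w) !exp (sym e2 e1); ring.
Qed.

Lemma metric_cont z u v : cod c z -> {for z, continuous (fun x => m x u v)}.
Proof. by move=> cz; exact: (class_C_cont (metric_smooth ac u v 0) cz). Qed.

Lemma metric_quad_cont (T : topologicalType) (z w : T -> R * R) t :
  cod c (z t) -> {for t, continuous z} -> {for t, continuous w} ->
  {for t, continuous (fun s => m (z s) (w s) (w s))}.
Proof.
move=> cz ctz ctw.
have hc := atlas_chart ac.
have near_cod : \forall s \near t, cod c (z s) := ctz _ (cod_open hc cz).
have w1 : {for t, continuous (fun s => (w s).1)}.
  have cfst : {for w t, continuous (@fst R R)} by exact: cvg_fst.
  exact: (continuous_comp ctw cfst).
have w2 : {for t, continuous (fun s => (w s).2)}.
  have csnd : {for w t, continuous (@snd R R)} by exact: cvg_snd.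
  exact: (continuous_comp ctw csnd).
have mc u v : {for t, continuous (fun s => m (z s) u v)}.
  apply: (continuous_comp (f := z) (g := fun x => m x u v)) => //; exact: metric_cont.
have c2 : {for t, continuous (fun=> 2 : R)} by exact: cvg_cst.
apply: (continuous_near_eq (f := fun s => (w s).1 * (w s).1 * m (z s) e1 e1 +
  2 * ((w s).1 * (w s).2) * m (z s) e1 e2 + (w s).2 * (w s).2 * m (z s) e2 e2)).
  apply: (continuousD (continuousD _ _) _).
  - exact: (continuousM (continuousM w1 w1) (mc _ _)).
  - exact: (continuousM (continuousM c2 (continuousM w1 w2)) (mc _ _)).
  - exact: (continuousM (continuousM w2 w2) (mc _ _)).
by apply: filterS near_cod => s cs; rewrite metric_quad // !expr2.
Qed.

Lemma metric_bounds x : cod c x -> exists r k K : R, [/\ 0 < r, 0 < k, 0 < K &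
  forall z, `|x.1 - z.1| < r -> `|x.2 - z.2| < r -> cod c z /\
    forall w : R * R, k * `|w| <= Num.sqrt (m z w w) <= K * `|w|].
Proof.
move=> cx.
pose e z := m z e1 e1; pose f z := m z e1 e2; pose h z := m z e2 e2.
have ce : {for x, continuous e} by exact: metric_cont.
have cf : {for x, continuous f} by exact: metric_cont.
have ch : {for x, continuous h} by exact: metric_cont.
have e0 : 0 < e x.
  by apply: (metric_posdef ac cx); apply/eqP => -[] /eqP; rewrite oner_eq0.
have h0 : 0 < h x.
  by apply: (metric_posdef ac cx); apply/eqP => -[] /eqP; rewrite oner_eq0.
have det0 : 0 < e x * h x - f x ^+ 2.
  (* On this vector the form equals [e x] times its determinant, which is therefore positive. *)
  have v0 : (- f x, e x) != 0 by apply/eqP => -[] _ /eqP; rewrite gt_eqF.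
  have := metric_posdef ac cx v0; rewrite metric_quad //= -/(e x) -/(f x) -/(h x).
  have -> : (- f x) ^+ 2 * e x + 2 * (- f x * e x) * f x + e x ^+ 2 * h x =
    e x * (e x * h x - f x ^+ 2) by ring.
  by rewrite pmulr_rgt0.
pose T := e x + h x + `|f x| + 1; pose delta := (e x * h x - f x ^+ 2) / 2.
have T0 : 0 < T by have := normr_ge0 (f x); rewrite /T; lra.
have d0 : 0 < delta by rewrite divr_gt0.
have cdet : {for x, continuous (fun z => e z * h z - f z * f z)}.
  exact: (continuousB (continuousM ce ch) (continuousM cf cf)).
have cnf : {for x, continuous (fun z => `|f z|)}.
  by apply: (continuous_comp (f := f)); [exact: cf | exact: norm_continuous].
have H : \forall z \near x, [/\ cod c z, 0 < e z /\ e z < T, 0 < h z /\ h z < T,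
    `|f z| < T & delta < e z * h z - f z ^+ 2].
  have n1 := near_gt ce e0; have n2 := near_gt ch h0.
  have n3 : \forall z \near x, e z < T.
    by apply: (near_lt ce); have := normr_ge0 (f x); rewrite /T; lra.
  have n4 : \forall z \near x, h z < T.
    by apply: (near_lt ch); have := normr_ge0 (f x); rewrite /T; lra.
  have n5 : \forall z \near x, `|f z| < T by apply: (near_lt cnf); rewrite /T; lra.
  have n6 : \forall z \near x, delta < e z * h z - f z * f z.
    by apply: (near_gt cdet); rewrite /delta -expr2; lra.
  near=> z; split; [|split|split| |rewrite expr2]; near: z => //.
  exact: (cod_open (atlas_chart ac) cx).
have /nbhsRRP[r r0 hr] := H.
exists r, (Num.sqrt (delta / T)), (Num.sqrt (4 * T)); split => //.
- by rewrite sqrtr_gt0 divr_gt0.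
- by rewrite sqrtr_gt0 mulr_gt0.
move=> z z1 z2; have [cz [ez eT] [hz hT] fT dl] := hr z z1 z2; split => // w.
have wn1 : `|w.1| <= `|w| by rewrite prod_normE le_max lexx.
have wn2 : `|w.2| <= `|w| by rewrite prod_normE le_max lexx orbT.
have wn : `|w.1| = `|w| \/ `|w.2| = `|w|.
  by rewrite prod_normE; case: (leP `|w.1| `|w.2|); [right|left].
have := quadratic_bounds d0 T0 ez eT hz hT fT dl wn1 wn2 wn.
rewrite /= -metric_quad // => -[q1 q2].
have sq : Num.sqrt (`|w| ^+ 2) = `|w| by rewrite sqrtr_sqr normr_id.
rewrite -{1 2}sq -!sqrtrM; try exact: ltW.
- by rewrite !ler_wsqrtr.
- by rewrite mulr_ge0 // ltW.
- by rewrite divr_ge0 // ltW.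
Unshelve. all: by end_near.
Qed.

End MetricInChart.

Section SpeedCont.
Variables (R : realType) (M : topologicalType) (g : riemannian_surface R M).
Variables (I : set R) (gamma : R -> M).
Hypothesis I_open : forall t, I t -> \forall s \near t, I s.
Hypothesis gamma_smooth : smooth_curve_on g I gamma.

Lemma curve_cfun_cont c t : atlas g c -> I t -> dom c (gamma t) ->
  {for t, continuous (cfun c \o gamma)}.
Proof.
move=> ac It ct; apply: continuous_comp; first exact: (curve_cont gamma_smooth).
exact: (cfun_cont (atlas_chart ac)).
Qed.

Lemma speed_cont t : I t -> {for t, continuous (speed g gamma)}.
Proof.
move=> It; pose c := chart_at g (gamma t).
have ac : atlas g c := chart_at_atlas g (gamma t).
have ct : dom c (gamma t) := chart_at_dom g (gamma t).
pose u s := derive1 (cfun c \o gamma) s.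
apply: (continuous_near_eq (f := fun s => Num.sqrt (metric g c (cfun c (gamma s)) (u s) (u s)))).
  apply: (continuous_comp (f := fun s => metric g c (cfun c (gamma s)) (u s) (u s))).
    apply: (metric_quad_cont ac).
    - by exists (gamma t).
    - exact: curve_cfun_cont.
    - by have [] := curve_chart_derive gamma_smooth ac It ct.
  exact: sqrt_continuous.
apply: filterS (curve_chart_open I_open gamma_smooth ac It ct) => s [Is cs].
exact: (speedE I_open gamma_smooth ac Is cs).
Qed.

Lemma speed_ge0 t : 0 <= speed g gamma t.
Proof. exact: sqrtr_ge0. Qed.

End SpeedCont.

Lemma derive1_affine (R : realType) (V : normedModType R) (x w : V) (t : R) :
  derive1 (fun s : R => x + s *: w) t = w.
Proof.
rewrite derive1E; have -> : (fun s : R => x + s *: w) = cst x + ( *:%R^~ w) by [].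
have d2 : differentiable ( *:%R^~ w : R -> V) t by [].
have d1 : derivable (cst x : R -> V) t 1 by exact: derivable_cst.
rewrite deriveD //; last exact: diff_derivable.
by rewrite derive_cst add0r deriveE // diff_val scale1r.
Qed.

Lemma open_itv_near (R : realType) (a b t : R) : `]a, b[%classic t ->
  \forall s \near t, `]a, b[%classic s.
Proof. by move=> h; apply: open_nbhs_nbhs; split => //; exact: interval_open. Qed.

(** * Upper bounds for the distance by coordinate segments *)

Section Paths.
Variables (R : realType) (M : topologicalType) (g : riemannian_surface R M).
Hypothesis M_plane : exists f : M -> R * R, homeomorphism f.

Lemma curve_length_ge0 gamma a b : 0 <= curve_length g gamma a b.
Proof. by apply: Rintegral_ge0 => t _; exact: speed_ge0. Qed.

Lemma path_length_ge0 p q l : path_length g p q l -> 0 <= l.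
Proof. by elim=> // gamma a b e r l' _ _ _ _ l0; rewrite addr_ge0 // curve_length_ge0. Qed.

Lemma path_length_cat p q r l l' : path_length g p q l -> path_length g q r l' ->
  path_length g p r (l + l').
Proof.
move=> pq; elim: pq l' => [s|gamma a b e s k ab e0 sm _ IH] l'; first by rewrite add0r.
by rewrite -addrA => /IH; exact: (path_length_cons ab e0 sm).
Qed.

(** Coordinate segments have speed at most [K] times their coordinate length. Both directions are
    built, as separate segments, so that no curve has to be reversed. *)
Lemma short_paths p : exists K : R, 0 < K /\ let c := chart_at g p in
  \forall q \near p, exists l l', [/\ l <= K * `|cfun c q - cfun c p|,
    path_length g p q l, l' <= K * `|cfun c q - cfun c p| & path_length g q p l'].
Proof.
set c := chart_at g p.
have ac : atlas g c := chart_at_atlas g p.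
have hc := atlas_chart ac.
have cp : dom c p := chart_at_dom g p.
have codp : cod c (cfun c p) by exists p.
have [r [k [K [r0 k0 K0 H]]]] := metric_bounds ac codp.
exists K; split => //=.
have seg (x y : R * R) : (forall t : R, - (1 / 2) < t < 1 + 1 / 2 ->
      `|(cfun c p).1 - (x + t *: (y - x)).1| < r /\ `|(cfun c p).2 - (x + t *: (y - x)).2| < r) ->
    exists2 l, l <= K * `|y - x| & path_length g (cinv c x) (cinv c y) l.
  move=> near_p; set w := y - x; pose A (t : R) := x + t *: w.
  (* The pieces of a path must extend beyond their endpoints, here by 1/2 around the segment from 0
     to 1. *)
  pose I : set R := `]0 - 1 / 2, 1 + 1 / 2[%classic.
  have IE t : I t -> cod c (A t) /\ forall v : R * R, Num.sqrt (metric g c (A t) v v) <= K * `|v|.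
    rewrite /I /= in_itv /= => /andP[t1 t2].
    have [|a1 a2] := near_p t; first by apply/andP; split; lra.
    by have [ct h] := H _ a1 a2; split => // v; have /andP[] := h v.
  have I_open t : I t -> \forall s \near t, I s by exact: open_itv_near.
  pose gamma := cinv c \o A.
  have cA t : {for t, continuous A}.
    by apply: cvgD; [exact: cvg_cst | exact: scalel_continuous].
  have sm : smooth_curve_on g I gamma.
    split=> [t /set_mem It|d ad n].
      by apply: (continuous_comp (f := A)); [exact: cA | apply: cinv_cont hc _ _; have [] := IE t It].
    have -> : cfun d \o gamma = fun t => transition c d (A t) by [].
    apply: (class_C_line (transition_smooth ac ad n)) => t [It dt].
    have [ct _] := IE t It; have [d1 d2] := cinvP hc ct.
    by exists (cinv c (A t)) => //; split.
  have sp t : I t -> speed g gamma t <= K * `|w|.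
    move=> It; have [ct h] := IE t It; have [d1 d2] := cinvP hc ct.
    rewrite (speedE I_open sm ac It d1) /= d2.
    have -> : derive1 (cfun c \o gamma) t = w.
      rewrite -(derive1_affine x w t) !derive1E; apply: near_eq_derive.
      by apply: filterS (I_open t It) => s Is; have [cs _] := IE s Is; have [_] := cinvP hc cs.
    exact: h.
  have I01 t : 0 <= t <= 1 -> I t.
    by move=> /andP[? ?]; rewrite /I /= in_itv /=; apply/andP; split; lra.
  exists (curve_length g gamma 0 1 + 0).
    rewrite addr0 -[K * _]mulr1 -[X in _ * X]subr0.
    apply: (@Rintegral_le R (speed g gamma) 0 1) => // t /I01 It; last exact: sp.
    exact: (speed_cont I_open sm).
  have -> : cinv c x = gamma 0 by rewrite /gamma /A /= scale0r addr0.
  have yE : cinv c y = gamma 1 by rewrite /gamma /A /= scale1r addrC subrK.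
  have e0 : (0 : R) < 1 / 2 by rewrite divr_gt0.
  by apply: (path_length_cons ler01 e0 sm); rewrite yE; exact: path_length_nil.
have cr : \forall q \near p, [/\ dom c q, `|(cfun c p).1 - (cfun c q).1| < r / 2 &
    `|(cfun c p).2 - (cfun c q).2| < r / 2].
  have H' : \forall x \near cfun c p, `|(cfun c p).1 - x.1| < r / 2 /\ `|(cfun c p).2 - x.2| < r / 2.
    by apply/nbhsRRP; exists (r / 2) => //; rewrite divr_gt0.
  have H'' : \forall q \near p, `|(cfun c p).1 - (cfun c q).1| < r / 2 /\
      `|(cfun c p).2 - (cfun c q).2| < r / 2 := cfun_cont hc cp H'.
  by apply: filterS2 (dom_open hc cp) H'' => q ? [].
apply: filterS cr => q [cq q1 q2].
(* Extending the segment multiplies coordinate differences by at most 3/2, and 3/2 of [r / 2] is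
   below [r]. *)
have arith1 (a b t : R) : `|a - b| < r / 2 -> - (1 / 2) < t < 1 + 1 / 2 ->
    `|a - (a + t * (b - a))| < r.
  rewrite opprD addNKr normrN normrM => ab /andP[t1 t2].
  have : `|t| <= 1 + 1 / 2 by rewrite ler_norml; apply/andP; split; lra.
  rewrite distrC in ab; have := normr_ge0 (b - a); have := normr_ge0 t.
  move: ab; set u := `|b - a|; set v := `|t|; nra.
have arith2 (a b t : R) : `|a - b| < r / 2 -> - (1 / 2) < t < 1 + 1 / 2 ->
    `|a - (b + t * (a - b))| < r.
  move=> ab /andP[t1 t2]; have -> : a - (b + t * (a - b)) = (1 - t) * (a - b) by ring.
  rewrite normrM; have : `|1 - t| <= 1 + 1 / 2 by rewrite ler_norml; apply/andP; split; lra.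
  have := normr_ge0 (a - b); have := normr_ge0 (1 - t).
  move: ab; set u := `|a - b|; set v := `|1 - t|; nra.
have [|l lK lp] := seg (cfun c p) (cfun c q).
  by move=> t tt; split; exact: arith1.
have [|l' lK' lp'] := seg (cfun c q) (cfun c p).
  by move=> t tt; split; exact: arith2.
rewrite !(cfunK hc) // in lp lp'; exists l, l'; split => //.
by rewrite distrC.
Qed.

(** Being reachable from [p] is locally constant. This makes the infimum in [dist] one over a
    nonempty set, as lower bounds require. *)
Lemma path_exists p q : exists l, path_length g p q l.
Proof.
have := @plane_locally_constant R M M_plane Prop (fun x => exists l, path_length g p x l) _ p q.
move=> <-; first by exists 0; exact: path_length_nil.
move=> x; have [K [K0 H]] := short_paths x; apply: filterS H => y [l [l' [_ xy _ yx]]].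
apply/propext; split => -[k pk]; first by exists (k + l'); exact: path_length_cat yx.
by exists (k + l); exact: path_length_cat xy.
Qed.

Lemma dist_le p q l : path_length g p q l -> dist g p q <= l.
Proof.
by move=> pl; apply: ge_inf => //; exists 0 => k; exact: path_length_ge0.
Qed.

Lemma dist_ge p q m : (forall l, path_length g p q l -> m <= l) -> m <= dist g p q.
Proof. by move=> h; apply: lb_le_inf; [exact: path_exists | exact: h]. Qed.

Lemma dist_ge0 p q : 0 <= dist g p q.
Proof. by apply: dist_ge => l; exact: path_length_ge0. Qed.

Lemma dist_self p : dist g p p = 0.
Proof. by apply/eqP; rewrite eq_le dist_ge0 andbT; apply: dist_le; exact: path_length_nil. Qed.

Lemma dist_triangle p q r : dist g p r <= dist g p q + dist g q r.
Proof.
rewrite -lerBlDr; apply: dist_ge => l pl; rewrite lerBlDr addrC -lerBlDr.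
apply: dist_ge => l' ql; rewrite lerBlDr addrC; apply: dist_le.
exact: path_length_cat ql.
Qed.

Lemma dist_near p e : 0 < e -> \forall q \near p, dist g p q < e /\ dist g q p < e.
Proof.
move=> e0; have [K [K0 H]] := short_paths p; set c := chart_at g p in H.
have cc : {for p, continuous (cfun c)}.
  exact: (cfun_cont (atlas_chart (chart_at_atlas g p)) (chart_at_dom g p)).
have small : \forall q \near p, `|cfun c p - cfun c q| < e / K.
  by move: cc => /cvgrPdist_lt; apply; rewrite divr_gt0.
apply: filterS2 H small => q [l [l' [lK pq lK' qp]]]; rewrite distrC => h.
have hK : K * `|cfun c q - cfun c p| < e by rewrite mulrC -ltr_pdivlMr.
split; first exact: le_lt_trans (dist_le pq) (le_lt_trans lK hK).
exact: le_lt_trans (dist_le qp) (le_lt_trans lK' hK).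
Qed.

End Paths.

Lemma derivable_increment (R : realType) (f : R -> R * R) (u v B : R) : u <= v ->
  (forall t, u <= t <= v -> derivable f t 1 /\ `|derive1 f t| <= B) ->
  `|f v - f u| <= B * (v - u).
Proof.
move=> uv H.
have norm1 (w : R * R) : `|w.1| <= `|w| by rewrite prod_normE le_max lexx.
have norm2 (w : R * R) : `|w.2| <= `|w| by rewrite prod_normE le_max lexx orbT.
have vu : 0 <= v - u by rewrite subr_ge0.
have mvt (k : R -> R) : (forall t, u <= t <= v -> derivable k t 1 /\ `|'D_1 k t| <= B) ->
    `|k v - k u| <= B * (v - u).
  move=> Hk; have [||t] := @MVT_segment R k (fun t => 'D_1 k t) u v uv.
  - move=> t; rewrite in_itv /= => /andP[? ?]; apply: derivableP.
    by apply: (Hk t _).1; apply/andP; split; lra.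
  - apply: continuous_in_subspaceT => t; rewrite inE /= in_itv /= => /Hk[d _].
    by apply: differentiable_continuous; apply/derivable1_diffP.
  rewrite in_itv /= => /Hk[_ b] ->.
  by rewrite normrM (ger0_norm vu) ler_wpM2r.
rewrite prod_normE ge_max; apply/andP; split.
  apply: (mvt (fun t => (f t).1)) => t /H[d b]; have [d1 e1] := derive_fst d.
  by split => //; rewrite e1 -derive1E; apply: le_trans b.
apply: (mvt (fun t => (f t).2)) => t /H[d b]; have [d1 e1] := derive_snd d.
by split => //; rewrite e1 -derive1E; apply: le_trans b.
Qed.

(** * Lower bounds for the distance by a Lipschitz function *)

Section LowerBound.
Variables (R : realType) (M : topologicalType) (g : riemannian_surface R M).
Hypothesis M_plane : exists f : M -> R * R, homeomorphism f.
Variables (p : M) (r0 k : R).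
Let c := chart_at g p.
Hypothesis k0 : 0 < k.
Hypothesis bnd : forall z, `|(cfun c p).1 - z.1| < r0 -> `|(cfun c p).2 - z.2| < r0 ->
  cod c z /\ forall w : R * R, k * `|w| <= Num.sqrt (metric g c z w w).
Variable r : R.
Hypothesis r_gt0 : 0 < r.
Hypothesis r_lt : r < r0.

Let ac : atlas g c := chart_at_atlas g p.
Let hc : is_chart c := atlas_chart ac.
Let N q := `|cfun c p - cfun c q|.

(** A bump of height [r] at [p], vanishing off a small disk. Its variation along a curve, times [k],
    bounds the length from below, so no first exit time from the chart is needed. *)
Definition chart_depth q := if `[< dom c q >] then Num.max 0 (r - N q) else 0.

Definition chart_disk := cinv c @`
  [set z | `|(cfun c p).1 - z.1| <= r /\ `|(cfun c p).2 - z.2| <= r].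

Lemma chart_depth_out q : ~ chart_disk q -> chart_depth q = 0.
Proof.
move=> nK; rewrite /chart_depth; case: asboolP => // cq; apply: max_l.
rewrite subr_le0 leNgt; apply/negP => h; apply: nK; exists (cfun c q); last exact: cfunK.
move: h; rewrite /N prod_normE gt_max /= => /andP[h1 h2].
by split; exact: ltW.
Qed.

Lemma chart_disk_dom q : chart_disk q -> dom c q /\
  `|(cfun c p).1 - (cfun c q).1| <= r /\ `|(cfun c p).2 - (cfun c q).2| <= r.
Proof.
move=> [z [z1 z2] <-]; have [|cz _] := bnd (le_lt_trans z1 r_lt); first exact: le_lt_trans r_lt.
by have [d ->] := cinvP hc cz.
Qed.

(** The disk is the continuous image of a compact square, and [M] is Hausdorff. Hence [chart_depth]
    vanishes around every point off the disk, including those at the edge of the chart domain. *)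
Lemma chart_disk_closed q : ~ chart_disk q -> \forall q' \near q, ~ chart_disk q'.
Proof.
have : closed chart_disk.
  apply: compact_closed; first exact: surface_hausdorff g.
  apply: continuous_compact.
    apply: continuous_in_subspaceT => z /set_mem[z1 z2].
    apply: (cinv_cont hc).
    by have [|cz _] := bnd (le_lt_trans z1 r_lt); first exact: le_lt_trans r_lt.
  have -> : [set z : R * R | `|(cfun c p).1 - z.1| <= r /\ `|(cfun c p).2 - z.2| <= r] =
      `[(cfun c p).1 - r, (cfun c p).1 + r]%classic `*`
      `[(cfun c p).2 - r, (cfun c p).2 + r]%classic.
    by apply/seteqP; split => z; rewrite /= !in_itv /= !ler_distlC.
  by apply: compact_setX; exact: segment_compact.
by move=> cl nq; apply: (@open_nbhs_nbhs _ q (~` chart_disk)); split => //; exact: closed_openC.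
Qed.

Lemma chart_depth_lip q q' : dom c q -> dom c q' ->
  chart_depth q - chart_depth q' <= `|cfun c q' - cfun c q|.
Proof.
move=> cq cq'; rewrite /chart_depth !asboolT //.
have : N q' <= N q + `|cfun c q' - cfun c q|.
  have -> : N q' = `|(cfun c p - cfun c q) + (cfun c q - cfun c q')|.
    by rewrite addrA subrK.
  by rewrite (distrC (cfun c q')); exact: ler_normD.
have := normr_ge0 (cfun c q' - cfun c q).
by case: (leP 0 (r - N q)); case: (leP 0 (r - N q')); lra.
Qed.

(* Locally both sides are controlled by the norm of the velocity at one instant,
   up to an arbitrarily small multiple of the elapsed time. *)
Lemma curve_length_ge gamma a b e : a <= b -> 0 < e ->
  smooth_curve_on g `]a - e, b + e[%classic gamma ->
  k * (chart_depth (gamma a) - chart_depth (gamma b)) <= curve_length g gamma a b.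
Proof.
move=> ab e0 sm; set I := `]a - e, b + e[%classic in sm.
have I_open t : I t -> \forall s \near t, I s by exact: open_itv_near.
have Iab t : a <= t <= b -> I t.
  by move=> /andP[? ?]; rewrite /I /= in_itv /=; apply/andP; split; lra.
have k_gt0 := k0; have r_lt' := r_lt.
have cs t : a <= t <= b -> {for t, continuous (speed g gamma)}.
  by move=> /Iab; exact: (speed_cont I_open sm).
have L_ge0 u v : 0 <= curve_length g gamma u v by exact: curve_length_ge0.
apply/ler_addgt0Pr => eta' eta'0.
(* The total error [eta * (b - a)] is at most [eta']; the added 1 keeps the denominator positive
   when [a = b]. *)
pose eta := eta' / (b - a + 1).
have eta0 : 0 < eta by rewrite divr_gt0 //; lra.
suff H : forall u v, u <= v -> a <= u -> v <= b ->
    k * (chart_depth (gamma u) - chart_depth (gamma v)) <=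
    curve_length g gamma u v + eta * (v - u).
  apply: le_trans (H a b ab (lexx a) (lexx b)) _; rewrite lerD2l /eta.
  rewrite mulrAC ler_pdivrMr; last lra.
  by rewrite ler_pM2l //; lra.
apply: interval_ind.
  move=> u v w uv vw Huv Hvw au wb.
  have := Huv au (le_trans vw wb); have := Hvw (le_trans au uv) wb.
  have -> : curve_length g gamma u w = curve_length g gamma u v + curve_length g gamma v w.
    exact: (Rintegral_chasles cs au uv vw wb).
  set X := chart_depth (gamma u); set Y := chart_depth (gamma v).
  set Z := chart_depth (gamma w); set L1 := curve_length _ _ _ _.
  set L2 := curve_length _ _ _ _ => h1 h2.
  have -> : k * (X - Z) = k * (X - Y) + k * (Y - Z) by ring.
  have -> : eta * (w - u) = eta * (v - u) + eta * (w - v) by ring.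
  lra.
move=> t0.
have [ta|at0] := ltP t0 a.
  by exists (a - t0); rewrite ?subr_gt0 // => u v h1 h2 h3 h4 _; exfalso; lra.
have [bt|tb] := ltP b t0.
  by exists (t0 - b); rewrite ?subr_gt0 // => u v h1 h2 h3 _ h4; exfalso; lra.
have It0 : I t0 by apply: Iab; rewrite at0.
have cg := curve_cont sm It0.
have [Kt|nKt] := pselect (chart_disk (gamma t0)); last first.
  have H : \forall s \near t0, ~ chart_disk (gamma s) := cg _ (chart_disk_closed nKt).
  have /nbhsRP[d d0 hd] := H; exists d => // u v h1 h2 h3 _ _.
  rewrite !chart_depth_out; last 2 first.
  - by apply: hd; rewrite ltr_distlC; apply/andP; split; lra.
  - by apply: hd; rewrite ltr_distlC; apply/andP; split; lra.
  by rewrite subrr mulr0 addr_ge0 // mulr_ge0 ?subr_ge0 // ltW.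
have [ct [n1 n2]] := chart_disk_dom Kt.
pose w s := derive1 (cfun c \o gamma) s.
have [_ cw] := curve_chart_derive sm ac It0 ct.
(* The upper bound for the displacement uses speed [|w t0| + eps], the lower bound for the length
   [|w t0| - eps]; after multiplication by [k] they differ by [eta] per unit of time. *)
pose eps := eta / (2 * k).
have eps0 : 0 < eps by rewrite divr_gt0 // mulr_gt0.
have nw : \forall s \near t0, `|w t0 - w s| < eps.
  by move: cw => /cvgrPdist_lt /(_ _ eps0).
have cc := curve_cfun_cont sm ac It0 ct.
have nn : \forall s \near t0, `|(cfun c p).1 - (cfun c (gamma s)).1| < r0 /\
    `|(cfun c p).2 - (cfun c (gamma s)).2| < r0.
  have H : \forall z \near cfun c (gamma t0), `|(cfun c p).1 - z.1| < r0 /\ `|(cfun c p).2 - z.2| < r0.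
    apply/nbhsRRP; exists (r0 - r); first by rewrite subr_gt0.
    move: n1 n2; rewrite !ler_distlC => /andP[? ?] /andP[? ?] z.
    rewrite !ltr_distlC => /andP[? ?] /andP[? ?].
    by split; apply/andP; split; lra.
  exact: (cc _ H).
have nI := curve_chart_open I_open sm ac It0 ct.
have H : \forall s \near t0, [/\ I s, dom c (gamma s), `|w t0 - w s| < eps &
    `|(cfun c p).1 - (cfun c (gamma s)).1| < r0 /\ `|(cfun c p).2 - (cfun c (gamma s)).2| < r0].
  by apply: filterS3 nI nw nn => s [].
have /nbhsRP[d d0 hd] := H; exists d => // u v tu uv vt au vb.
have hs s : u <= s <= v -> [/\ I s, dom c (gamma s), `|w t0 - w s| < eps &
    `|(cfun c p).1 - (cfun c (gamma s)).1| < r0 /\ `|(cfun c p).2 - (cfun c (gamma s)).2| < r0].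
  by move=> /andP[? ?]; apply: hd; rewrite ltr_distlC; apply/andP; split; lra.
have cu : dom c (gamma u) by have [|] := hs u; rewrite ?lexx.
have cv : dom c (gamma v) by have [|] := hs v; rewrite ?lexx ?uv.
have wle s : u <= s <= v -> `|w s| <= `|w t0| + eps /\ `|w t0| - eps <= `|w s|.
  move=> /hs[_ _ ws _].
  have h1 : `|w s| <= `|w t0| + `|w t0 - w s|.
    by rewrite distrC -{1}(subrK (w t0) (w s)) addrC; exact: ler_normD.
  have h2 : `|w t0| <= `|w s| + `|w t0 - w s|.
    by rewrite -{1}(subrK (w s) (w t0)) addrC; exact: ler_normD.
  split; first by apply: le_trans h1 _; rewrite lerD2l ltW.
  by rewrite lerBlDr; apply: le_trans h2 _; rewrite lerD2l ltW.
have dw s : u <= s <= v ->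
    derivable (cfun c \o gamma) s 1 /\ `|derive1 (cfun c \o gamma) s| <= `|w t0| + eps.
  move=> us; have [Is ds _ _] := hs s us.
  exact: (conj (curve_chart_derive sm ac Is ds).1 (wle s us).1).
have inc := derivable_increment uv dw.
have Lge : k * (`|w t0| - eps) * (v - u) <= curve_length g gamma u v.
  apply: (Rintegral_ge cs) => // s us; have [Is ds _ [m1 m2]] := hs s us.
  rewrite (speedE I_open sm ac Is ds); have [_ /(_ (w s)) h] := bnd m1 m2.
  by apply: le_trans h; rewrite ler_pM2l //; exact: (proj2 (wle s us)).
apply: (@le_trans _ _ (k * ((`|w t0| + eps) * (v - u)))).
  by rewrite ler_pM2l //; apply: le_trans (chart_depth_lip cu cv) _.
have -> : eta = 2 * k * eps.
  by rewrite /eps mulrC divfK // mulf_eq0 negb_or pnatr_eq0 /= gt_eqF.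
have -> : k * ((`|w t0| + eps) * (v - u)) =
    k * (`|w t0| - eps) * (v - u) + 2 * k * eps * (v - u) by ring.
by rewrite lerD2r.
Qed.

Lemma path_length_ge q q' l : path_length g q q' l ->
  k * (chart_depth q - chart_depth q') <= l.
Proof.
elim=> [s|gamma a b e s m ab e0 sm _ IH]; first by rewrite subrr mulr0.
have := curve_length_ge ab e0 sm; move: IH.
set X := chart_depth (gamma a); set Y := chart_depth (gamma b); set Z := chart_depth s.
have -> : k * (X - Z) = k * (X - Y) + k * (Y - Z) by ring.
by move=> *; exact: lerD.
Qed.

Lemma dist_out q : ~ chart_disk q -> k * r <= dist g p q.
Proof.
move=> nq; apply: (dist_ge M_plane) => l /path_length_ge.
rewrite (chart_depth_out nq) subr0 /chart_depth asboolT; last exact: chart_at_dom.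
by rewrite /N subrr normr0 subr0 max_r // ltW.
Qed.

End LowerBound.

Section DistTopology.
Variables (R : realType) (M : topologicalType) (g : riemannian_surface R M).
Hypothesis M_plane : exists f : M -> R * R, homeomorphism f.

Lemma nbhs_dist p (U : set M) : nbhs p U ->
  exists2 e : R, 0 < e & forall q, dist g p q < e -> U q.
Proof.
move=> pU; set c := chart_at g p.
have ac : atlas g c := chart_at_atlas g p.
have hc := atlas_chart ac.
have cp : dom c p := chart_at_dom g p.
have codp : cod c (cfun c p) by exists p.
have [r [k [K [r0 k0 K0 H]]]] := metric_bounds ac codp.
have nU : nbhs (cinv c (cfun c p)) U by rewrite cfunK.
have HU : \forall z \near cfun c p, U (cinv c z) := cinv_cont hc codp nU.
have /nbhsRRP[d d0 hd] := HU.
pose r1 := Num.min (r / 2) (d / 2).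
have r10 : 0 < r1 by rewrite lt_min !divr_gt0.
have r1r : r1 < r by rewrite gt_min; apply/orP; left; rewrite ltr_pdivrMr // ltr_pMr // ltr1n.
have r1d : r1 < d.
  by rewrite gt_min; apply/orP; right; rewrite ltr_pdivrMr // ltr_pMr // ltr1n.
have bnd z : `|(cfun c p).1 - z.1| < r -> `|(cfun c p).2 - z.2| < r ->
    cod c z /\ forall w : R * R, k * `|w| <= Num.sqrt (metric g c z w w).
  by move=> z1 z2; have [cz h] := H z z1 z2; split => // w; have /andP[] := h w.
exists (k * r1); first exact: mulr_gt0.
move=> q qlt; have [[z [z1 z2] <-]|nq] := pselect (chart_disk g p r1 q).
  by apply: hd; exact: le_lt_trans r1d.
by have := dist_out M_plane k0 bnd r10 r1r nq; rewrite leNgt qlt.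
Qed.

End DistTopology.

(** * From the geodesic foliation to a lined plane *)

Section LinedPlane.
Variables (R : realType) (M : topologicalType).
Variables (g : riemannian_surface R M) (F : foliation R M).
Hypothesis M_plane : exists f : M -> R * R, homeomorphism f.
Hypothesis F_geodesic : geodesic_line_foliation g F.

Lemma leaf_sym p q : leaf F p q -> leaf F q p.
Proof.
elim=> [x y [c [fc cx cy e]]|x|x y z _ xy _ yz]; first by apply: rt_step; exists c.
  exact: rt_refl.
exact: rt_trans yz xy.
Qed.

(** The average is symmetric without any reversal of curves, and it leaves the distance unchanged
    along the leaves, where it is already symmetric. *)
Let D p q := (dist g p q + dist g q p) / 2.

Lemma sym_dist_nbhs p (U : set M) :
  nbhs p U <-> exists2 e : R, 0 < e & forall q, D p q < e -> U q.
Proof.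
split=> [/(nbhs_dist g M_plane)[e e0 h]|[e e0 h]].
  exists (e / 2) => [|q]; first by rewrite divr_gt0.
  by rewrite /D => pq; apply: h; have := dist_ge0 g M_plane q p; lra.
by apply: filterS (dist_near g p e0) => q [h1 h2]; apply: h; rewrite /D; lra.
Qed.

Lemma leaf_line p : exists gamma : R -> M, [/\ gamma 0 = p,
  forall s t, D (gamma s) (gamma t) = `|s - t| &
  forall q, leaf F p q <-> exists t, q = gamma t].
Proof.
have [gamma [_ isom] E] := F_geodesic (ex_intro2 _ _ p I erefl : leaves F (leaf F p)).
have [t0 _ t0p] : range gamma p by rewrite -E; exact: rt_refl.
exists (fun t => gamma (t0 + t)); split; first by rewrite addr0.
  by move=> s t; rewrite /D !isom (distrC (t0 + t)) opprD addrACA subrr add0r; lra.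
move=> q; rewrite E; split=> [[t _ <-]|[t ->]]; last by exists (t0 + t).
by exists (t - t0); rewrite addrC subrK.
Qed.

Lemma lined_plane_exists : exists S : lined_plane R M,
  same_leaf S = fun p q => leaf F p q.
Proof.
have [ln lnP] := choice leaf_line.
unshelve eexists (@LinedPlane R M D _ _ _ sym_dist_nbhs (fun p q => leaf F p q) _ _ _ ln _ _ _ M_plane).
- by move=> p; rewrite /D (dist_self g M_plane) // addr0 mul0r.
- by move=> p q; rewrite /D addrC.
- move=> q p r; rewrite /D.
  have := dist_triangle g M_plane p q r; have := dist_triangle g M_plane r q p; lra.
- exact: leaf_sym.
- by move=> q p r pq qr; exact: rt_trans pq qr.
- move=> p; have [c fc cp] := fatlas_cover F p; exists c => //; split.
  + exact: fatlas_chart fc.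
  + exact: fatlas_rectangle fc.
  + by move=> q r cq cr e; apply: rt_step; exists c.
- by move=> p; have [] := lnP p.
- by move=> p; have [] := lnP p.
- by move=> p q; have [] := lnP p.
- by [].
Qed.

End LinedPlane.

Theorem theorem1p3 (R : realType) (M : topologicalType)
    (g : riemannian_surface R M) (F : foliation R M)
    (M_plane : exists f : M -> R * R, homeomorphism f)
    (g_complete : complete_surface g)
    (F_geodesic : geodesic_line_foliation g F) :
  exists h : M -> R * R, homeomorphism h /\
    [set h @` L | L in leaves F] =
    [set [set: R] `*` [set c] | c in [set: R]].
Proof.
have [S SE] := lined_plane_exists M_plane F_geodesic.
have [G] := geodesic_flow_exists S.
(* The inverse homeomorphism provides a base point [f' 0] of [M]. *)
have [_ [_ [f' _]]] := M_plane.
have [h [f [homeo_h hL fsurj]]] :=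
  trivialization G (surface_second_countable g) (f' 0).
rewrite SE in hL; exists h; split => //; apply/seteqP; split.
  by move=> _ [_ [p _ <-] <-]; exists (f p) => //; rewrite -hL.
move=> _ [c _ <-]; have [p <-] := fsurj c.
by exists (leaf F p); [exists p | exact: hL].
Qed.
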